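(* Let $k$ be an algebraically closed field, let $\mathbf{q}=(q_{ij})$ be a multiplicatively antisymmetric $n\times n$ matrix over $k$, let $A=\mathcal{O}_{\mathbf{q}}(k^n)$ be the corresponding quantum affine space, and let $R=\mathcal{O}(k^n)=k[y_1,\dots,y_n]$. Assume further that $-1\notin\langle q_{ij}\rangle$ (the subgroup of $k^\times$ generated by the $q_{ij}$) or that $\operatorname{char} k=2$. Let $H=(k^\times)^n$ act by $k$-algebra automorphisms on $A$ and on $R$ in the standard manner. Then there exist $H$-equivariant topological quotient maps $$\operatorname{spec} R\rightarrow \operatorname{spec} A\qquad\text{and}\qquad \operatorname{max} R\rightarrow \operatorname{prim} A$$ given by $P\mapsto \Phi^{-1}(P:S_w^{\perp})$ for $P\in\operatorname{spec}_w R$ (where $w$ ranges over the subsets of $\{1,\dots,n\}$). The fibers of the second map, over points in $\operatorname{prim}_w A$, consist precisely of the $S_w^{\perp}$-orbits within $\operatorname{max}_w R$.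
   Context: Topology: $\operatorname{spec}$ of a ring is its set of prime ideals (an ideal $P$ is prime if it is proper and contains no product of two ideals neither of which is contained in $P$), with the Zariski topology whose closed sets are the sets $\{P\mid P\supseteq I\}$ for ideals $I$; $\operatorname{prim}$ (left primitive ideals) and $\operatorname{max}$ (maximal ideals) carry the relative topology. A map $\phi:X\to Y$ of topological spaces is a topological quotient map if it is surjective and $W\subseteq Y$ is closed exactly when $\phi^{-1}(W)$ is closed. Quantum affine space: $\mathbf{q}$ multiplicatively antisymmetric means all $q_{ij}\in k^\times$, $q_{ii}=1$, $q_{ji}=q_{ij}^{-1}$. $A=\mathcal{O}_{\mathbf{q}}(k^n)$ is the $k$-algebra generated by $x_1,\dots,x_n$ subject only to $x_ix_j=q_{ij}x_jx_i$ for all $i,j$. Cocycle and the map $\Phi$: let $\Gamma=\mathbb{Z}^n$ with standard basis $\epsilon_1,\dots,\epsilon_n$ and $\Gamma^+=(\mathbb{Z}_{\ge 0})^n$. Let $\sigma:\Gamma\times\Gamma\to k^\times$ be the alternating bicharacter $\sigma(\alpha,\beta)=\prod_{i,j=1}^n q_{ij}^{\alpha_i\beta_j}$. Under the hypotheses there is an alternating bicharacter $c:\Gamma\times\Gamma\to k^\times$ with $c^2=\sigma$ and $c(\alpha,\beta)=1$ whenever $\sigma(\alpha,\beta)=1$; fix such a $c$. (''Alternating bicharacter'': $c(\alpha,\alpha)=1$, $c(\beta,\alpha)=c(\alpha,\beta)^{-1}$, $c(\alpha,\beta+\beta')=c(\alpha,\beta)c(\alpha,\beta')$.) Then $A$ is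 identified with the twisted semigroup algebra $k^c\Gamma^+$, having $k$-basis $\{x_\alpha\mid\alpha\in\Gamma^+\}$ with $x_\alpha x_\beta=c(\alpha,\beta)x_{\alpha+\beta}$ and $x_{\epsilon_i}=x_i$. Likewise $R=k\Gamma^+$ has $k$-basis $\{y_\alpha\mid \alpha\in\Gamma^+\}$ with $y_\alpha y_\beta=y_{\alpha+\beta}$ and $y_{\epsilon_i}=y_i$. $\Phi:A\to R$ is the $k$-linear isomorphism with $\Phi(x_\alpha)=y_\alpha$. Torus action: $H=(k^\times)^n$ is identified with $\operatorname{Hom}(\Gamma,k^\times)$, with pairing $\langle h,\alpha\rangle=\prod_i h_i^{\alpha_i}$; it acts by $h.x_\alpha=\langle h,\alpha\rangle x_\alpha$ and $h.y_\alpha=\langle h,\alpha\rangle y_\alpha$, and hence on the spaces of ideals. Strata: for $w\subseteq\{1,\dots,n\}$, $\operatorname{spec}_wR=\{P\in\operatorname{spec}R\mid P\cap\{y_1,\dots,y_n\}=\{y_i\mid i\in w\}\}$, $\operatorname{max}_wR=\operatorname{max}R\cap\operatorname{spec}_wR$, $\operatorname{spec}_wA=\{P\in\operatorname{spec}A\mid P\cap\{x_1,\dots,x_n\}=\{x_i\mid i\in w\}\}$, $\operatorname{prim}_wA=\operatorname{prim}A\cap\operatorname{spec}_wA$. Let $\Gamma_w$ be the subgroup of $\Gamma$ generated by $\{\epsilon_i\mid i\notin w\}$, $S_w=\{\alpha\in\Gamma_w\mid\sigma(\alpha,\beta)=1\text{ for all }\beta\in\Gamma_w\}$, and $S_w^\perp=\{h\in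 H\mid\langle h,\alpha\rangle=1\text{ for all }\alpha\in S_w\}$. For a subgroup $G$ of $H$ and an ideal $I$, $(I:G)=\bigcap_{g\in G}g(I)$. *)

(* Defs.v *)
From HB Require Import structures.
From mathcomp Require Import all_boot all_order all_algebra.
From mathcomp Require Import mpoly.
From mathcomp Require Import boolp classical_sets.
From mathcomp Require Import topology_structure initial_topology subtype_topology.

Set Implicit Arguments.
Unset Strict Implicit.
Unset Printing Implicit Defensive.

Import Order.TTheory GRing.Theory Num.Theory.
Local Open Scope classical_set_scope.
Local Open Scope ring_scope.

Section Ideals.
Variable B : nzRingType.
Implicit Types I J P : set B.

(* Two-sided; when B is an algebra over a field these are also its
   algebra ideals, since c *: a = (c *: 1) * a. *)
Definition is_ideal I :=
  [/\ I 0, forall a b, I a -> I b -> I (a + b)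
    & forall a b, I b -> I (a * b) /\ I (b * a)].

Definition ideal_product I J : set B :=
  [set a | exists2 s : seq (B * B),
     (forall u, u \in s -> I u.1 /\ J u.2) & a = \sum_(u <- s) u.1 * u.2].

Definition is_prime_ideal P :=
  [/\ is_ideal P, P != setT
    & forall I J, is_ideal I -> is_ideal J ->
        ideal_product I J `<=` P -> I `<=` P \/ J `<=` P].

Definition is_maximal_ideal P :=
  [/\ is_ideal P, P != setT
    & forall I, is_ideal I -> P `<=` I -> I = P \/ I = setT].

Definition is_submodule (M : lmodType B) (N : set M) :=
  [/\ N 0, forall u v, N u -> N v -> N (u + v)
    & forall a u, N u -> N (a *: u)].

Definition is_simple_module (M : lmodType B) :=
  (exists m : M, m != 0) /\
  forall N : set M, is_submodule N -> N = [set 0] \/ N = setT.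

Definition is_left_primitive_ideal P :=
  exists2 M : lmodType B, is_simple_module M
    & P = [set a | forall m : M, a *: m = 0].

Lemma ideal_opp I a : is_ideal I -> I a -> I (- a).
Proof. by case=> _ _ IM Ia; rewrite -mulN1r; case: (IM (-1) a Ia). Qed.

Lemma ideal_productP I J P : is_ideal P ->
  ideal_product I J `<=` P <-> (forall a b, I a -> J b -> P (a * b)).
Proof.
move=> [P0 PD _]; split=> [IJP a b Ia Jb|IJP _ [s sIJ ->]].
  apply: IJP; exists [:: (a, b)]; last by rewrite big_seq1.
  by move=> u; rewrite inE => /eqP ->.
rewrite big_seq; elim/big_ind: _ => //.
by move=> u /sIJ [Iu Ju]; apply: IJP.
Qed.

Lemma maximal_ideal_prime P : is_maximal_ideal P -> is_prime_ideal P.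
Proof.
move=> [idP PT Pmax]; split=> // I J idI idJ /(ideal_productP _ _ idP) IJP.
have sum_ideal K : is_ideal K ->
    is_ideal [set a | exists b c, [/\ P b, K c & a = b + c]].
  case: idP => [P0 PD PM] [K0 KD KM]; split.
  - by exists 0, 0; rewrite addr0.
  - move=> _ _ [b [c [Pb Kc ->]]] [b' [c' [Pb' Kc' ->]]].
    by exists (b + b'), (c + c'); rewrite addrACA; split; auto.
  - move=> a _ [b [c [Pb Kc ->]]]; split.
      exists (a * b), (a * c); rewrite mulrDr.
      by split=> //; [case: (PM a b Pb)|case: (KM a c Kc)].
    exists (b * a), (c * a); rewrite mulrDl.
    by split=> //; [case: (PM a b Pb)|case: (KM a c Kc)].
have [IP|nIP] := pselect (I `<=` P); first by left.
have [JP|nJP] := pselect (J `<=` P); first by right.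
have one K : is_ideal K -> ~ K `<=` P -> exists b c, [/\ P b, K c & 1 = b + c].
  move=> idK nKP; have [P0 _ _] := idP; have [K0 _ _] := idK.
  have [a Pa|PE|KT] := Pmax _ (sum_ideal K idK).
  - by exists a, 0; rewrite addr0.
  - case: nKP => a Ka; rewrite -PE; exists 0, a; by rewrite add0r.
  - have : [set: B] 1 by [].
    by rewrite -KT.
have [b [c [Pb Ic E1]]] := one I idI nIP.
have [b' [c' [Pb' Jc' E2]]] := one J idJ nJP.
have [P0 PD PM] := idP; case/eqP: PT.
apply/seteqP; split=> // a _; have P1 : P 1.
  have -> : 1 = b * (b' + c') + (c * b' + c * c').
    by rewrite -mulrDr -mulrDl -E1 -E2 mulr1.
  apply: (PD); first by case: (PM (b' + c') b Pb).
  by apply: PD; [case: (PM c b' Pb')|apply: IJP].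
by rewrite -[a]mulr1; case: (PM a 1 P1).
Qed.

Lemma left_primitive_ideal_prime P :
  is_left_primitive_ideal P -> is_prime_ideal P.
Proof.
move=> [M [[m0 m0N0] Msimple] PE].
have idP : is_ideal P.
  rewrite PE; split=> /=.
  - by move=> m; rewrite scale0r.
  - by move=> a b Ia Ib m; rewrite scalerDl Ia Ib addr0.
  - by move=> a b Ib; split=> m; rewrite -scalerA Ib // scaler0.
split=> //.
  apply/eqP => PT; have : P 1 by rewrite PT.
  by rewrite PE => /(_ m0); rewrite scale1r => /eqP; rewrite (negPf m0N0).
move=> I J idI idJ /(ideal_productP _ _ idP) IJP.
have [JP|nJP] := pselect (J `<=` P); [by right|left].
have /asboolPn/existsp_asboolPn [b /not_implyP [Jb nPb]] := nJP.
have [m bm] : exists m : M, b *: m != 0.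
  apply: contrapT => H; apply: nPb; rewrite PE => m.
  by apply/eqP; apply: contrapT => /negP ?; apply: H; exists m.
pose N := [set u : M | exists2 a, J a & u = a *: m].
have subN : is_submodule N.
  case: (idJ) => J0 JD JM; split.
  - by exists 0; rewrite ?scale0r.
  - move=> _ _ [a Ja ->] [a' Ja' ->]; exists (a + a'); first exact: JD.
    by rewrite scalerDl.
  - move=> a _ [a' Ja' ->]; exists (a * a'); last by rewrite scalerA.
    by case: (JM a a' Ja').
have [N0|NT] := Msimple N subN.
  have : N (b *: m) by exists b.
  by rewrite N0 => /eqP; rewrite (negPf bm).
move=> a Ia; rewrite PE => u.
have [c Jc ->] : N u by rewrite NT.
by have := IJP a c Ia Jc; rewrite PE scalerA => /(_ m).
Qed.

End Ideals.

Record spec (B : nzRingType) := Spec {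
  ideal_of :> set B;
  spec_prime : is_prime_ideal ideal_of }.

Lemma spec_inj (B : nzRingType) : injective (@ideal_of B).
Proof.
move=> [P hP] [Q hQ] /= PQ; move: hP hQ; rewrite PQ => hP hQ.
by congr Spec; apply: Prop_irrelevance.
Qed.

HB.instance Definition _ (B : nzRingType) := gen_eqMixin (spec B).
HB.instance Definition _ (B : nzRingType) := gen_choiceMixin (spec B).

Section Zariski.
Variable B : nzRingType.

Definition vanishing (I : set B) : set (spec B) := [set P | I `<=` P].

Definition zariski_open (U : set (spec B)) :=
  exists2 I, is_ideal I & ~` U = vanishing I.

Lemma zariski_openT : zariski_open setT.
Proof.
exists setT; first by split.
rewrite setCT; apply/seteqP; split=> // P TP.
have [_ /eqP + _] := spec_prime P; apply.
by apply/seteqP; split=> // a; exact: TP.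
Qed.

Lemma zariski_openI : setI_closed zariski_open.
Proof.
move=> U V [I idI UI] [J idJ VJ]; exists (I `&` J).
  case: idI idJ => [I0 ID IM] [J0 JD JM]; split=> //.
  - by move=> a b [Ia Ja] [Ib Jb]; split; auto.
  - move=> a b [Ib Jb].
    by split; split; by [case: (IM a b Ib)|case: (JM a b Jb)].
rewrite setCI UI VJ; apply/seteqP; split=> P.
  by move=> [IP|JP] a [Ia Ja]; [apply: IP|apply: JP].
move=> IJP; have [idP _ +] := spec_prime P; apply=> //.
apply/(ideal_productP _ _ idP) => a b Ia Jb; apply: IJP.
by split; [case: idI => _ _ /(_ b a Ia) []|case: idJ => _ _ /(_ a b Jb) []].
Qed.

Lemma zariski_open_bigU (T : Type) (f : T -> set (spec B)) :
  (forall i, zariski_open (f i)) -> zariski_open (\bigcup_i f i).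
Proof.
move=> fop.
have idl i : exists I, is_ideal I /\ ~` f i = vanishing I.
  by case: (fop i) => I; exists I.
have [I fIP] := choice idl.
have II i : is_ideal (I i) by case: (fIP i).
have fI i : ~` f i = vanishing (I i) by case: (fIP i).
exists [set a | forall K, is_ideal K -> (forall i, I i `<=` K) -> K a].
  split=> /=.
  - by move=> K [].
  - move=> a b Ka Kb K idK IK; have [_ KD _] := idK.
    by apply: KD; [exact: Ka|exact: Kb].
  - move=> a b Kb; split=> K idK IK;
    by case: (idK) => _ _ /(_ a b (Kb K idK IK)) [].
apply/seteqP; split=> P.
  move=> nfP a /(_ P); apply; first by case: (spec_prime P).
  move=> i; suff : vanishing (I i) P by [].
  by rewrite -fI => fiP; apply: nfP; exists i.
move=> IP [i _ fiP]; suff : (~` f i) P by [].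
by rewrite fI => a Ia; apply: IP => K _ /(_ i); exact.
Qed.

HB.instance Definition _ := isOpenTopological.Build (spec B)
  zariski_openT zariski_openI zariski_open_bigU.

Lemma zariski_closedP (W : set (spec B)) :
  closed W <-> exists2 I, is_ideal I & W = vanishing I.
Proof.
rewrite -openC.
change (zariski_open (~` W) <-> exists2 I, is_ideal I & W = vanishing I).
by rewrite /zariski_open setCK.
Qed.

(* Maximal and left primitive ideals are prime (maximal_ideal_prime,
   left_primitive_ideal_prime), so nothing is lost by carving max and prim out
   of spec.  Coerced to types (set_type), these sets carry the relative
   topology. *)
Definition max_spec : set (spec B) := [set P | is_maximal_ideal P].
Definition prim_spec : set (spec B) := [set P | is_left_primitive_ideal P].

End Zariski.

Arguments max_spec : clear implicits.
Arguments prim_spec : clear implicits.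

Definition topological_quotient_map (X Y : topologicalType) (f : X -> Y) :=
  range f = setT /\ forall W : set Y, closed W <-> closed (f @^-1` W).

Section Torus.
Variables (k : fieldType) (n : nat).

(* H = (k \ {0})^n *)
Record torus := Torus {
  torus_val :> {ffun 'I_n -> k};
  torus_neq0 : [forall i, torus_val i != 0] }.

HB.instance Definition _ := [isSub for torus_val].

Lemma torusP (h : torus) i : h i != 0.
Proof. by have /forallP := torus_neq0 h. Qed.

Lemma torus_one_subproof : [forall i, [ffun _ : 'I_n => 1 : k] i != 0].
Proof. by apply/forallP => i; rewrite ffunE oner_neq0. Qed.
Definition torus_one := Torus torus_one_subproof.

Lemma torus_mul_subproof (g h : torus) :
  [forall i, [ffun i : 'I_n => g i * h i] i != 0].
Proof. by apply/forallP => i; rewrite ffunE mulf_neq0 ?torusP. Qed.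
Definition torus_mul (g h : torus) := Torus (torus_mul_subproof g h).

Lemma torus_inv_subproof (h : torus) :
  [forall i, [ffun i : 'I_n => (h i)^-1] i != 0].
Proof. by apply/forallP => i; rewrite ffunE invr_neq0 ?torusP. Qed.
Definition torus_inv (h : torus) := Torus (torus_inv_subproof h).

Lemma torus_mulV h : torus_mul h (torus_inv h) = torus_one.
Proof. by apply/val_inj/ffunP => i; rewrite !ffunE mulfV ?torusP. Qed.

Lemma torus_mulVl h : torus_mul (torus_inv h) h = torus_one.
Proof. by apply/val_inj/ffunP => i; rewrite !ffunE mulVf ?torusP. Qed.

Record torus_action (B : algType k) := TorusAction {
  torus_act :> torus -> {lrmorphism B -> B};
  torus_act1 : forall a, torus_act torus_one a = a;
  torus_actM : forall g h a,
    torus_act (torus_mul g h) a = torus_act g (torus_act h a) }.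

Definition is_standard_action (B : algType k) (x : 'I_n -> B)
    (act : torus_action B) :=
  forall h i, act h (x i) = h i *: x i.

(* (I : G) *)
Definition colon (B : algType k) (act : torus_action B) (I : set B)
    (G : set torus) : set B :=
  \bigcap_(g in G) (act g @` I).

Section SpecAction.
Variables (B : algType k) (act : torus_action B).

Lemma torus_actK h : cancel (act h) (act (torus_inv h)).
Proof. by move=> a; rewrite -torus_actM torus_mulVl torus_act1. Qed.

Lemma torus_actVK h : cancel (act (torus_inv h)) (act h).
Proof. by move=> a; rewrite -torus_actM torus_mulV torus_act1. Qed.

Lemma act_imageE h (I : set B) : act h @` I = act (torus_inv h) @^-1` I.
Proof.
apply/seteqP; split=> a /=; first by move=> [b Ib <-]; rewrite torus_actK.
by move=> Ia; exists (act (torus_inv h) a); rewrite ?torus_actVK.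
Qed.

Lemma act_preimage_ideal h (I : set B) : is_ideal I -> is_ideal (act h @^-1` I).
Proof.
move=> [I0 ID IM]; split=> /=; first by rewrite raddf0.
  by move=> a b Ia Ib; rewrite raddfD; apply: ID.
by move=> a b Ib; rewrite !rmorphM; apply: IM.
Qed.

Lemma act_image_ideal h (I : set B) : is_ideal I -> is_ideal (act h @` I).
Proof. by rewrite act_imageE; apply: act_preimage_ideal. Qed.

Lemma act_image_proper h (I : set B) : I != setT -> act h @` I != setT.
Proof.
apply: contra => /eqP IT; apply/eqP/seteqP; split=> // a _.
have : [set: B] (act h a) by [].
by rewrite -IT act_imageE /= torus_actK.
Qed.

Lemma act_image_prime h (P : set B) :
  is_prime_ideal P -> is_prime_ideal (act h @` P).
Proof.
move=> [idP PT Pprime]; have idhP := act_image_ideal h idP.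
split=> //; first exact: act_image_proper.
move=> I J idI idJ /(ideal_productP _ _ idhP) IJP.
have [|IP|JP] := Pprime _ _ (act_preimage_ideal h idI)
                             (act_preimage_ideal h idJ).
- apply/(ideal_productP _ _ idP) => a b /= Ia Jb.
  by have := IJP _ _ Ia Jb; rewrite -rmorphM act_imageE /= torus_actK.
- by left=> a Ia; rewrite act_imageE; apply: IP; rewrite /= torus_actVK.
- by right=> a Ja; rewrite act_imageE; apply: JP; rewrite /= torus_actVK.
Qed.

Lemma act_image_maximal h (P : set B) :
  is_maximal_ideal P -> is_maximal_ideal (act h @` P).
Proof.
move=> [idP PT Pmax]; split; [exact: act_image_ideal|exact: act_image_proper|].
move=> I idI PI.
have [|IP|IT] := Pmax _ (act_preimage_ideal h idI).
- by move=> a Pa; apply: PI; exists a.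
- left; rewrite -IP act_imageE; apply/seteqP.
  by split=> a /=; rewrite torus_actVK.
- right; apply/seteqP; split=> // a _.
  have : [set: B] (act (torus_inv h) a) by [].
  by rewrite -IT /= torus_actVK.
Qed.

Definition spec_act h (P : spec B) : spec B :=
  Spec (act_image_prime h (spec_prime P)).

Lemma max_spec_act_subproof h (P : max_spec B) :
  spec_act h (val P) \in max_spec B.
Proof. by apply/mem_set/act_image_maximal; exact: (set_mem (valP P)). Qed.

Definition max_spec_act h (P : max_spec B) : max_spec B :=
  SigSub (max_spec_act_subproof h P).

Definition max_orbit (G : set torus) (P : max_spec B) : set (max_spec B) :=
  (fun g => max_spec_act g P) @` G.

End SpecAction.
End Torus.

(* For x = (x_1, ..., x_n) this is spec_w B *)
Definition spec_stratum (B : nzRingType) (n : nat) (x : 'I_n -> B)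
    (w : {set 'I_n}) : set (spec B) :=
  [set P | ideal_of P `&` range x = x @` [set i | i \in w]].

Section QuantumAffineSpace.
Variables (k : fieldType) (n : nat) (q : 'M[k]_n).

Definition mult_antisymmetric :=
  [/\ forall i j, q i j != 0, forall i, q i i = 1
    & forall i j, q j i = (q i j)^-1].

(* The subgroup of k \ {0} generated by the entries of q *)
Definition entry_group : set k :=
  [set a | forall G : set k,
     G 1 -> (forall b c, G b -> G c -> G (b / c)) ->
     (forall i j, G (q i j)) -> G a].

Definition q_commuting (B : algType k) (x : 'I_n -> B) :=
  forall i j, x i * x j = q i j *: (x j * x i).

(* The presentation by the generators x_i and the relations
   x_i x_j = q_ij x_j x_i, as a universal property; uniqueness of f expresses
   that the x_i generate A. *)
Definition is_quantum_affine_space (A : algType k) (x : 'I_n -> A) :=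
  q_commuting x /\
  forall (B : algType k) (b : 'I_n -> B), q_commuting b ->
    exists2 f : {lrmorphism A -> B}, (forall i, f (x i) = b i)
      & forall g : {lrmorphism A -> B}, (forall i, g (x i) = b i) -> g =1 f.

Local Notation Gamma := {ffun 'I_n -> int}.

Definition is_alternating_bicharacter (c : Gamma -> Gamma -> k) :=
  [/\ forall a b, c a b != 0, forall a, c a a = 1,
      forall a b, c b a = (c a b)^-1
    & forall a b b', c a (b + b') = c a b * c a b'].

Definition sigma (a b : Gamma) : k :=
  \prod_(i < n) \prod_(j < n) q i j ^ (a i * b j).

Definition is_square_root_cocycle (c : Gamma -> Gamma -> k) :=
  [/\ is_alternating_bicharacter c, forall a b, c a b ^+ 2 = sigma a b
    & forall a b, sigma a b = 1 -> c a b = 1].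

Definition coordinates (i : 'I_n) : {mpoly k[n]} := 'X_i.

(* The inclusion of the semigroup of exponents in Z^n *)
Definition exponent (m : 'X_{1..n}) : Gamma := [ffun i => (m i)%:Z].

(* X m is the element x_m of the twisted semigroup algebra and
   'X_[m] is y_m; as the latter form a basis of the polynomial ring, the last
   two clauses say that (X m)_m is a k-basis of A. *)
Definition is_twisted_identification (c : Gamma -> Gamma -> k) (A : algType k)
    (x : 'I_n -> A) (X : 'X_{1..n} -> A) (Phi : {linear A -> {mpoly k[n]}}) :=
  [/\ forall i, X U_(i)%MM = x i,
      forall m m', X m * X m' = c (exponent m) (exponent m') *: X (m + m')%MM,
      forall m, Phi (X m) = 'X_[m]
    & bijective Phi].

Definition epsilon (i : 'I_n) : Gamma := [ffun j => (j == i)%:Z].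

(* The subgroup of Z^n generated by the epsilon_i with i not in w *)
Definition Gamma_ (w : {set 'I_n}) : set Gamma :=
  [set a | forall G : set Gamma,
     G 0 -> (forall b c, G b -> G c -> G (b - c)) ->
     (forall i, i \notin w -> G (epsilon i)) -> G a].

Definition S_ (w : {set 'I_n}) : set Gamma :=
  [set a | Gamma_ w a /\ forall b, Gamma_ w b -> sigma a b = 1].

Definition pairing (h : torus k n) (a : Gamma) : k := \prod_(i < n) h i ^ a i.

Definition S_perp (w : {set 'I_n}) : set (torus k n) :=
  [set h | forall a, S_ w a -> pairing h a = 1].

End QuantumAffineSpace.

Arguments coordinates : clear implicits.

(* Main.v *)
Require Import Defs.
From HB Require Import structures.
From mathcomp Require Import all_boot all_order all_algebra.
From mathcomp Require Import mpoly.
From mathcomp Require Import boolp classical_sets.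
From mathcomp Require Import topology_structure initial_topology subtype_topology.

Set Implicit Arguments.
Unset Strict Implicit.
Unset Printing Implicit Defensive.

Import Order.TTheory GRing.Theory Num.Theory.
Local Open Scope classical_set_scope.
Local Open Scope ring_scope.

(** Both algebras are the same vector space of polynomials with two products
    that differ on monomials only by the factor c.  Fix a stratum w, discard the
    monomials involving a variable with index in w, and grade the others by the
    classes of exponents modulo S_w.  As c is 1 wherever sigma is, it is constant
    on pairs of classes ([tmul_homogeneous]): on homogeneous elements the two
    products are proportional, so a graded subspace is an ideal for one of them
    if and only if it is an ideal for the other ([graded_tideal],
    [graded_ideal]).

    A prime of A in the stratum is stable under conjugation by the variables
    outside w; their scalars on the homogeneous components, taken together,
    separate the classes, so the prime is graded ([tprime_graded]).  A prime P of R need not be graded, but its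
    largest graded subspace is prime in A ([graded_core_tprime]); it is also the
    intersection (P : S_w^perp), because the conjugations above are given by
    elements of S_w^perp ([colonE]).  Every prime of A arises in this way: the
    homogeneous elements outside it form a multiplicative set, and an ideal of R
    maximal among those avoiding this set is prime ([tprime_lift]).  Closed sets
    can be compared stratum by stratum, since for a graded ideal J containment in
    P and in the image of P are equivalent ([graded_sub_core],
    [closed_transfer]).

    For the second map, the Nullstellensatz turns maximal ideals of R into points
    ([mpoly_nullstellensatz], [maximal_point]).  The image of a point is maximal
    in its stratum of A and annihilates a simple module on which the variables
    outside w act invertibly ([point_primitive]).  Conversely, on a simple module
    the fractions of monomials with exponents in S_w act by scalars, by a generic
    freeness argument based on leading monomials ([central_fraction_scalar]), and
    any point at which these fractions take the same values is mapped to the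
    annihilator ([primitive_point]).  Two points of a stratum have the same image
    exactly when the fractions agree at them, that is, when they differ by an
    element of S_w^perp ([same_core_orbit]).

    Finally, c is obtained from sigma through a multiplicative square root on the
    group generated by the q_ij ([multiplicative_sqrt]). *)

(** * Zorn's lemma and square roots of bicharacters *)

Lemma Zorn_above (T : Type) (P : set (set T)) (Q : set T) :
  P Q ->
  (forall F, F `<=` P -> F !=set0 -> total_on F subset ->
     P (\bigcup_(X in F) X)) ->
  exists M, [/\ Q `<=` M, P M & forall B, P B -> M `<=` B -> B = M].
Proof.
move=> PQ Pchain.
have [F FP Ftot|A [PA Amax]] := @Zorn_bigcup T (fun A => P (A `|` Q)).
  have [->|/set0P F0] := eqVneq F set0; first by rewrite bigcup_set0 set0U.
  have -> : \bigcup_(X in F) X `|` Q =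
            \bigcup_(Y in (fun X => X `|` Q) @` F) Y.
    apply/seteqP; split=> [a [[X FX Xa]|Qa]|a [_ [X FX <-]] [Xa|Qa]].
    - by exists (X `|` Q); [exists X|left].
    - by have [X FX] := F0; exists (X `|` Q); [exists X|right].
    - by left; exists X.
    - by right.
  apply: Pchain.
  - by move=> _ [X FX <-]; exact: FP.
  - by have [X FX] := F0; exists (X `|` Q); exists X.
  - move=> _ _ [X FX <-] [Y FY <-].
    by have [XY|YX] := Ftot X Y FX FY; [left|right]; exact: setSU.
exists (A `|` Q); split=> // B PB AQB.
have BQ : B `|` Q = B by apply/setUidPl => a Qa; apply: AQB; right.
apply/seteqP; split=> //.
apply: contrapT => nBA; apply: (Amax B); last by rewrite BQ.
split; first by move=> a Aa; apply: AQB; left.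
by move=> BA; apply: nBA => a /BA Aa; left.
Qed.

Lemma closed_field_sqrt (k : closedFieldType) (a : k) : exists b, b ^+ 2 = a.
Proof.
have [|b /rootP] := @closed_rootP k ('X^2 - a%:P) _.
  by rewrite size_XnsubC.
by rewrite !hornerE => /subr0_eq <-; exists b.
Qed.

(** A subgroup of the multiplicative group that is maximal among those avoiding
    -1 contains exactly one square root of each of its elements: if a root s is
    outside, then -1 = m s for some m in the subgroup, so the root -s is inside;
    and two distinct roots differ by the factor -1.  In characteristic 2 square
    roots are unique anyway. *)
Lemma multiplicative_sqrt (k : closedFieldType) (G : set k) :
  G 1 -> (forall a b, G a -> G b -> G (a / b)) -> ~ G 0 ->
  ~ G (-1) \/ 2%N \in [pchar k] ->
  exists r : k -> k, (forall a, G a -> r a ^+ 2 = a) /\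
    (forall a b, G a -> G b -> r (a * b) = r a * r b).
Proof.
move=> G1 GV G0 GN1.
suff [M [MV GM Msqrt Muniq]] : exists M : set k,
    [/\ forall a b, M a -> M b -> M (a * b), G `<=` M,
        forall a, M a -> exists2 b, M b & b ^+ 2 = a
      & forall a b, M a -> M b -> a ^+ 2 = b ^+ 2 -> a = b].
  have rP (a : k) : exists b, M a -> M b /\ b ^+ 2 = a.
    have [/Msqrt[b]|nMa] := pselect (M a); first by exists b.
    by exists 0.
  have [r rE] := choice rP; exists r; split=> [a /GM Ma|a b /GM Ma /GM Mb].
    by case: (rE a Ma).
  have [Mra ra] := rE _ Ma; have [Mrb rb] := rE _ Mb.
  have [Mrab rab] := rE _ (MV _ _ Ma Mb).
  by apply: Muniq => //; [exact: MV|rewrite exprMn rab ra rb].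
have [k2|k2] := boolP (2%N \in [pchar k]).
  exists setT; split=> // [a _|a b _ _ ab].
    by have [b bE] := closed_field_sqrt a; exists b.
  apply/eqP; rewrite -subr_eq0 -[_ == 0](expf_eq0 _ 2) /= (_ : _ ^+ 2 = 0) //.
  rewrite sqrrB ab mulr2n -mulr2n -[_ *+ 2]mulr_natr (pcharf0 k2) mulr0 subr0.
  by rewrite -mulr2n -mulr_natr (pcharf0 k2) mulr0.
case: GN1 => [GN1|]; last by rewrite (negPf k2).
pose sub (M : set k) :=
  [/\ M 1, forall a b, M a -> M b -> M (a / b), ~ M 0 & ~ M (-1)].
have [|F FP [X0 FX0] Ftot|M [GM [M1 MV M0 MN1] Mmax]] := @Zorn_above _ sub G.
- by [].
- have [X01 _ _ _] := FP _ FX0; split.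
  + by exists X0.
  + move=> a b [X FX Xa] [Y FY Yb].
    have [XY|YX] := Ftot X Y FX FY.
      by exists Y => //; have [_ YV _ _] := FP _ FY; apply: YV => //; exact: XY.
    by exists X => //; have [_ XV _ _] := FP _ FX; apply: XV => //; exact: YX.
  + by move=> [X FX X00]; have [_ _ /(_ X00)] := FP _ FX.
  + by move=> [X FX XN]; have [_ _ _ /(_ XN)] := FP _ FX.
have Mneq0 a : M a -> a != 0 by apply: contraPneq => ->.
have Minv a : M a -> M a^-1 by move=> Ma; rewrite -div1r; exact: MV.
have MM a b : M a -> M b -> M (a * b).
  by move=> Ma Mb; rewrite -[b]invrK; apply: MV => //; exact: Minv.
exists M; split=> // [a Ma|a b Ma Mb].
  have [s sE] := closed_field_sqrt a.
  have s0 : s != 0 by apply: contraTneq (Mneq0 _ Ma) => s0;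
    rewrite -sE s0 expr0n eqxx.
  have [Ms|nMs] := pselect (M s); first by exists s.
  pose N := M `|` [set b | M (b * s)].
  have [NN1|nNN1] := pselect (N (-1)).
    case: NN1 => //= MNs; exists (- s); rewrite ?sqrrN //.
    by rewrite -mulN1r.
  suff NM : N = M.
    case: nMs; rewrite -NM; right => /=; by rewrite -expr2 sE.
  apply: Mmax; last by move=> b Mb; left.
  have sI b c : b / c = b * s / (c * s).
    by rewrite invfM mulrACA divff // mulr1.
  split=> //; first by left.
  - move=> b c [Mb|/= Mb] [Mc|/= Mc].
    + by left; exact: MV.
    + right => /=; rewrite (_ : _ * s = b * a / (c * s)); last first.
        by rewrite -sE expr2 invfM [RHS]mulrACA -[s * s / s]mulrA divff //
          mulr1.
      by apply: MV => //; exact: MM.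
    + by right => /=; rewrite mulrAC; exact: MV.
    + by left; rewrite sI; exact: MV.
  - by case=> //=; rewrite mul0r.
move=> /eqP; rewrite eqf_sqr => /orP[/eqP //|/eqP aN].
by case: MN1; have := MV _ _ Ma Mb; rewrite aN mulNr divff // Mneq0.
Qed.

(** * The bicharacter sigma and its square roots *)

Section Bicharacters.
Variables (k : fieldType) (n : nat).
Local Notation Gamma := {ffun 'I_n -> int}.
Implicit Types a b : Gamma.

Section Alternating.
Variables (c : Gamma -> Gamma -> k) (c_alt : is_alternating_bicharacter c).

Lemma bichar_neq0 a b : c a b != 0. Proof. by case: c_alt. Qed.

Lemma bicharDr a b b' : c a (b + b') = c a b * c a b'.
Proof. by case: c_alt. Qed.

Lemma bicharC a b : c b a = (c a b)^-1. Proof. by case: c_alt. Qed.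

Lemma bicharxx a : c a a = 1. Proof. by case: c_alt. Qed.

Lemma bicharDl a a' b : c (a + a') b = c a b * c a' b.
Proof. by rewrite bicharC bicharDr invfM -!bicharC. Qed.

Lemma bichar0r a : c a 0 = 1.
Proof.
by apply: (mulfI (bichar_neq0 a 0)); rewrite -bicharDr addr0 mulr1.
Qed.

Lemma bichar0l a : c 0 a = 1.
Proof. by rewrite bicharC bichar0r invr1. Qed.

Lemma bicharNr a b : c a (- b) = (c a b)^-1.
Proof.
apply: (mulfI (bichar_neq0 a b)).
by rewrite -bicharDr subrr bichar0r divff ?bichar_neq0.
Qed.

Lemma bicharBr a b b' : c a (b - b') = c a b / c a b'.
Proof. by rewrite bicharDr bicharNr. Qed.

Lemma bicharBl a a' b : c (a - a') b = c a b / c a' b.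
Proof. by rewrite bicharC bicharBr invfM -!bicharC. Qed.

End Alternating.

Lemma epsilonE (i j : 'I_n) : epsilon i j = (j == i)%:Z.
Proof. by rewrite ffunE. Qed.

Lemma Gamma_sum (a : Gamma) : a = \sum_i epsilon i *~ a i.
Proof.
have mE (z : int) (f : Gamma) j : (f *~ z) j = f j *~ z.
  elim/int_rect: z => [|m IH|m IH]; first by rewrite !mulr0z ffunE.
    by rewrite intS !mulrzDr !mulr1z ffunE IH.
  rewrite intS opprD !mulrzDr ffunE IH; congr (_ + _).
  by rewrite !mulrNz !mulr1z ffunE.
apply/ffunP => j; rewrite sum_ffunE (bigD1 j) //= big1 => [|i ij].
  by rewrite addr0 mE epsilonE eqxx intz.
by rewrite mE epsilonE eq_sym (negPf ij) mul0rz.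
Qed.

Lemma Gamma_P (w : {set 'I_n}) a : Gamma_ w a <-> forall i, i \in w -> a i = 0.
Proof.
split=> [|aw G G0 GB Ge].
  move=> /(_ [set b : Gamma | forall i, i \in w -> b i = 0]).
  apply=> /= [i iw|b b' bw bw' i iw|i iw j jw].
  - by rewrite ffunE.
  - by rewrite !ffunE bw // bw' // subrr.
  - by rewrite epsilonE; case: eqP => // ji; rewrite -ji jw in iw.
have GN b : G b -> G (- b) by rewrite -sub0r; exact: GB.
have GD b b' : G b -> G b' -> G (b + b').
  by move=> Gb Gb'; rewrite -[b']opprK; apply: GB => //; exact: GN.
have GZ b (z : int) : G b -> G (b *~ z).
  move=> Gb; elim/int_rect: z => [|m IH|m IH]; first by rewrite mulr0z.
    by rewrite intS mulrzDr mulr1z; exact: GD.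
  by rewrite intS opprD mulrzDr mulrNz mulr1z; apply: GD => //; exact: GN.
rewrite [a]Gamma_sum; elim/big_ind: _ => // i _.
by have [/aw ->|iw] := boolP (i \in w); [rewrite mulr0z|apply/GZ/Ge].
Qed.

Variable q : 'M[k]_n.
Hypothesis q_antisym : mult_antisymmetric q.

Lemma sigma_alternating : is_alternating_bicharacter (sigma q).
Proof.
have [q0 q1 qV] := q_antisym.
have s0 a b : sigma q a b != 0.
  by apply/prodf_neq0 => i _; apply/prodf_neq0 => j _; exact: expfz_neq0.
have sV a b : sigma q b a = (sigma q a b)^-1.
  rewrite /sigma exchange_big /= -prodfV; apply: eq_bigr => i _.
  rewrite -prodfV; apply: eq_bigr => j _.
  by rewrite qV mulrC expfV.
have sD a b b' : sigma q a (b + b') = sigma q a b * sigma q a b'.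
  rewrite /sigma -big_split /=; apply: eq_bigr => i _.
  rewrite -big_split /=; apply: eq_bigr => j _.
  by rewrite ffunE mulrDr expfzDr.
split=> // a; rewrite [a]Gamma_sum.
(* b |-> sigma b b is multiplicative, so it suffices to look at generators *)
have sDD b b' : sigma q b b = 1 -> sigma q b' b' = 1 ->
    sigma q (b + b') (b + b') = 1.
  have sDl a1 a2 a3 : sigma q (a1 + a2) a3 = sigma q a1 a3 * sigma q a2 a3.
    by rewrite sV sD invfM -!sV.
  by move=> b1 b'1; rewrite sD !sDl b1 b'1 mul1r mulr1 (sV b b') mulVf.
have s00 : sigma q 0 0 = 1.
  by rewrite /sigma big1 // => i _; rewrite big1 // => j _; rewrite ffunE mul0r.
have sN b : sigma q b b = 1 -> sigma q (- b) (- b) = 1.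
  move=> b1; rewrite -[RHS]b1 /sigma; apply: eq_bigr => i _;
    apply: eq_bigr => j _.
  by rewrite !ffunE mulrNN.
elim/big_ind: _ => // i _; elim/int_rect: (a i) => [|m IH|m IH].
- by rewrite mulr0z.
- rewrite intS mulrzDr mulr1z; apply: sDD => //.
  rewrite /sigma big1 // => i1 _; rewrite big1 // => j1 _; rewrite !epsilonE.
  by do 2!case: eqP => [->|_]; rewrite ?mul0r ?mulr0 ?q1 // exp1rz.
- rewrite intS opprD mulrzDr mulrNz mulr1z; apply: sDD => //; apply: sN.
  rewrite /sigma big1 // => i1 _; rewrite big1 // => j1 _; rewrite !epsilonE.
  by do 2!case: eqP => [->|_]; rewrite ?mul0r ?mulr0 ?q1 // exp1rz.
Qed.

Lemma sigma_epsilon i j : sigma q (epsilon i) (epsilon j) = q i j.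
Proof.
rewrite /sigma (bigD1 i) //= (bigD1 j) //= !epsilonE !eqxx mulr1 expr1z.
rewrite big1 => [|j' /negPf j'j]; last by rewrite !epsilonE j'j mulr0.
rewrite mulr1 big1 ?mulr1 // => i' /negPf i'i.
by rewrite big1 // => j' _; rewrite epsilonE i'i mul0r.
Qed.

Lemma sigma_entry_group a b : entry_group q (sigma q a b).
Proof.
move=> G G1 GV Gq.
have GI x : G x -> G x^-1 by rewrite -div1r; exact: GV.
have GM x y : G x -> G y -> G (x * y).
  by move=> Gx Gy; rewrite -[y]invrK; apply: GV => //; exact: GI.
apply: (big_ind G) => // i _; apply: (big_ind G) => // j _.
have GX x m : G x -> G (x ^+ m).
  by move=> Gx; elim: m => // m IH; rewrite exprS; exact: GM.
by case: (a i * b j) => m; [|apply: GI]; exact: GX.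
Qed.

Lemma S_P w a : S_ q w a <->
  Gamma_ w a /\ forall i, i \notin w -> sigma q a (epsilon i) = 1.
Proof.
have s_alt := sigma_alternating.
split=> -[aw aS]; split=> //.
  by move=> i iw; apply: aS => G G0 GB Ge; exact: Ge.
move=> b /(_ [set b | sigma q a b = 1]); apply=> /= [|b1 b2 e1 e2|//].
  exact: bichar0r.
by rewrite (bicharBr s_alt) e1 e2 divr1.
Qed.

Lemma S_0 w : S_ q w 0.
Proof.
apply/S_P; split=> [|i _]; first by apply/Gamma_P => i _; rewrite ffunE.
exact: (bichar0l sigma_alternating).
Qed.

Lemma S_B w a b : S_ q w a -> S_ q w b -> S_ q w (a - b).
Proof.
move=> /S_P[/Gamma_P aw aS] /S_P[/Gamma_P bw bS]; apply/S_P; split=> [|i iw].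
  by apply/Gamma_P => i iw; rewrite !ffunE aw // bw // subrr.
by rewrite (bicharBl sigma_alternating) aS // bS // divr1.
Qed.

Lemma S_N w a : S_ q w a -> S_ q w (- a).
Proof. by rewrite -sub0r; apply: S_B; exact: S_0. Qed.

Lemma S_D w a b : S_ q w a -> S_ q w b -> S_ q w (a + b).
Proof. by move=> aS bS; rewrite -[b]opprK; apply: S_B => //; exact: S_N. Qed.

End Bicharacters.

(** Composing sigma with a multiplicative square root on the group generated by
    the entries of q keeps it an alternating bicharacter and sends 1 to 1. *)
Lemma exists_square_root_cocycle (k : closedFieldType) (n : nat) (q : 'M[k]_n) :
  mult_antisymmetric q -> ~ entry_group q (-1) \/ 2%N \in [pchar k] ->
  exists c, is_square_root_cocycle q c.
Proof.
move=> qa qN1; have s_alt := sigma_alternating qa.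
have G1 : entry_group q 1 by move=> G.
have GV a b : entry_group q a -> entry_group q b -> entry_group q (a / b).
  move=> Ga Gb G G1' GV' Gq.
  exact: (GV' _ _ (Ga G G1' GV' Gq) (Gb G G1' GV' Gq)).
have G0 : ~ entry_group q 0.
  have [q0 _ _] := qa.
  have nz (b c : k) : b != 0 -> c != 0 -> b / c != 0.
    by move=> b0 c0; rewrite mulf_neq0 ?invr_neq0.
  by move=> /(_ [set a | a != 0] (oner_neq0 _) nz q0) /=; rewrite eqxx.
have [r [r2 rM]] := multiplicative_sqrt G1 GV G0 qN1.
have r0 a : entry_group q a -> r a != 0.
  move=> Ga; apply/eqP => ra; have := r2 _ Ga; rewrite ra expr2 mulr0 => a0.
  by apply: G0; rewrite a0.
have r1 : r 1 = 1.
  by apply: (mulfI (r0 _ G1)); rewrite -rM // !mulr1.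
have sG := @sigma_entry_group k n q.
exists (fun a b => r (sigma q a b)); split=> [|a b|a b ->//]; last exact: r2.
split=> [a b|a|a b|a b b'].
- exact: r0.
- by rewrite (bicharxx s_alt).
- apply: (mulfI (r0 _ (sG a b))); rewrite -rM // divff ?r0 //.
  by rewrite (bicharC s_alt a) divff ?(bichar_neq0 s_alt).
- by rewrite (bicharDr s_alt) rM.
Qed.

(** * Linear maps out of polynomial spaces *)

Section LinearExtension.
Variables (R : comNzRingType) (n : nat).
Implicit Types p : {mpoly R[n]}.

Section Extension.
Variable V : lmodType R.
Implicit Types F : 'X_{1..n} -> V.

Definition mext F p : V := \sum_(m <- msupp p) p@_m *: F m.

Lemma mext_seq F p (s : seq 'X_{1..n}) : uniq s -> {subset msupp p <= s} ->
  mext F p = \sum_(m <- s) p@_m *: F m.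
Proof.
move=> us ps; rewrite [RHS](bigID (mem (msupp p))) /= [X in _ + X]big1.
  rewrite addr0 -big_filter; apply: perm_big; apply: uniq_perm.
  - exact: msupp_uniq.
  - exact: filter_uniq.
  - by move=> m; rewrite mem_filter; case: (boolP (m \in msupp p)) => // /ps ->.
by move=> m /memN_msupp_eq0 ->; rewrite scale0r.
Qed.

Lemma mext_is_linear F : linear (mext F).
Proof.
move=> a p q; pose s := undup (msupp p ++ msupp q ++ msupp (a *: p + q)).
rewrite !(@mext_seq F _ s) ?undup_uniq //.
- by rewrite scaler_sumr -big_split /=; apply: eq_bigr => m _;
    rewrite mcoeffD mcoeffZ scalerDl scalerA.
- by move=> m mq; rewrite mem_undup !mem_cat mq orbT.
- by move=> m mp; rewrite mem_undup !mem_cat mp.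
- by move=> m mq; rewrite mem_undup !mem_cat mq !orbT.
Qed.

HB.instance Definition _ F :=
  GRing.isLinear.Build R {mpoly R[n]} V *:%R (mext F) (mext_is_linear F).

Lemma mextX F m : mext F 'X_[m] = F m.
Proof. by rewrite /mext msuppX big_seq1 mcoeffX eqxx scale1r. Qed.

Lemma mpoly_linear_ext (f g : {linear {mpoly R[n]} -> V}) :
  (forall m, f 'X_[m] = g 'X_[m]) -> f =1 g.
Proof.
move=> fg p; rewrite [p]mpolyE !linear_sum; apply: eq_bigr => m _.
by rewrite !linearZ fg.
Qed.

End Extension.

Lemma mpoly_linear_ind (P : {mpoly R[n]} -> Prop) :
  (forall m, P 'X_[m]) -> (forall p q, P p -> P q -> P (p + q)) ->
  (forall a p, P p -> P (a *: p)) -> forall p, P p.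
Proof.
move=> PX PD PZ p; rewrite [p]mpolyE; elim/big_ind: _ => [|//|m _].
  by rewrite -(scale0r 'X_[0]); exact: PZ.
exact: PZ.
Qed.

Lemma mcoeff_mext_inj (c : 'X_{1..n} -> R) (t : 'X_{1..n} -> 'X_{1..n}) p m :
  injective t -> (mext (fun m => c m *: 'X_[t m]) p)@_(t m) = p@_m * c m.
Proof.
move=> t_inj; rewrite /mext raddf_sum /=.
have [mp|mp] := boolP (m \in msupp p).
  rewrite (bigD1_seq m) ?msupp_uniq //= big1 => [|m' /negPf m'm].
    by rewrite addr0 !mcoeffZ mcoeffX eqxx mulr1.
  by rewrite !mcoeffZ mcoeffX (inj_eq t_inj) m'm !mulr0.
rewrite (memN_msupp_eq0 mp) mul0r big_seq big1 // => m' m'p.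
rewrite !mcoeffZ mcoeffX (inj_eq t_inj); case: eqP => [m'm|];
  last by rewrite !mulr0.
by rewrite -m'm m'p in mp.
Qed.

Lemma mcoeff_mext_out (c : 'X_{1..n} -> R) (t : 'X_{1..n} -> 'X_{1..n}) p m :
  (forall m', t m' != m) -> (mext (fun m => c m *: 'X_[t m]) p)@_m = 0.
Proof.
move=> tm; rewrite /mext raddf_sum /= big1 // => m' _.
by rewrite !mcoeffZ mcoeffX (negPf (tm m')) !mulr0.
Qed.

Definition mdiag (chi : 'X_{1..n} -> R) := mext (fun m => chi m *: 'X_[R, m]).

HB.instance Definition _ chi := GRing.Linear.on (mdiag chi).

Lemma mdiagX chi m : mdiag chi 'X_[m] = chi m *: 'X_[m].
Proof. exact: mextX. Qed.

Lemma mcoeff_mdiag chi p m : (mdiag chi p)@_m = chi m * p@_m.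
Proof. by rewrite mulrC; apply: (@mcoeff_mext_inj _ id). Qed.

End LinearExtension.

(** * Quantum affine space as a twisted semigroup algebra *)

Section TwistedAlgebra.
Variables (k : fieldType) (n : nat).
Local Notation Gamma := {ffun 'I_n -> int}.

Lemma exponentD (m m' : 'X_{1..n}) :
  exponent (m + m')%MM = exponent m + exponent m'.
Proof. by apply/ffunP => i; rewrite !ffunE mnmDE. Qed.

Lemma exponent0 : exponent (0%MM : 'X_{1..n}) = 0.
Proof. by apply/ffunP => i; rewrite !ffunE mnm0E. Qed.

Lemma exponentU (i : 'I_n) : exponent U_(i)%MM = epsilon i.
Proof. by apply/ffunP => j; rewrite !ffunE mnm1E eq_sym. Qed.

Variables (c : Gamma -> Gamma -> k) (c_alt : is_alternating_bicharacter c).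
Local Notation ce m m' := (c (exponent m) (exponent m')).

Definition tmul_mon (q : {mpoly k[n]}) (m : 'X_{1..n}) : {mpoly k[n]} :=
  mext (fun m' => ce m m' *: 'X_[m + m']) q.
Definition tmul (p q : {mpoly k[n]}) := mext (tmul_mon q) p.

Lemma tmulXX m m' : tmul 'X_[m] 'X_[m'] = ce m m' *: 'X_[m + m'].
Proof. by rewrite /tmul mextX /tmul_mon mextX. Qed.

Lemma tmulr_is_linear p : linear (tmul p).
Proof.
move=> a q r; rewrite /tmul /mext scaler_sumr -big_split /=.
apply: eq_bigr => m _.
by rewrite /tmul_mon linearP scalerDr !scalerA mulrC.
Qed.

HB.instance Definition _ p := GRing.isLinear.Build k {mpoly k[n]} {mpoly k[n]}
  *:%R (tmul p) (tmulr_is_linear p).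

Lemma tmulDl : left_distributive tmul +%R.
Proof. by move=> p q r; rewrite /tmul linearD. Qed.

Lemma tmulDr : right_distributive tmul +%R.
Proof. by move=> p q r; rewrite linearD. Qed.

Lemma tmulZl a p q : a *: tmul p q = tmul (a *: p) q.
Proof. by rewrite /tmul linearZ. Qed.

Lemma tmulZr a p q : a *: tmul p q = tmul p (a *: q).
Proof. by rewrite linearZ. Qed.

Lemma tmul1l : left_id 'X_[0] tmul.
Proof.
move=> p; elim/mpoly_linear_ind: p => [m|p q IHp IHq|a p IH].
- by rewrite tmulXX exponent0 (bichar0l c_alt) scale1r add0m.
- by rewrite tmulDr IHp IHq.
- by rewrite -tmulZr IH.
Qed.

Lemma tmul1r : right_id 'X_[0] tmul.
Proof.
move=> p; elim/mpoly_linear_ind: p => [m|p q IHp IHq|a p IH].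
- by rewrite tmulXX exponent0 (bichar0r c_alt) scale1r addm0.
- by rewrite tmulDl IHp IHq.
- by rewrite -tmulZl IH.
Qed.

Lemma tmulA : associative tmul.
Proof.
move=> p q r; elim/mpoly_linear_ind: p => [m1|p p' IHp IHq|a p IH];
  last 2 first.
- by rewrite !tmulDl IHp IHq.
- by rewrite -!tmulZl IH.
elim/mpoly_linear_ind: q => [m2|p p' IHp IHq|a p IH]; last 2 first.
- by rewrite tmulDl !tmulDr tmulDl IHp IHq.
- by rewrite -!(tmulZr, tmulZl) IH.
elim/mpoly_linear_ind: r => [m3|p p' IHp IHq|a p IH]; last 2 first.
- by rewrite !tmulDr IHp IHq.
- by rewrite -!(tmulZr, tmulZl) IH.
rewrite !tmulXX -tmulZr -tmulZl !tmulXX !scalerA addmA !exponentD.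
by rewrite (bicharDr c_alt) (bicharDl c_alt) mulrC mulrA.
Qed.

(** The bicharacter axioms enter the type so that the ring structure, which
    depends on them, can be found by unification. *)
Definition twisted (_ : is_alternating_bicharacter c) : Type := {mpoly k[n]}.

HB.instance Definition _ := GRing.Lmodule.on (twisted c_alt).

Lemma twisted1_neq0 : ('X_[0] : twisted c_alt) != 0.
Proof. by rewrite mpolyX0 oner_neq0. Qed.

HB.instance Definition _ := GRing.Zmodule_isNzRing.Build (twisted c_alt)
  tmulA tmul1l tmul1r tmulDl tmulDr twisted1_neq0.

HB.instance Definition _ := GRing.Lmodule_isLalgebra.Build k (twisted c_alt)
  tmulZl.

HB.instance Definition _ := GRing.Lalgebra_isAlgebra.Build k (twisted c_alt)
  tmulZr.

Section Words.
Variables (B : algType k) (x : 'I_n -> B).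
Implicit Types l : seq 'I_n.

Definition word_weight l : 'X_{1..n} := (\sum_(i <- l) U_(i))%MM.

Definition mword (m : 'X_{1..n}) : seq 'I_n :=
  flatten [seq nseq (m i) i | i <- enum 'I_n].

Lemma count_mword m i : count_mem i (mword m) = m i.
Proof.
rewrite count_flatten -map_comp sumnE big_map big_enum /= (bigD1 i) //=.
rewrite count_nseq /= eqxx mul1n big1 ?addn0 // => j /negPf ji.
by rewrite count_nseq /= ji mul0n.
Qed.

Lemma word_weight_perm l l' : perm_eq l l' -> word_weight l = word_weight l'.
Proof. exact: perm_big. Qed.

Lemma word_weight_cons i l : word_weight (i :: l) = (U_(i) + word_weight l)%MM.
Proof. by rewrite /word_weight big_cons. Qed.

Lemma word_weight_cat l l' :
  word_weight (l ++ l') = (word_weight l + word_weight l')%MM.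
Proof. by rewrite /word_weight big_cat. Qed.

Lemma word_weight1 i : word_weight [:: i] = U_(i)%MM.
Proof. by rewrite /word_weight big_seq1. Qed.

Lemma mword_weight m : word_weight (mword m) = m.
Proof.
apply/mnmP => i; rewrite /word_weight mnm_sumE -[RHS](count_mword m).
rewrite -sum1_count [RHS]big_mkcond; apply: eq_bigr => j _.
by rewrite mnm1E /=; case: (j == i).
Qed.

(** The product of a word in the generators, divided by the scalar that makes
    it independent of the order of the letters. *)
Fixpoint nword l : B :=
  if l is i :: l' then (ce U_(i) (word_weight l'))^-1 *: (x i * nword l') else
    1.

Lemma nword_mon (Y : 'X_{1..n} -> B) : Y 0%MM = 1 ->
  (forall i, Y U_(i)%MM = x i) ->
  (forall m m', Y m * Y m' = ce m m' *: Y (m + m')%MM) ->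
  forall l, nword l = Y (word_weight l).
Proof.
move=> Y0 YU YM; elim=> [|i l IH] /=; first by rewrite /word_weight big_nil Y0.
rewrite word_weight_cons IH -YU YM scalerA mulVf ?scale1r //.
exact: (bichar_neq0 c_alt).
Qed.

Lemma nword1 i : nword [:: i] = x i.
Proof.
by rewrite /= /word_weight big_nil exponent0 (bichar0r c_alt) invr1 scale1r
  mulr1.
Qed.

Variables (q : 'M[k]_n) (qa : mult_antisymmetric q) (xq : q_commuting q x).
Hypothesis c2 : forall a b, c a b ^+ 2 = sigma q a b.

Lemma nword_comm i l :
  x i * nword l = ce U_(i) (word_weight l) ^+ 2 *: (nword l * x i).
Proof.
elim: l => [|j l IH] /=.
  by rewrite /word_weight big_nil exponent0 (bichar0r c_alt) expr1n mul1r
    mulr1 scale1r.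
rewrite -scalerAr mulrA xq -scalerAl -mulrA IH -scalerAr mulrA -scalerAl.
rewrite !scalerA word_weight_cons exponentD (bicharDr c_alt) exprMn.
congr (_ *: _); rewrite !exponentU -(sigma_epsilon q i j) -(c2 (epsilon i)).
by rewrite -mulrA mulrC.
Qed.

Lemma nword_cat l l' : nword (l ++ l') =
  (ce (word_weight l) (word_weight l'))^-1 *: (nword l * nword l').
Proof.
elim: l => [|i l IH] /=.
  by rewrite /word_weight big_nil exponent0 (bichar0l c_alt) invr1 scale1r
    mul1r.
rewrite IH word_weight_cat word_weight_cons !exponentD.
rewrite (bicharDl c_alt) (bicharDr c_alt) -scalerAr -scalerAl !scalerA mulrA.
by congr (_ *: _); rewrite !invfM [RHS]mulrC mulrA.
Qed.

Lemma nword_rcons i l : nword (l ++ [:: i]) = nword (i :: l).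
Proof.
rewrite nword_cat nword1 word_weight1 /= nword_comm scalerA; congr (_ *: _).
rewrite (bicharC c_alt (exponent U_(i))) invrK expr2 mulrA mulVf ?mul1r //.
exact: (bichar_neq0 c_alt).
Qed.

Lemma nword_perm l l' : perm_eq l l' -> nword l = nword l'.
Proof.
elim: l l' => [|i l IH] l' ll';
  first by move/perm_size: ll' => /esym/size0nil ->.
have /splitPr l'E : i \in l' by rewrite -(perm_mem ll') mem_head.
case: l'E ll' => l1 l2;
  rewrite perm_sym -cat1s perm_catCA /= perm_cons perm_sym.
move=> ll'; rewrite -[l1 ++ _]/(l1 ++ ([:: i] ++ l2)) catA nword_cat
  nword_rcons.
have -> : word_weight (l1 ++ [:: i]) = word_weight (i :: l1).
  exact: (word_weight_perm (permEl (perm_catC l1 [:: i]))).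
by rewrite -nword_cat /= (IH _ ll') (word_weight_perm ll').
Qed.

Lemma nwordM m m' : nword (mword m) * nword (mword m') =
  ce m m' *: nword (mword (m + m')%MM).
Proof.
have -> : nword (mword (m + m')%MM) = nword (mword m ++ mword m').
  apply: nword_perm; apply/allP => i _ /=.
  by rewrite count_cat !count_mword mnmDE.
rewrite nword_cat !mword_weight scalerA divff ?scale1r //.
exact: (bichar_neq0 c_alt).
Qed.

Lemma nwordU i : nword (mword U_(i)%MM) = x i.
Proof.
rewrite -nword1; apply: nword_perm; apply/allP => j _ /=.
by rewrite count_mword mnm1E addn0.
Qed.

Lemma nword0 : nword (mword 0%MM) = 1.
Proof.
suff -> : mword 0%MM = [::] by [].
by apply: size0nil; apply/eqP; rewrite -leqn0 leqNgt -has_predT;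
  apply/hasPn => i; rewrite -has_pred1 has_count count_mword mnm0E.
Qed.

End Words.

Variables (q : 'M[k]_n) (qa : mult_antisymmetric q).
Hypothesis c2 : forall a b, c a b ^+ 2 = sigma q a b.

Lemma twisted_q_commuting :
  q_commuting q (fun i => 'X_i : twisted c_alt).
Proof.
move=> i j; rewrite -[LHS]/(tmul _ _) -[X in _ *: X]/(tmul _ _) !tmulXX scalerA.
rewrite addmC !exponentU; congr (_ *: _).
rewrite (bicharC c_alt (epsilon i) (epsilon j)) -(sigma_epsilon q) -c2.
by rewrite expr2 mulfK ?(bichar_neq0 c_alt).
Qed.

(** Both algebras have the same universal property: the homomorphism to the
    twisted algebra given by the presentation has the linear extension of the
    normalised words as inverse, the composite on A being the identity because
    it fixes the generators. *)
Lemma exists_twisted_identification (A : algType k) (x : 'I_n -> A) :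
  is_quantum_affine_space q x ->
  exists (X : 'X_{1..n} -> A) (Phi : {linear A -> {mpoly k[n]}}),
    is_twisted_identification c x X Phi.
Proof.
move=> [xq univ].
pose X m := nword x (mword m).
have XM m m' : X m * X m' = ce m m' *: X (m + m')%MM by exact: nwordM.
have [f fx _] := univ _ _ twisted_q_commuting.
pose g : {linear {mpoly k[n]} -> A} := mext X.
have gM : {morph (g : twisted c_alt -> A) : p p' / p * p'}.
  move=> p p'; rewrite -[p * p']/(tmul p p').
  elim/mpoly_linear_ind: p => [m|p r IHp IHq|a p IH]; last 2 first.
  - by rewrite tmulDl !linearD /= IHp IHq mulrDl.
  - by rewrite -tmulZl !linearZ /= IH -scalerAl.
  elim/mpoly_linear_ind: p' => [m'|p r IHp IHq|a p IH]; last 2 first.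
  - by rewrite tmulDr !linearD /= IHp IHq mulrDr.
  - by rewrite -tmulZr !linearZ /= IH -scalerAr.
  by rewrite tmulXX linearZ /= !mextX XM.
have g1 : (g : twisted c_alt -> A) 1 = 1 by rewrite /= mextX; exact: nword0.
pose gL : {lrmorphism twisted c_alt -> A} :=
  HB.pack (g : twisted c_alt -> A)
   (GRing.isLinear.Build k (twisted c_alt) A *:%R (g : twisted c_alt -> A)
     (@linearP _ _ _ _ g))
   (GRing.isMonoidMorphism.Build (twisted c_alt) A (g : twisted c_alt -> A)
     (g1, gM)).
have fX m : f (X m) = 'X_[m].
  have fw l : f (nword x l) = nword (fun i => 'X_i : twisted c_alt) l.
    elim: l => [|i l IH] /=; first exact: rmorph1.
    by rewrite linearZ /= rmorphM /= fx IH.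
  rewrite fw (@nword_mon (twisted c_alt) _ (fun m => 'X_[m])) ?mword_weight //.
  exact: tmulXX.
have fg p : f (g p) = p.
  elim/mpoly_linear_ind: p => [m|p r IHp IHq|a p IH].
  - by rewrite /= mextX fX.
  - by rewrite !linearD /= IHp IHq.
  - by rewrite !linearZ /= IH.
have gf a : g (f a) = a.
  have [h _ hU] := univ _ _ xq.
  rewrite -[LHS]/((gL \o f) a) -[RHS]/((idfun : {lrmorphism A -> A}) a).
  rewrite (hU (gL \o f)) ?(hU (idfun : {lrmorphism A -> A})) // => i.
  by rewrite /= fx mextX; exact: nwordU.
pose Phi : {linear A -> {mpoly k[n]}} :=
  HB.pack (f : A -> {mpoly k[n]})
   (GRing.isLinear.Build k A {mpoly k[n]} *:%R (f : A -> {mpoly k[n]})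
     (@linearP _ _ _ _ f)).
exists X, Phi; split=> //; last by exists g.
by move=> i; exact: nwordU.
Qed.

End TwistedAlgebra.

(** * The Nullstellensatz for polynomial rings *)

Lemma exists_minimal (T : Type) (P : T -> Prop) (f : T -> nat) :
  (exists x, P x) -> exists x, P x /\ forall y, (f y < f x)%N -> ~ P y.
Proof.
move=> [x0 Px0].
have exP : exists i, `[< exists x, P x /\ f x = i >].
  by exists (f x0); apply/asboolP; exists x0.
case: (ex_minnP exP) => i /asboolP [x [Px <-]] imin.
exists x; split=> // y yx Py; suff: (f x <= f y)%N by rewrite leqNgt yx.
by apply: imin; apply/asboolP; exists y.
Qed.

Lemma ideal_subr (B : nzRingType) (I : set B) a b :
  is_ideal I -> I a -> I b -> I (a - b).
Proof.
by move=> idI Ia Ib; have [_ ID _] := idI; apply: ID => //; exact: ideal_opp.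
Qed.

Lemma ideal_mulr (B : nzRingType) (I : set B) a b : is_ideal I -> I b -> I (a
  * b).
Proof. by move=> [_ _ IM] Ib; case: (IM a b Ib). Qed.

Lemma ideal_mull (B : nzRingType) (I : set B) a b : is_ideal I -> I b -> I (b
  * a).
Proof. by move=> [_ _ IM] Ib; case: (IM a b Ib). Qed.

Lemma ideal_proper (B : nzRingType) (I : set B) :
  is_ideal I -> I != setT <-> ~ I 1.
Proof.
move=> idI; split=> [/eqP IT I1|I1]; last by apply/eqP => IT; apply: I1;
  rewrite IT.
apply: IT; apply/seteqP; split=> // a _; rewrite -[a]mulr1.
exact: ideal_mulr.
Qed.

Lemma comm_primeP (B : comNzRingType) (P : set B) : is_prime_ideal P <->
  [/\ is_ideal P, ~ P 1 & forall a b, P (a * b) -> P a \/ P b].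
Proof.
split=> [[idP /(ideal_proper idP) P1 Pprime]|[idP P1 Pprime]]; split=> //.
- move=> a b Pab; pose gen (d : B) := [set c * d | c in setT].
  have idgen d : is_ideal (gen d).
    split; first by exists 0; rewrite ?mul0r.
      by move=> _ _ [u _ <-] [v _ <-]; exists (u + v) => //; rewrite mulrDl.
    move=> u _ [v _ <-]; split; first by exists (u * v); rewrite ?mulrA.
    by exists (v * u); rewrite // mulrAC.
  have [|Pa|Pb] := Pprime _ _ (idgen a) (idgen b).
  + apply/(ideal_productP _ _ idP) => _ _ [u _ <-] [v _ <-].
    by rewrite mulrACA; exact: ideal_mulr.
  + by left; apply: Pa; exists 1; rewrite ?mul1r.
  + by right; apply: Pb; exists 1; rewrite ?mul1r.
- by apply/(ideal_proper idP).
- move=> I J idI idJ /(ideal_productP _ _ idP) IJP.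
  have [IP|nIP] := pselect (I `<=` P); [by left|right=> b Jb].
  have [a [Ia nPa]] : exists a, I a /\ ~ P a.
    apply: contrapT => H; apply: nIP => a Ia; apply: contrapT => nPa.
    by apply: H; exists a.
  by case: (Pprime _ _ (IJP a b Ia Jb)).
Qed.

(** The strong Nullstellensatz for D: every prime ideal is an intersection of
    kernels of k-valued points. *)
Definition enough_points (k : fieldType) (D : comNzRingType) (iota : k -> D) :=
  forall (P : set D) e, is_prime_ideal P -> ~ P e ->
  exists theta : {rmorphism D -> k},
    [/\ forall a, theta (iota a) = a, forall d, P d -> theta d = 0
      & theta e != 0].

Import Pdiv.Idomain.

Lemma size_drop_lead (D : nzRingType) (f : {poly D}) : f != 0 ->
  (size (f - (lead_coef f)%:P * 'X^((size f).-1))%R < size f)%N.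
Proof.
move=> f0; rewrite [X in (_ < X)%N](polySpred f0) ltnS.
apply/leq_sizeP => j; rewrite leq_eqVlt coefB coefCM coefXn => /predU1P[<-|jf].
  by rewrite eqxx mulr1 subrr.
rewrite nth_default ?(gtn_eqF jf) ?mulr0 ?subr0 //.
by rewrite (polySpred f0).
Qed.

Section EnoughPointsPoly.
Variables (k : closedFieldType) (D : idomainType) (iota : k -> D).
Hypothesis D_points : enough_points iota.
Variables (P : set {poly D}) (e : {poly D}).
Hypotheses (P_prime : is_prime_ideal P) (nPe : ~ P e).
Implicit Types f g h : {poly D}.

Let idP : is_ideal P. Proof. by case/comm_primeP: P_prime. Qed.
Let P1 : ~ P 1. Proof. by case/comm_primeP: P_prime. Qed.
Let PM f g : P (f * g) -> P f \/ P g.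
Proof. by case/comm_primeP: P_prime => _ _; apply. Qed.
Let P0 : P 0. Proof. by case: idP. Qed.

Let p := [set d : D | P d%:P].

Let p_prime : is_prime_ideal p.
Proof.
apply/comm_primeP; split=> [|//|a b]; last by rewrite /p /= polyCM => /PM.
split; first by rewrite /p /= polyC0.
  by move=> a b pa pb; rewrite /p /= polyCD; case: idP => _ PD _; exact: PD.
move=> a b pb; rewrite /p /= !polyCM.
by split; [exact: ideal_mulr|exact: ideal_mull].
Qed.

Let idp : is_ideal p. Proof. by case: p_prime. Qed.
Let pM a b : p (a * b) -> p a \/ p b.
Proof. by case/comm_primeP: p_prime => _ _; apply. Qed.
Let p1 : ~ p 1. Proof. by case/comm_primeP: p_prime. Qed.
Let npX a m : ~ p a -> ~ p (a ^+ m).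
Proof. by move=> pa; elim: m => // m IH; rewrite exprS => /pM[]. Qed.

Let PZ a f : P f -> P (a *: f).
Proof. by rewrite -mul_polyC; exact: ideal_mulr. Qed.

Let PZV a f : ~ p a -> P (a *: f) -> P f.
Proof. by move=> pa; rewrite -mul_polyC => /PM[]. Qed.

Let P_coef f : (forall i, p f`_i) -> P f.
Proof.
move=> pf; rewrite -[f]coefK poly_def; case: idP => _ PD _.
by elim/big_ind: _ => // i _; rewrite -mul_polyC; apply: ideal_mull => //;
  exact: pf.
Qed.

Definition poly_point (theta : {rmorphism D -> k}) (xi : k) :
  {rmorphism {poly D} -> k} := horner_eval xi \o map_poly theta.

Lemma poly_pointE theta xi f : poly_point theta xi f = (map_poly theta f).[xi].
Proof. by []. Qed.

Lemma poly_pointC theta xi a : poly_point theta xi a%:P = theta a.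
Proof. by rewrite poly_pointE map_polyC hornerC. Qed.

Lemma points_generic : (forall f, P f -> forall i, p f`_i) ->
  exists theta : {rmorphism {poly D} -> k},
    [/\ forall a, theta (iota a)%:P = a, forall d, P d -> theta d = 0
      & theta e != 0].
Proof.
move=> Pp.
have [i ei] : exists i, ~ p e`_i.
  apply: contrapT => H; apply: nPe; apply: P_coef => i.
  by apply: contrapT => ei; apply: H; exists i.
have [theta [thiota thp the]] := D_points p_prime ei.
have [|xi xie] := @closed_nonrootP _ (map_poly theta e) _.
  by apply: contraNneq the => th0; rewrite -coef_map th0 coef0.
exists (poly_point theta xi); split=> // [a|f Pf].
  by rewrite poly_pointC.
rewrite poly_pointE (_ : map_poly theta f = 0) ?horner0 //.
by apply/polyP => j; rewrite coef_map coef0 /= thp //; exact: Pp.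
Qed.

Lemma points_algebraic f0 i0 : P f0 -> ~ p f0`_i0 ->
  exists theta : {rmorphism {poly D} -> k},
    [/\ forall a, theta (iota a)%:P = a, forall d, P d -> theta d = 0
      & theta e != 0].
Proof.
move=> Pf0 pf0.
(* a relation of minimal degree over the domain D / p *)
have [|f [[Pf [i pfi]] fmin]] := @exists_minimal {poly D}
    (fun f => P f /\ exists i, ~ p f`_i) (fun f => size f).
  by exists f0; split=> //; exists i0.
have smallP (r : {poly D}) : (size r < size f)%N -> P r -> forall j, p r`_j.
  by move=> /fmin nr Pr j; apply: contrapT => pj; apply: nr; split=> //;
    exists j.
have fn0 : f != 0.
  by apply: contra_notN pfi => /eqP ->; rewrite coef0; case: idp.
pose a := lead_coef f; have pa : ~ p a.
  move=> pa; apply: (fmin _ (size_drop_lead fn0)); split.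
    by apply: ideal_subr => //; exact: ideal_mull.
  exists i; rewrite coefB coefCM coefXn; case: eqP => [iE|_];
    last by rewrite mulr0 subr0.
  by case: pfi; rewrite iE.
have f1 : size f != 1%N.
  by apply/eqP => /eqP /size_poly1P [b _ fE]; apply: pa;
    rewrite /a fE lead_coefC /p /= -fE.
(* a multiple of e of minimal degree modulo P is a constant *)
have [|g [[nPg [v gve]] gmin]] := @exists_minimal {poly D}
    (fun g => ~ P g /\ exists v, P (g - v * e)) (fun g => size g).
  by exists e; split=> //; exists 1; rewrite mul1r subrr.
have gn0 : g != 0 by apply: contra_notN nPg => /eqP ->.
pose b := lead_coef g; have pb : ~ p b.
  move=> pb; have Pt : P ((lead_coef g)%:P * 'X^((size g).-1)) by exact:
    ideal_mull.
  apply: (gmin _ (size_drop_lead gn0)); split.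
    move=> Pgt; apply: nPg;
      rewrite -[g](subrK ((lead_coef g)%:P * 'X^((size g).-1))).
    by case: idP => _ PD _; exact: PD.
  by exists v; rewrite addrAC; exact: ideal_subr.
have gf : (size g < size f)%N.
  rewrite ltnNge; apply/negP => fg.
  have gE := divp_eq g f;
    have rf : (size (g %% f)%R < size f)%N by rewrite ltn_modp.
  have rE : g %% f = a ^+ scalp g f *: g - g %/ f * f by rewrite gE addrC addKr.
  apply: (gmin _ (leq_trans rf fg)); split.
    move=> Pr; apply: nPg; apply: (PZV (@npX _ (scalp g f) pa));
      rewrite -/a in gE *.
    rewrite gE; case: idP => _ PD _; apply: PD => //; exact: ideal_mulr.
  exists (a ^+ scalp g f *: v); rewrite rE addrAC -scalerAl -scalerBr.
  by apply: ideal_subr => //; [exact: PZ|exact: ideal_mulr].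
have g1 : (size g <= 1)%N.
  rewrite leqNgt; apply/negP => g1.
  have fE := divp_eq f g;
    have rg : (size (f %% g)%R < size g)%N by rewrite ltn_modp.
  rewrite -/b in fE; set m := scalp f g in fE.
  have rE : f %% g = b ^+ m *: f - f %/ g * g by rewrite fE addrC addKr.
  have Pr : P (f %% g).
    apply: contrapT => nPr; apply: (gmin _ rg); split=> //.
    exists (- (f %/ g * v)).
    have -> : f %% g - - (f %/ g * v) * e = b ^+ m *: f - f %/ g * (g - v * e).
      by rewrite rE mulNr opprK mulrBr mulrA opprB addrA addrAC.
    by apply: ideal_subr => //; [exact: PZ|exact: ideal_mulr].
  have Ph : P (f %/ g).
    have : P (f %/ g * g).
      rewrite (_ : _ * _ = b ^+ m *: f - f %% g); last by rewrite fE addrK.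
      by apply: ideal_subr => //; exact: PZ.
    by case/PM.
  have hf : (size (f %/ g)%R < size f)%N.
    rewrite size_divp // ltn_subrL -ltnS (ltn_predK g1) g1 /=.
    by rewrite size_poly_gt0.
  have ph := smallP _ hf Ph; have pr := smallP _ (ltn_trans rg gf) Pr.
  have : p (b ^+ m * a).
    have -> : b ^+ m * a = (f %/ g * g + f %% g)`_(size f).-1 by rewrite -fE
      coefZ.
    rewrite coefD coefM; have [p0 pD _] := idp; apply: (pD _ _ _ (pr _)).
    by apply: (big_ind p) => [||j _]; [exact: p0|exact: pD|exact: ideal_mull].
  by case/pM => //; exact: npX.
have [theta [thiota thp]] : exists theta : {rmorphism D -> k},
    [/\ forall a, theta (iota a) = a, forall d, p d -> theta d = 0
      & theta (g`_0 * a) != 0].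
  apply: D_points => // /pM[|//]; rewrite /p /=; by rewrite -size1_polyC.
rewrite rmorphM mulf_eq0 negb_or => /andP[thg tha].
have [|xi xif] := @closed_rootP _ (map_poly theta f) _.
  by rewrite size_map_poly_id0.
have kill h : P h -> poly_point theta xi h = 0.
  move=> Ph; have hE := divp_eq h f.
  have rf : (size (h %% f)%R < size f)%N by rewrite ltn_modp.
  have Pr : P (h %% f).
    rewrite (_ : _ %% _ = lead_coef f ^+ scalp h f *: h - h %/ f * f);
      last first.
      by rewrite hE addrC addKr.
    by apply: ideal_subr => //; [exact: PZ|exact: ideal_mulr].
  have r0 : map_poly theta (h %% f) = 0.
    by apply/polyP => j; rewrite coef_map coef0 /= thp //; exact: smallP.
  have := congr1 (poly_point theta xi) hE.
  rewrite -mul_polyC rmorphD !rmorphM poly_pointC poly_pointE.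
  rewrite [X in _ + X]poly_pointE r0 horner0 addr0.
  rewrite [X in _ = _ * X]poly_pointE (rootP xif) mulr0 rmorphXn => /eqP.
  by rewrite mulf_eq0 expf_eq0 (negPf tha) andbF => /eqP.
exists (poly_point theta xi); split=> // [c|]; first by rewrite poly_pointC.
have := kill _ gve; rewrite rmorphB rmorphM (size1_polyC g1) poly_pointC.
by move=> /subr0_eq gE; move: thg; rewrite gE mulf_eq0 negb_or => /andP[].
Qed.

End EnoughPointsPoly.

(** Let t be the additional variable.  If its image is transcendental over D / p,
    where p is the trace of P, any value of t outside a finite set will do.
    Otherwise take a relation f of minimal degree and a multiple of e that is a
    constant g modulo P: a point of D / p at which neither the leading
    coefficient of f nor g vanishes extends by sending t to a root of f. *)
Lemma enough_points_poly (k : closedFieldType) (D : idomainType) (iota : k -> D) :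
  enough_points iota -> enough_points (polyC \o iota).
Proof.
move=> D_points P e P_prime nPe.
have [Pp|] := pselect (forall f, P f -> forall i, P (f`_i)%:P).
  exact: points_generic.
move=> /existsNP[f /not_implyP[Pf /existsNP[i pfi]]].
exact: (points_algebraic D_points P_prime nPe Pf pfi).
Qed.

Section AddVariable.
Variables (R : comNzRingType) (n : nat).

(** Its surjectivity reduces the polynomial ring in n + 1 variables to univariate
    polynomials over the one in n variables. *)
Definition last_variable : {rmorphism {poly {mpoly R[n]}} -> {mpoly R[n.+1]}} :=
  horner_eval 'X_ord_max \o map_poly (@mwiden n R).

Lemma last_variableC p : last_variable p%:P = mwiden p.
Proof. by rewrite /= /horner_eval map_polyC hornerC. Qed.

Lemma last_variableX : last_variable 'X = 'X_ord_max.
Proof. by rewrite /= /horner_eval map_polyX hornerX. Qed.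

End AddVariable.

Lemma enough_points_mpoly (k : closedFieldType) (n : nat) :
  enough_points (@mpolyC n k).
Proof.
elim: n => [|n IHn] P e Pprime nPe.
  have [idP P1 PM] := (comm_primeP P).1 Pprime.
  exists (@meval 0 k (fun=> 0)); split=> [a|d Pd|].
  - exact: mevalC.
  - rewrite [d]nvar0_mpolyC /= mevalC; apply: contrapT => /eqP d0; apply: P1.
    have := ideal_mulr ((d@_0)^-1)%:MP idP Pd.
    by rewrite {2}[d]nvar0_mpolyC -mpolyCM mulVf.
  - rewrite [e]nvar0_mpolyC /= mevalC; apply: contra_notN nPe => /eqP e0.
    by rewrite [e]nvar0_mpolyC e0; case: idP.
have [idP P1 PM] := (comm_primeP P).1 Pprime.
pose pi := last_variable k n; pose Q := pi @^-1` P.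
have QE F : Q F = P (pi F) by [].
have Qprime : is_prime_ideal Q.
  apply/comm_primeP; split=> [||a b]; last by rewrite !QE rmorphM; exact: PM.
    split; first by rewrite QE rmorph0; case: idP.
      by move=> a b; rewrite !QE rmorphD; case: idP => _ PD _; exact: PD.
    move=> a b; rewrite !QE !rmorphM => Qb.
    by split; [exact: ideal_mulr|exact: ideal_mull].
  by rewrite QE rmorph1.
have pi_surj p : exists F, pi F = p.
  elim/mpolyind: p => [|c m p _ _ [F piF]]; first by exists 0; rewrite rmorph0.
  suff [G piG] : exists G, pi G = 'X_[m].
    exists ((c%:MP)%:P * G + F); rewrite rmorphD rmorphM piG piF.
    by rewrite last_variableC mwidenC mul_mpolyC.
  rewrite mpolyXE_id; elim/big_ind: _ => [|x y [F1 <-] [F2 <-]|i _].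
  - by exists 1; rewrite rmorph1.
  - by exists (F1 * F2); rewrite rmorphM.
  suff [G <-] : exists G, pi G = 'X_i by exists (G ^+ m i); rewrite rmorphXn.
  case: (unliftP ord_max i) => [j ->|->]; last by exists 'X;
    exact: last_variableX.
  exists ('X_j)%:P; rewrite last_variableC mwidenX mnmwiden1; congr 'X_[U_(_)].
  by apply: val_inj; rewrite /= /bump leqNgt ltn_ord.
have [s sE] := choice pi_surj.
have nQe : ~ Q (s e) by rewrite QE sE.
have [theta [thiota thQ the]] := enough_points_poly IHn Qprime nQe.
have ths p F : pi F = p -> theta (s p) = theta F.
  move=> piF; apply/eqP; rewrite -subr_eq0 -rmorphB; apply/eqP/thQ.
  by rewrite QE rmorphB sE piF subrr; case: idP.
have thD : zmod_morphism (theta \o s).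
  by move=> p r /=; rewrite (ths _ (s p - s r)) ?rmorphB // !sE.
have thM : monoid_morphism (theta \o s).
  split=> [|p r] /=; first by rewrite (ths _ 1) ?rmorph1.
  by rewrite (ths _ (s p * s r)) ?rmorphM // !sE.
pose theta' : {rmorphism {mpoly k[n.+1]} -> k} := HB.pack (theta \o s)
  (GRing.isZmodMorphism.Build _ _ _ thD) (GRing.isMonoidMorphism.Build _ _ _
    thM).
exists theta'; split=> //= [a|d Pd].
- by rewrite (ths _ (a%:MP)%:P) ?thiota // last_variableC mwidenC.
- by apply: thQ; rewrite QE sE.
Qed.

(** A homomorphism from the polynomial ring to k that is the identity on
    constants is evaluation at the point whose coordinates are the images of the
    variables. *)
Lemma mpoly_nullstellensatz (k : closedFieldType) (n : nat)
    (P : set {mpoly k[n]}) e : is_prime_ideal P -> ~ P e ->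
  exists a : 'I_n -> k, (forall f, P f -> f.@[a] = 0) /\ e.@[a] != 0.
Proof.
move=> Pprime nPe; have [theta [thC thP the]] := enough_points_mpoly Pprime nPe.
pose a i := theta 'X_i; have thE f : theta f = f.@[a].
  rewrite [f in LHS]mpolyE rmorph_sum mevalE; apply: eq_bigr => m _ /=.
  rewrite -mul_mpolyC rmorphM /= thC mpolyXE_id rmorph_prod; congr (_ * _).
  by apply: eq_bigr => i _; rewrite rmorphXn.
by exists a; split=> [f Pf|]; rewrite -thE //; exact: thP.
Qed.

(** * Subspaces graded by the classes of S_w *)

Lemma prime_avoiding (B : comNzRingType) (Q S : set B) :
  is_ideal Q -> S 1 -> (forall a b, S a -> S b -> S (a * b)) ->
  (forall a, S a -> ~ Q a) ->
  exists P, [/\ is_prime_ideal P, Q `<=` P & forall a, S a -> ~ P a].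
Proof.
move=> idQ S1 SM SQ.
have [|F FP [X0 FX0] Ftot|P [QP [idP SP] Pmax]] := @Zorn_above _
    (fun P => is_ideal P /\ forall a, S a -> ~ P a) Q.
- by [].
- split; last by move=> a Sa [X FX Xa]; case: (FP _ FX) => _ /(_ a Sa).
  split.
  + by exists X0 => //; case: (FP _ FX0) => [[]].
  + move=> a b [X FX Xa] [Y FY Yb].
    have [XY|YX] := Ftot X Y FX FY.
      by exists Y => //; case: (FP _ FY) => [[_ YD _] _]; apply: YD => //;
        exact: XY.
    by exists X => //; case: (FP _ FX) => [[_ XD _] _]; apply: XD => //;
      exact: YX.
  + move=> a b [X FX Xb]; have [idX _] := FP _ FX.
    by split; exists X => //; [exact: ideal_mulr|exact: ideal_mull].
exists P; split=> //; apply/comm_primeP; split=> // [|a b Pab]; first exact: SP.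
have [P0 PD _] := idP.
have meet d : ~ P d -> exists s u, [/\ S s & P (s - u * d)].
  move=> Pd; apply: contrapT => H; apply: Pd.
  suff <- : [set s | exists u, P (s - u * d)] = P.
    by exists 1; rewrite mul1r subrr.
  apply: Pmax; last by move=> s Ps; exists 0; rewrite mul0r subr0.
  split; last by move=> s Ss [u Pu]; apply: H; exists s, u.
  split.
  - by exists 0; rewrite mul0r subr0.
  - move=> s t [u Pu] [v Pv]; exists (u + v).
    by rewrite mulrDl opprD addrACA; exact: PD.
  - move=> t s [u Pu]; suff H' : exists u0, P (t * s - u0 * d).
      by split=> //; rewrite mulrC.
    by exists (t * u); rewrite -mulrA -mulrBr; exact: ideal_mulr.
apply: contrapT => /not_orP[/meet[s [u [Ss Ps]]] /meet[t [v [St Pt]]]].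
apply: (SP (s * t)); first exact: SM.
have -> : s * t = (s - u * a) * t + u * a * (t - v * b) + u * v * (a * b).
  rewrite mulrBl mulrBr addrA subrK.
  by rewrite [u * v * _]mulrACA [u * a * (v * b)]mulrA subrK.
apply: (PD); last exact: ideal_mulr.
by apply: (PD); [exact: ideal_mull|exact: ideal_mulr].
Qed.

Section Subspaces.
Variables (k : fieldType) (n : nat).
Local Notation V := {mpoly k[n]}.
Implicit Types (f g : V) (J K P : set V) (m : 'X_{1..n}).

Definition is_subspace J :=
  [/\ J 0, forall f g, J f -> J g -> J (f + g) & forall a f, J f -> J (a *: f)].

Lemma subspaceB J f g : is_subspace J -> J f -> J g -> J (f - g).
Proof.
by move=> [_ JD JZ] Jf Jg; apply: JD => //; rewrite -scaleN1r; exact: JZ.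
Qed.

Lemma subspaceZ J a f : a != 0 -> is_subspace J -> J (a *: f) -> J f.
Proof.
move=> a0 [_ _ JZ] /(JZ a^-1); rewrite scalerA mulVf // scale1r; exact.
Qed.

Lemma subspace_supp J f :
  is_subspace J -> (forall m, m \in msupp f -> J 'X_[m]) -> J f.
Proof.
move=> [J0 JD JZ] Jm; rewrite [f]mpolyE big_seq.
by apply: (big_ind J) => // m /Jm; exact: JZ.
Qed.

Lemma ideal_subspace J : is_ideal J -> is_subspace J.
Proof.
move=> idJ; have [J0 JD _] := idJ; split=> // a f Jf.
by rewrite -mul_mpolyC; exact: ideal_mulr.
Qed.

Lemma subspace_ideal J : is_subspace J ->
  (forall m f, J f -> J ('X_[m] * f)) -> is_ideal J.
Proof.
move=> sJ JX; have [J0 JD JZ] := sJ; split=> // g f Jf.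
suff Jgf : J (g * f) by split=> //; rewrite mulrC.
rewrite [g]mpolyE mulr_suml; apply: (big_ind J) => // m _.
by rewrite -scalerAl; apply/JZ/JX.
Qed.

Lemma size_msupp_lt f g m : {subset msupp g <= msupp f} ->
  m \in msupp f -> m \notin msupp g -> (size (msupp g) < size (msupp f))%N.
Proof.
move=> gf mf mg; rewrite -/(size (m :: msupp g)).
apply: uniq_leq_size => [|m' ]; first by rewrite /= mg msupp_uniq.
by rewrite inE => /predU1P[->|/gf].
Qed.

Lemma mdiag_mdiag (chi psi : 'X_{1..n} -> k) f :
  mdiag chi (mdiag psi f) = mdiag (fun m => chi m * psi m) f.
Proof. by apply/mpolyP => m; rewrite !mcoeff_mdiag mulrA. Qed.

Lemma eq_mdiag (chi psi : 'X_{1..n} -> k) f :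
  {in msupp f, chi =1 psi} -> mdiag chi f = mdiag psi f.
Proof.
move=> e; apply/mpolyP => m; rewrite !mcoeff_mdiag.
have [/e ->//|/memN_msupp_eq0 ->] := boolP (m \in msupp f).
by rewrite !mulr0.
Qed.

Lemma mdiag1 f : mdiag (fun=> 1) f = f.
Proof. by apply/mpolyP => m; rewrite mcoeff_mdiag mul1r. Qed.

Lemma mdiag0 f : mdiag (fun=> 0) f = 0.
Proof. by apply/mpolyP => m; rewrite mcoeff_mdiag mul0r mcoeff0. Qed.

(** Subtracting an eigenvalue of a diagonal operator removes a monomial outside
    E without touching the part supported in E (up to a scalar): a subspace
    stable under enough diagonal operators contains that part of each of its
    elements. *)
Lemma diagonal_component J (E : pred 'X_{1..n}) f : is_subspace J ->
  (forall m1, ~~ E m1 -> J 'X_[m1] \/ exists chi e,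
     [/\ forall g, J g -> J (mdiag chi g), forall m, E m -> chi m = e
       & chi m1 != e]) ->
  J f -> J (mdiag (fun m => (E m)%:R) f).
Proof.
move=> sJ HE; have [J0 JD JZ] := sJ.
have [N] := ubnP (size (msupp f)); elim: N f => // N IH f fN Jf.
have [/allP fE|/allPn [m1 m1f m1E]] := boolP (all E (msupp f)).
  rewrite (@eq_mdiag _ (fun=> 1)) ?mdiag1 // => m mf.
  by rewrite (fE m mf).
have [Jm1|[chi [e [Jchi chiE chi1]]]] := HE m1 m1E.
  have -> : mdiag (fun m => (E m)%:R) f =
      mdiag (fun m => (E m)%:R) (f - f@_m1 *: 'X_[m1]).
    by rewrite linearB linearZ /= mdiagX (negPf m1E) scale0r scaler0 subr0.
  apply: IH; last by apply: subspaceB => //; exact: JZ.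
  rewrite -ltnS; apply: leq_trans fN; rewrite ltnS.
  apply: (@size_msupp_lt _ _ m1) => // [m|].
    rewrite !mcoeff_msupp; apply: contraNneq => mf.
    rewrite mcoeffB mcoeffZ mcoeffX mf sub0r; case: (m1 =P m) => [mm|_];
      last by rewrite mulr0 oppr0 eqxx.
    by rewrite mm mf mul0r oppr0 eqxx.
  by rewrite mcoeff_msupp mcoeffB mcoeffZ mcoeffX eqxx mulr1 subrr eqxx.
pose g := (e - chi m1)^-1 *: (mdiag chi f - chi m1 *: f).
have e0 : e - chi m1 != 0 by rewrite subr_eq0 eq_sym.
have gE m : g@_m = (e - chi m1)^-1 * (chi m - chi m1) * f@_m.
  by rewrite mcoeffZ mcoeffB mcoeff_mdiag mcoeffZ -mulrBl mulrA.
have -> : mdiag (fun m => (E m)%:R) f = mdiag (fun m => (E m)%:R) g.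
  apply/mpolyP => m; rewrite !mcoeff_mdiag gE.
  case: (boolP (E m)) => [/chiE ->|_]; last by rewrite !mul0r.
  by rewrite mulVf // !mul1r.
apply: IH; last exact: JZ _ _ (subspaceB sJ (Jchi _ Jf) (JZ _ _ Jf)).
rewrite -ltnS; apply: leq_trans fN; rewrite ltnS.
apply: (@size_msupp_lt _ _ m1) => // [m|].
  by rewrite !mcoeff_msupp gE mulf_eq0 negb_or => /andP[].
by rewrite mcoeff_msupp gE subrr mulr0 mul0r eqxx.
Qed.

End Subspaces.

Section Strata.
Variables (k : fieldType) (n : nat) (q : 'M[k]_n).
Hypothesis qa : mult_antisymmetric q.
Local Notation V := {mpoly k[n]}.
Implicit Types (f g : V) (J K P : set V) (m : 'X_{1..n}) (w : {set 'I_n}).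

(** For m with this property the monomial of exponent m is invertible on the
    stratum of w. *)
Definition off w m := [forall (i | i \in w), m i == 0%N].

Lemma offP w m : reflect (forall i, i \in w -> m i = 0%N) (off w m).
Proof. by apply: (iffP forall_inP) => H i iw; apply/eqP/H. Qed.

Lemma offPn w m : ~~ off w m -> exists2 i, i \in w & m i != 0%N.
Proof. by rewrite negb_forall_in => /exists_inP. Qed.

Lemma off0 w : off w 0%MM. Proof. by apply/offP => i _; rewrite mnm0E. Qed.

Lemma offD w m m' : off w (m + m')%MM = off w m && off w m'.
Proof.
apply/offP/andP => [mm|[/offP mw /offP mw'] i iw].
  by split; apply/offP => i /mm /eqP;
    rewrite mnmDE addn_eq0 => /andP[/eqP ? /eqP].
by rewrite mnmDE mw // mw'.
Qed.

Lemma offU w i : off w U_(i)%MM = (i \notin w).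
Proof.
apply/offP/idP => [iw|iw j jw].
  by apply/negP => /iw; rewrite mnm1E eqxx.
by rewrite mnm1E; case: eqP => // ij; rewrite ij jw in iw.
Qed.

Lemma off_Gamma w m : off w m <-> Gamma_ w (exponent m).
Proof.
split=> [/offP mw|/Gamma_P mw]; first by apply/Gamma_P => i /mw;
  rewrite ffunE => ->.
by apply/offP => i /mw; rewrite ffunE; case.
Qed.

Definition in_class w m0 m := off w m && `[< S_ q w (exponent m - exponent m0)
  >].

Definition component w m0 := mdiag (fun m => (in_class w m0 m)%:R : k).

HB.instance Definition _ w m0 := GRing.Linear.on (component w m0).

Lemma in_class_refl w m : off w m -> in_class w m m.
Proof. by rewrite /in_class => ->; apply/asboolP; rewrite subrr;
  exact: S_0. Qed.

Lemma in_class_sym w m0 m : in_class w m0 m -> in_class w m m0.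
Proof.
move=> /andP[mw /asboolP mS]; apply/andP; split; last first.
  by apply/asboolP; rewrite -opprB; exact: S_N.
apply/off_Gamma; apply/Gamma_P => i iw.
have [/Gamma_P + _] := mS => /(_ i iw); rewrite !ffunE (offP _ _ mw i iw) add0r.
by move/eqP; rewrite oppr_eq0 => /eqP.
Qed.

Lemma in_class_trans w m1 m0 m : in_class w m0 m1 -> in_class w m1 m ->
  in_class w m0 m.
Proof.
move=> /andP[_ /asboolP m01] /andP[mw /asboolP m1S]; rewrite /in_class mw.
apply/asboolP; rewrite -(subrK (exponent m1) (exponent m)) -addrA.
exact: S_D.
Qed.

Lemma in_class_off w m0 m : in_class w m0 m -> off w m0.
Proof. by move=> /in_class_sym /andP[]. Qed.

Lemma in_classD w m0 m m0' m' : in_class w m0 m -> in_class w m0' m' ->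
  in_class w (m0 + m0')%MM (m + m')%MM.
Proof.
move=> /andP[mw /asboolP mS] /andP[mw' /asboolP mS'].
rewrite /in_class offD mw mw'; apply/asboolP.
by rewrite !exponentD opprD addrACA; exact: S_D.
Qed.

Definition homogeneous w m0 f := {subset msupp f <= in_class w m0}.

Lemma component_homogeneous w m0 f : homogeneous w m0 (component w m0 f).
Proof.
move=> m; rewrite mcoeff_msupp mcoeff_mdiag.
by case: (boolP (in_class w m0 m)) => [h _|_]; [exact: h|rewrite mul0r eqxx].
Qed.

Lemma component_id w m0 f : homogeneous w m0 f -> component w m0 f = f.
Proof.
move=> fh; rewrite /component (@eq_mdiag _ _ _ (fun=> 1)) ?mdiag1 // => m.
by move=> /fh h; have -> : in_class w m0 m by exact: h.
Qed.

Lemma component_or w m0 m f :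
  homogeneous w m0 f -> component w m f = f \/ component w m f = 0.
Proof.
move=> fh; have [mm0|mm0] := boolP (in_class w m m0).
  left; apply: component_id => m' /fh m0m'; exact: in_class_trans mm0 m0m'.
right; rewrite /component (@eq_mdiag _ _ _ (fun=> 0)) ?mdiag0 // => m' /fh m0m'.
have [mm'|//] := boolP (in_class w m m').
by case/negP: mm0; apply: in_class_trans mm' _; exact: in_class_sym.
Qed.

Lemma componentX_out w m0 m : ~~ off w m -> component w m0 'X_[m] = 0.
Proof. by move=> mw;
  rewrite /component mdiagX /in_class (negPf mw) scale0r. Qed.

Lemma homogeneousM w m0 m0' f g : homogeneous w m0 f -> homogeneous w m0' g ->
  homogeneous w (m0 + m0')%MM (f * g).
Proof.
move=> fh gh m /msuppM_le /allpairsP[[m1 m2] /= [/fh h1 /gh h2 ->]].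
exact: in_classD.
Qed.

Lemma homogeneousX w m : off w m -> homogeneous w m 'X_[m].
Proof. by move=> mw m'; rewrite msuppX inE => /eqP ->;
  exact: in_class_refl. Qed.

Lemma homogeneousZ w m a f : homogeneous w m f -> homogeneous w m (a *: f).
Proof. by move=> fh m' /msuppZ_le /fh. Qed.

Lemma components_suffice w K f : is_subspace K ->
  (forall m, ~~ off w m -> K 'X_[m]) -> (forall m0, K (component w m0 f)) -> K
    f.
Proof.
move=> sK Kout; have [K0 KD KZ] := sK.
have [N] := ubnP (size (msupp f)); elim: N f => // N IH f fN Kf.
have [/allP fout|/allPn [m0 m0f]] := boolP (all (predC (off w)) (msupp f)).
  by apply: subspace_supp => // m /fout /Kout.
rewrite /= negbK => m0w.
rewrite -(subrK (component w m0 f) f); apply: KD => //; apply: IH => [|m].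
  rewrite -ltnS; apply: leq_trans fN; rewrite ltnS.
  apply: (@size_msupp_lt _ _ _ _ m0) => // [m|].
    rewrite !mcoeff_msupp; apply: contraNneq => mf.
    by rewrite mcoeffB mcoeff_mdiag mf mulr0 subr0 eqxx.
  rewrite mcoeff_msupp mcoeffB mcoeff_mdiag in_class_refl //.
  by rewrite mul1r subrr eqxx.
rewrite linearB /=; apply: subspaceB => //.
by have [->|->] := component_or m (@component_homogeneous w m0 f).
Qed.

(** Subspaces spanned, modulo the monomials that vanish on the stratum of w, by
    homogeneous elements; for them the two multiplications have the same
    ideals. *)
Definition is_graded w J := [/\ is_subspace J, forall m, ~~ off w m -> J 'X_[m]
  & forall f m0, J f -> J (component w m0 f)].

(** The largest subspace of P graded by the classes of S_w. *)
Definition graded_core w P : set V := [set f | forall m0, P (component w m0 f)].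

Lemma graded_core_graded w P : is_subspace P -> is_graded w (graded_core w P).
Proof.
move=> [P0 PD PZ]; split.
- split=> [m0|f g Pf Pg m0|a f Pf m0]; first by rewrite linear0.
    by rewrite linearD; apply: PD; [exact: Pf|exact: Pg].
  by rewrite linearZ; apply: PZ; exact: Pf.
- by move=> m mw m0; rewrite componentX_out.
- move=> f m0 Pf m.
  by have [->|->] := component_or m (@component_homogeneous w m0 f).
Qed.

Lemma graded_core_sub w P : is_subspace P ->
  (forall m, ~~ off w m -> P 'X_[m]) -> graded_core w P `<=` P.
Proof. by move=> sP Pout f; exact: components_suffice. Qed.

Lemma graded_core_max w J P : is_graded w J -> J `<=` P -> J `<=` graded_core
  w P.
Proof. by move=> [_ _ Jc] JP f Jf m0; apply/JP/Jc. Qed.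

Lemma graded_core_ideal w P : is_ideal P -> is_ideal (graded_core w P).
Proof.
move=> idP; have sP := ideal_subspace idP.
have [sC Cout _] := graded_core_graded w sP; have [C0 CD CZ] := sC.
apply: subspace_ideal => // m f Cf.
pose K := [set g | graded_core w P ('X_[m] * g)].
apply: (@components_suffice w K).
- split=> [|g h Kg Kh|a g Kg]; rewrite /K /= ?mulr0 ?mulrDr -?scalerAr //.
    exact: CD.
  exact: CZ.
- by move=> m' m'w; rewrite /K /= -mpolyXD; apply: Cout;
  rewrite offD negb_and m'w orbT.
move=> m0; rewrite /K /=; have [mw|mw] := boolP (off w m); last first.
  apply: (subspace_supp sC) => m' /msuppM_le /allpairsP[[m1 m2] /= [+ _ ->]].
  by rewrite msuppX inE => /eqP ->; apply: Cout; rewrite offD negb_and mw.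
have h := homogeneousM (homogeneousX mw) (@component_homogeneous w m0 f).
move=> m'; have [->|->] := component_or m' h; last by case: sP.
exact: ideal_mulr.
Qed.

Definition in_stratum w J := forall i, J 'X_i <-> i \in w.

Lemma mon_split m i : m i != 0%N -> m = (U_(i) + (m - U_(i)))%MM.
Proof. by rewrite -lep1mP => /submK {1}<-; rewrite addmC. Qed.

Lemma stratum_out w P m : is_ideal P -> in_stratum w P -> ~~ off w m -> P
  'X_[m].
Proof.
move=> idP Pw /offPn[i iw mi]; rewrite (mon_split mi) mpolyXD.
by apply: ideal_mull => //; apply/Pw.
Qed.

Lemma mword_off w m i : off w m -> i \in mword m -> i \notin w.
Proof.
move=> /offP mw im; apply/negP => /mw mi0.
by move: im; rewrite -has_pred1 has_count count_mword mi0.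
Qed.

Lemma stratum_off w P m : is_prime_ideal P -> in_stratum w P -> off w m -> ~ P
  'X_[m].
Proof.
move=> /comm_primeP[idP P1 PM] Pw mw; rewrite -(mword_weight m).
have : all (fun i => i \notin w) (mword m) by apply/allP => i; exact: mword_off.
elim: (mword m) => [_|i l IH /= /andP[iw lw]].
  by rewrite /word_weight big_nil mpolyX0.
rewrite word_weight_cons mpolyXD => /PM[/Pw|]; last exact: IH.
by rewrite (negPf iw).
Qed.

(** Two exponents lie in the same class exactly when conjugation by each
    generator invertible on the stratum multiplies their monomials by the same
    scalar. *)
Lemma sigma_class w m0 m i : in_class w m0 m -> i \notin w ->
  sigma q (epsilon i) (exponent m) = sigma q (epsilon i) (exponent m0).
Proof.
move=> /andP[_ /asboolP/(S_P qa)[_ mS]] iw; have s_alt := sigma_alternating qa.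
rewrite -(subrK (exponent m0) (exponent m)) (bicharDr s_alt).
by rewrite (bicharC s_alt (_ - _)) mS ?invr1 ?mul1r.
Qed.

Lemma class_separated w m0 m : off w m0 -> off w m -> ~~ in_class w m0 m ->
  exists2 i, i \notin w &
    sigma q (epsilon i) (exponent m) != sigma q (epsilon i) (exponent m0).
Proof.
move=> m0w mw mE; have s_alt := sigma_alternating qa.
apply: contrapT => H; move: mE; rewrite /in_class mw => /asboolP; apply.
apply/(S_P qa); split=> [|i iw].
  move/off_Gamma/Gamma_P: mw => mw; move/off_Gamma/Gamma_P: m0w => m0w.
  apply/Gamma_P => i iw; move: (m0w i iw) (mw i iw).
  by rewrite !ffunE => -> ->; rewrite subrr.
apply: contrapT => si; apply: H; exists i => //; apply/eqP => e; apply: si.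
rewrite (bicharC s_alt (epsilon i)) (bicharBr s_alt) e divff ?invr1 //.
exact: (bichar_neq0 s_alt).
Qed.

Variables (c : {ffun 'I_n -> int} -> {ffun 'I_n -> int} -> k).
Hypotheses (c_alt : is_alternating_bicharacter c)
  (c2 : forall a b, c a b ^+ 2 = sigma q a b)
  (c1 : forall a b, sigma q a b = 1 -> c a b = 1).
Local Notation ce m m' := (c (exponent m) (exponent m')).
Local Notation tmul := (tmul c).

Lemma cocycle_class w m0 m m0' m' : in_class w m0 m -> in_class w m0' m' ->
  ce m m' = ce m0 m0'.
Proof.
move=> mm0 mm0'; have [/in_class_off/off_Gamma m0w] := mm0.
have [/in_class_off/off_Gamma m0w'] := mm0'.
have /andP[_ /asboolP mS] := mm0; have /andP[_ /asboolP mS'] := mm0'.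
have cS s b : S_ q w s -> Gamma_ w b -> c s b = 1 by move=> [_ sS] bw;
  apply/c1/sS.
have cS' s b : S_ q w s -> Gamma_ w b -> c b s = 1.
  by move=> sS bw; rewrite (bicharC c_alt s) cS // invr1.
rewrite -(subrK (exponent m0) (exponent m)) -(subrK (exponent m0') (exponent
  m')).
move: (exponent m - _) (exponent m' - _) mS mS' => s s' sS sS'.
rewrite (bicharDl c_alt) !(bicharDr c_alt) (cS _ _ sS) ?(cS' _ _ sS') //.
  by rewrite (cS _ _ sS) // !mul1r.
by case: sS'.
Qed.

Lemma tmulE f g : tmul f g = \sum_(m <- msupp f) \sum_(m' <- msupp g)
  (f@_m * g@_m' * ce m m') *: 'X_[m + m'].
Proof.
rewrite /tmul /mext; apply: eq_bigr => m _.
rewrite /tmul_mon /mext scaler_sumr; apply: eq_bigr => m' _.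
by rewrite !scalerA.
Qed.

(** The hypothesis that c is trivial where sigma is makes c constant on pairs of
    classes, so that twisting rescales products of homogeneous elements. *)
Lemma tmul_homogeneous w m0 m0' f g :
  homogeneous w m0 f -> homogeneous w m0' g -> tmul f g = ce m0 m0' *: (f * g).
Proof.
move=> fh gh; rewrite tmulE [f in RHS]mpolyE [g in RHS]mpolyE mulr_suml
  scaler_sumr.
rewrite big_seq [RHS]big_seq; apply: eq_bigr => m /fh mm0.
rewrite mulr_sumr scaler_sumr big_seq [RHS]big_seq;
  apply: eq_bigr => m' /gh mm0'.
rewrite (cocycle_class mm0 mm0') -scalerAl -scalerAr !scalerA -mpolyXD.
by congr (_ *: _); rewrite mulrC mulrA.
Qed.

Lemma tmul_homogeneous_homogeneous w m0 m0' f g :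
  homogeneous w m0 f -> homogeneous w m0' g -> homogeneous w (m0 + m0')%MM
    (tmul f g).
Proof.
move=> fh gh; rewrite (tmul_homogeneous fh gh).
by apply/homogeneousZ/homogeneousM.
Qed.

Lemma tmulNC m m' : tmul 'X_[m] 'X_[m'] =
  ce m m' ^+ 2 *: tmul 'X_[m'] 'X_[m].
Proof.
rewrite !tmulXX scalerA addmC (bicharC c_alt (exponent m)) expr2 mulfK //.
exact: (bichar_neq0 c_alt).
Qed.

(** The two-sided ideals and the prime ideals for the twisted product, with the
    conditions reduced to multiplication by monomials. *)
Definition is_tideal J := [/\ is_subspace J,
  forall m f, J f -> J (tmul 'X_[m] f) & forall m f, J f -> J (tmul f 'X_[m])].

Definition is_tprime J := [/\ is_tideal J, ~ J 'X_[0]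
  & forall f g, (forall m, J (tmul (tmul f 'X_[m]) g)) -> J f \/ J g].

Lemma tideal_mull J f g : is_tideal J -> J f -> J (tmul g f).
Proof.
move=> [sJ JX _] Jf; have [J0 JD JZ] := sJ.
elim/mpoly_linear_ind: g => [m|p p' IHp IHq|a p IH]; first exact: JX.
  by rewrite tmulDl; exact: JD.
by rewrite -tmulZl; exact: JZ.
Qed.

Lemma tideal_mulr J f g : is_tideal J -> J f -> J (tmul f g).
Proof.
move=> [sJ _ JX] Jf; have [J0 JD JZ] := sJ.
elim/mpoly_linear_ind: g => [m|p p' IHp IHq|a p IH]; first exact: JX.
  by rewrite tmulDr; exact: JD.
by rewrite -tmulZr; exact: JZ.
Qed.

Lemma tmul_subspacel J f : is_subspace J -> is_subspace [set g | J (tmul f g)].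
Proof.
move=> [J0 JD JZ]; split=> /= [|g h Jg Jh|a g Jg]; first by rewrite linear0.
  by rewrite tmulDr; exact: JD.
by rewrite -tmulZr; exact: JZ.
Qed.

Lemma tmul_subspacer J f : is_subspace J -> is_subspace [set g | J (tmul g f)].
Proof.
move=> [J0 JD JZ]; split=> /= [|g h Jg Jh|a g Jg].
- by rewrite /tmul linear0.
- by rewrite tmulDl; exact: JD.
- by rewrite -tmulZl; exact: JZ.
Qed.

Lemma graded_tideal w J : is_graded w J -> is_ideal J -> is_tideal J.
Proof.
move=> [sJ Jout Jc] idJ; have [J0 JD JZ] := sJ; split=> // m f Jf.
- have sK := tmul_subspacel 'X_[m] sJ.
  have Kout m' : ~~ (off w m && off w m') -> J (tmul 'X_[m] 'X_[m']).
    by rewrite -offD tmulXX => mw; apply/JZ/Jout.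
  have [mw|mw] := boolP (off w m); last first.
    by apply: (subspace_supp sK) => m' _; apply: Kout; rewrite (negPf mw).
  apply: (@components_suffice w _ _ sK) => [m' m'w|m0].
    by apply: Kout; rewrite (negPf m'w) andbF.
  change (J (tmul 'X_[m] (component w m0 f))).
  rewrite (tmul_homogeneous (homogeneousX mw) (@component_homogeneous w m0 f)).
  by apply: JZ; apply: ideal_mulr => //; exact: Jc.
- have sK := tmul_subspacer 'X_[m] sJ.
  have Kout m' : ~~ (off w m' && off w m) -> J (tmul 'X_[m'] 'X_[m]).
    by rewrite -offD tmulXX => mw; apply/JZ/Jout.
  have [mw|mw] := boolP (off w m); last first.
    by apply: (subspace_supp sK) => m' _; apply: Kout; rewrite (negPf mw) andbF.
  apply: (@components_suffice w _ _ sK) => [m' m'w|m0].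
    by apply: Kout; rewrite (negPf m'w).
  change (J (tmul (component w m0 f) 'X_[m])).
  rewrite (tmul_homogeneous (@component_homogeneous w m0 f) (homogeneousX mw)).
  by apply: JZ; apply: ideal_mull => //; exact: Jc.
Qed.

Lemma graded_ideal w J : is_graded w J -> is_tideal J -> is_ideal J.
Proof.
move=> [sJ Jout Jc] idJ; have [J0 JD JZ] := sJ.
apply: subspace_ideal => // m f Jf.
have sK : is_subspace [set g | J ('X_[m] * g)].
  split=> /= [|g h Jg Jh|a g Jg]; rewrite ?mulr0 ?mulrDr -?scalerAr //.
    exact: JD.
  exact: JZ.
have Kout m' : ~~ (off w m && off w m') -> J ('X_[m] * 'X_[m']).
  by rewrite -offD -mpolyXD; exact: Jout.
have [mw|mw] := boolP (off w m); last first.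
  by apply: (subspace_supp sK) => m' _; apply: Kout; rewrite (negPf mw).
apply: (@components_suffice w _ _ sK) => [m' m'w|m0].
  by apply: Kout; rewrite (negPf m'w) andbF.
have := tideal_mull 'X_[m] idJ (Jc f m0 Jf).
rewrite (tmul_homogeneous (homogeneousX mw) (@component_homogeneous w m0 f)).
by apply: subspaceZ => //; exact: (bichar_neq0 c_alt).
Qed.

Lemma tstratum_out w J m : is_tideal J -> in_stratum w J -> ~~ off w m -> J
  'X_[m].
Proof.
move=> idJ Jw /offPn[i iw mi]; have [sJ _ _] := idJ.
suff : J (tmul 'X_i 'X_[m - U_(i)]).
  rewrite tmulXX -mon_split //; apply: subspaceZ => //.
  exact: (bichar_neq0 c_alt).
by apply: tideal_mulr => //; apply/Jw.
Qed.

Lemma tprime_regular J f m : is_tprime J -> J (tmul f 'X_[m]) -> J f \/ J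
  'X_[m].
Proof.
move=> [idJ _ Jp] Jfm; apply: Jp => m'; have [[_ _ JZ] _ JX] := idJ.
rewrite -(tmulA c_alt) tmulNC -tmulZr (tmulA c_alt); exact/JZ/JX.
Qed.

Lemma tstratum_off w J m : is_tprime J -> in_stratum w J -> off w m -> ~ J
  'X_[m].
Proof.
move=> Jp Jw mw; rewrite -(mword_weight m); have [[sJ _ _] J1 _] := Jp.
have : all (fun i => i \notin w) (mword m) by apply/allP => i; exact: mword_off.
elim: (mword m) => [_|i l IH /= /andP[iw lw]];
  first by rewrite /word_weight big_nil.
move=> Jil; suff : J (tmul 'X_i 'X_[word_weight l]).
  by case/(tprime_regular Jp) => [/Jw|]; [rewrite (negPf iw)|exact: IH].
by rewrite tmulXX -word_weight_cons; case: sJ => _ _; exact.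
Qed.

(** Right saturating an ideal at the monomials invertible on the stratum makes it
    stable under conjugation by them, so its elements can be decomposed. *)
Lemma tideal_component w J f m0 : is_tideal J ->
  (forall m, ~~ off w m -> J 'X_[m]) -> J f ->
  exists2 m, off w m & J (tmul (component w m0 f) 'X_[m]).
Proof.
move=> idJ Jout Jf; have [sJ JXl JXr] := idJ; have [J0 JD JZ] := sJ.
pose K := [set g | exists2 m, off w m & J (tmul g 'X_[m])].
have [m0w|m0w] := boolP (off w m0); last first.
  exists 0%MM; rewrite ?off0 // /component (@eq_mdiag _ _ _ (fun=> 0)).
    by rewrite mdiag0 /tmul linear0.
  by move=> m _; case: (boolP (in_class w m0 m)) => // /in_class_off;
    rewrite (negPf m0w).
suff : K (component w m0 f) by [].
apply: diagonal_component.
- split=> [|g h [m mw Jg] [m' mw' Jh]|a g [m mw Jg]].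
  + by exists 0%MM; rewrite ?off0 // /tmul linear0.
  + exists (m + m')%MM; first by rewrite offD mw.
    rewrite tmulDl; apply: JD; apply: (@subspaceZ _ _ _ (ce m m')) => //.
    * exact: (bichar_neq0 c_alt).
    * by rewrite tmulZr -tmulXX (tmulA c_alt); exact: JXr.
    * exact: (bichar_neq0 c_alt).
    * rewrite (bicharC c_alt (exponent m')) addmC.
      apply: (@subspaceZ _ _ _ (ce m' m ^+ 2)) => //.
        by rewrite expf_neq0 ?(bichar_neq0 c_alt).
      rewrite scalerA expr2 mulfK ?(bichar_neq0 c_alt) //.
      by rewrite tmulZr -tmulXX (tmulA c_alt); exact: JXr.
  + by exists m => //; rewrite -tmulZl; exact: JZ.
- move=> m1 m1E; have [m1w|m1w] := boolP (off w m1); last first.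
    by left; exists 0%MM; rewrite ?off0 //; apply/JXr/Jout.
  right; have [i iw si] := class_separated m0w m1w m1E.
  exists (fun m => sigma q (epsilon i) (exponent m)),
         (sigma q (epsilon i) (exponent m0)); split.
  + move=> g [m mw Jg]; exists (U_(i) + m)%MM; first by rewrite offD offU iw.
    suff -> : tmul (mdiag (fun m => sigma q (epsilon i) (exponent m)) g)
      'X_[U_(i) + m]
        = (ce U_(i) m)^-1 *: tmul 'X_[U_(i)] (tmul g 'X_[m]).
      by apply/JZ/JXl.
    elim/mpoly_linear_ind: g {Jg} => [m'|g h IHg IHh|a g IHg]; last 2 first.
    * by rewrite linearD !tmulDl tmulDr IHg IHh scalerDr.
    * by rewrite linearZ /= -!tmulZl -tmulZr IHg !scalerA mulrC.
    rewrite mdiagX -tmulZl !tmulXX -tmulZr tmulXX !scalerA -exponentU -c2.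
    rewrite [in LHS]addmA (addmC m') -addmA !exponentD !(bicharDr c_alt)
      (bicharC c_alt (exponent U_(i)) (exponent m')).
    congr (_ *: _); rewrite expr2 mulrA mulfK ?(bichar_neq0 c_alt) //.
    rewrite [ce U_(i) m' * ce U_(i) m]mulrC mulrACA mulVf ?(bichar_neq0 c_alt)
      //.
    by rewrite mul1r mulrC.
  + by move=> m /sigma_class; exact.
  + exact: si.
- by exists 0%MM; rewrite ?off0 // tmul1r.
Qed.

(** A monomial invertible on the stratum is normal, hence regular modulo a prime,
    so the prime is its own saturation and contains the components of its
    elements. *)
Lemma tprime_graded w J : is_tprime J -> in_stratum w J -> is_graded w J.
Proof.
move=> Jp Jw; have [idJ _ _] := Jp; have [sJ _ _] := idJ.
have Jout m := @tstratum_out w J m idJ Jw.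
split=> // f m0 /(tideal_component m0 idJ Jout)[m mw].
by case/(tprime_regular Jp) => // /(tstratum_off Jp Jw mw).
Qed.

Lemma graded_core_stratum w P : is_prime_ideal P -> in_stratum w P ->
  in_stratum w (graded_core w P).
Proof.
move=> Pp Pw i; have [idP _ _] := Pp; have sP := ideal_subspace idP.
have [_ Cout _] := graded_core_graded w sP.
split=> [/graded_core_sub H|iw]; last by apply: Cout; rewrite offU negbK.
by apply/Pw/H => // m; exact: stratum_out.
Qed.

(** If two ideals with product in the core Q were not in Q, their elements would
    have components outside P; multiplied by monomials invertible on the stratum,
    these components come back to the ideals, and on homogeneous elements the
    twisted product is a multiple of the product, for which P is prime. *)
Lemma graded_core_tprime w P : is_prime_ideal P -> in_stratum w P ->
  is_tprime (graded_core w P).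
Proof.
move=> Pp Pw; have [idP P1 PM] := (comm_primeP P).1 Pp.
have sP := ideal_subspace idP; set Q := graded_core w P.
have Qg : is_graded w Q := graded_core_graded w sP.
have [sQ Qout Qc] := Qg; have [Q0 QD QZ] := sQ.
have idQ : is_tideal Q := graded_tideal Qg (graded_core_ideal w idP).
have QP : Q `<=` P by apply: graded_core_sub => // m; exact: stratum_out.
have Pgt m f : off w m -> P (f * 'X_[m]) -> P f.
  by move=> mw /PM[//|/(stratum_off Pp Pw mw)].
split=> // [/QP|f g Qfg]; first by rewrite mpolyX0.
have [//|nQf] := pselect (Q f); first by left.
right; apply: contrapT => nQg.
have /existsNP[m0 nPf] := nQf; have /existsNP[m1 nPg] := nQg.
have idJ h : is_tideal [set a | forall m, Q (tmul (tmul a 'X_[m]) h)].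
  split=> [|m a Ja m'|m a Ja m'] /=.
  - split=> [m|a b Ja Jb m|x a Ja m]; first by rewrite /tmul !linear0.
      by rewrite !tmulDl; apply: QD; [exact: Ja|exact: Jb].
    by rewrite -!tmulZl; apply: QZ; exact: Ja.
  - rewrite -!(tmulA c_alt); apply: (tideal_mull _ idQ).
    by rewrite (tmulA c_alt); exact: Ja.
  - by rewrite -(tmulA c_alt a) tmulXX -tmulZr -tmulZl; apply: QZ; exact: Ja.
have idJ' h : is_tideal [set b | forall m, Q (tmul (tmul h 'X_[m]) b)].
  split=> [|m b Jb m'|m b Jb m'] /=.
  - split=> [m|a b Ja Jb m|x a Ja m]; first by rewrite linear0.
      by rewrite tmulDr; apply: QD; [exact: Ja|exact: Jb].
    by rewrite -tmulZr; apply: QZ; exact: Ja.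
  - rewrite (tmulA c_alt) -(tmulA c_alt h) tmulXX -tmulZr -tmulZl.
    by apply: QZ; exact: Jb.
  - by rewrite (tmulA c_alt); apply: (tideal_mulr _ idQ); exact: Jb.
have [||m mw] := @tideal_component w _ f m0 (idJ g).
- by move=> m mw m' /=; do 2!apply: (tideal_mulr _ idQ); exact: Qout.
- exact: Qfg.
set f' := tmul _ _ => /= Qf'g.
have [||m' mw'] := @tideal_component w _ g m1 (idJ' f').
- by move=> m2 m2w m' /=; apply: (tideal_mull _ idQ); exact: Qout.
- exact: Qf'g.
move=> /(_ 0%MM); rewrite (tmul1r c_alt) => /QP.
have fh := @component_homogeneous w m0 f;
  have gh := @component_homogeneous w m1 g.
have mh := homogeneousX mw; have mh' := homogeneousX mw'.
have fmh := tmul_homogeneous_homogeneous fh mh.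
have gmh := tmul_homogeneous_homogeneous gh mh'.
rewrite (tmul_homogeneous fmh gmh) /f' (tmul_homogeneous fh mh)
  (tmul_homogeneous gh mh').
have P_Z m2 m3 h : P (ce m2 m3 *: h) -> P h.
  by apply: subspaceZ => //; exact: (bichar_neq0 c_alt).
move/P_Z/PM => [/P_Z|/P_Z].
  by move/(Pgt _ _ mw).
by move/(Pgt _ _ mw').
Qed.

(** The homogeneous elements outside J form a multiplicative set; an ideal
    maximal among those containing J and avoiding it is the required prime. *)
Lemma tprime_lift w J : is_tprime J -> in_stratum w J ->
  exists P, [/\ is_prime_ideal P, in_stratum w P & graded_core w P = J].
Proof.
move=> Jp Jw; have Jg := tprime_graded Jp Jw.
have [idJ J1 JM] := Jp; have [sJ _ _] := idJ; have [_ Jout Jc] := Jg.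
have [J0 JD JZ] := sJ; have idRJ := graded_ideal Jg idJ.
have X1 : 'X_[0] = 1 :> V by rewrite mpolyX0.
have [|a b|a [_]//|P [Pp JP PS]] := @prime_avoiding _ J
    [set f | (exists m0, homogeneous w m0 f) /\ ~ J f] idRJ.
- by split; [exists 0%MM; rewrite -X1; apply/homogeneousX/off0|rewrite -X1].
- move=> [[m0 ah] nJa] [[m1 bh] nJb]; split.
    by exists (m0 + m1)%MM; exact: homogeneousM.
  move=> Jab; case: (JM a b) => // m.
  have [mw|mw] := boolP (off w m); last first.
    by apply: (tideal_mulr _ idJ); apply: (tideal_mull _ idJ); exact: Jout.
  have amh := tmul_homogeneous_homogeneous ah (homogeneousX mw).
  rewrite (tmul_homogeneous amh bh) (tmul_homogeneous ah (homogeneousX mw)).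
  by rewrite -scalerAl mulrAC; apply: (JZ); apply: (JZ); exact: ideal_mull.
have Pw : in_stratum w P.
  move=> i; split=> [PX|/Jw/JP//]; apply: contrapT => /negP iw.
  apply: (PS 'X_i) => //; split; last by move/Jw; rewrite (negPf iw).
  by exists U_(i)%MM; apply: homogeneousX; rewrite offU.
exists P; split=> //; apply/seteqP; split; last exact: graded_core_max.
move=> f Pf; apply: (components_suffice sJ Jout) => m0.
apply: contrapT => nJ; apply: (PS (component w m0 f)) => //.
by split=> //; exists m0; exact: component_homogeneous.
Qed.

End Strata.

(** * The maps between the spectra *)

(** The prime ideals of a noncommutative ring in terms of elements: the elements a
    with a B b in P form an ideal, and so do the b that work for all of them. *)
Lemma prime_elementwise (B : nzRingType) (P : set B) : is_prime_ideal P <->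
  [/\ is_ideal P, ~ P 1
    & forall a b, (forall x, P (a * x * b)) -> P a \/ P b].
Proof.
split=> [[idP /(ideal_proper idP) P1 Pprime]|[idP P1 Pprime]]; split=> //.
- move=> a b Pab; pose I := [set a | forall x, P (a * x * b)].
  pose J := [set b | forall a x, I a -> P (a * x * b)].
  have [P0 PD _] := idP.
  have idI : is_ideal I.
    split=> [x|u v Iu Iv x|u v Iv].
    + by rewrite !mul0r.
    + by rewrite !mulrDl; apply: PD; [exact: Iu|exact: Iv].
    + split=> x; first by rewrite -!mulrA; apply: ideal_mulr; rewrite ?mulrA.
      by rewrite -(mulrA v); exact: Iv.
  have idJ : is_ideal J.
    split=> [u x _|u v Ju Jv u' x Iu'|u v Jv].
    + by rewrite mulr0.
    + by rewrite mulrDr; apply: PD; [exact: Ju|exact: Jv].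
    + split=> u' x Iu'; first by rewrite mulrA -(mulrA u'); exact: Jv.
      by rewrite mulrA; apply: ideal_mull => //; exact: Jv.
  have [|IP|JP] := Pprime _ _ idI idJ.
  + apply/(ideal_productP _ _ idP) => u v Iu Jv.
    by rewrite -(mulr1 u); exact: Jv.
  + by left; exact: IP.
  + by right; apply: JP => u x; exact.
- by apply/(ideal_proper idP).
- move=> I J idI idJ /(ideal_productP _ _ idP) IJP.
  have [IP|nIP] := pselect (I `<=` P); [by left|right=> b Jb].
  have [a [Ia nPa]] : exists a, I a /\ ~ P a.
    apply: contrapT => H; apply: nIP => a Ia; apply: contrapT => nPa.
    by apply: H; exists a.
  have [//|//|//] := Pprime a b _.
  by move=> x; apply: IJP => //; exact: ideal_mull.
Qed.

Lemma spec_stratumP (B : nzRingType) (n : nat) (x : 'I_n -> B) w (P : spec B) :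
  injective x -> spec_stratum x w P <-> forall i, ideal_of P (x i) <-> i \in w.
Proof.
move=> x_inj; split=> [Pw i|Pw].
  split=> [Pi|iw].
    have : (x @` [set i | i \in w]) (x i) by rewrite -Pw; split=> //; exists i.
    by move=> [j jw /x_inj <-].
  have : (ideal_of P `&` range x) (x i) by rewrite Pw; exists i.
  by case.
apply/seteqP; split=> [a [Pa [i _ xi]]|_ [i iw <-]].
  by exists i => //; apply/Pw; rewrite xi.
by split; [apply/Pw|exists i].
Qed.

Lemma spec_ext (B : nzRingType) (P Q : spec B) :
  (forall a, ideal_of P a <-> ideal_of Q a) -> P = Q.
Proof. by move=> PQ; apply/spec_inj/seteqP; split=> a /PQ. Qed.

Lemma finite_union_closed (B : nzRingType) (I : finType) (F : I -> set B) :
  (forall i, is_ideal (F i)) ->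
  exists2 K, is_ideal K & forall P : spec B, K `<=` P <-> exists i, F i `<=` P.
Proof.
move=> idF; have : closed (\bigcup_(i in [set` enum I]) vanishing (F i)).
  rewrite bigcup_seq; apply: closed_bigsetU => i _; apply/zariski_closedP.
  by exists (F i).
case/zariski_closedP => K idK KE; exists K => // P.
suff : vanishing K P <-> exists i, F i `<=` P by [].
rewrite -KE; split=> [[i _ FP]|[i FP]]; exists i => //=.
by rewrite mem_enum.
Qed.

Section TorusPairing.
Variables (k : fieldType) (n : nat).
Implicit Types (h g : torus k n) (m : 'X_{1..n}).

Definition weight h m : k := \prod_(i < n) h i ^+ m i.

Lemma weight_neq0 h m : weight h m != 0.
Proof. by apply/prodf_neq0 => i _; rewrite expf_neq0 ?torusP. Qed.

Lemma weightD h m m' : weight h (m + m')%MM = weight h m * weight h m'.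
Proof. by rewrite /weight -big_split; apply: eq_bigr => i _;
  rewrite mnmDE exprD. Qed.

Lemma weight0 h : weight h 0%MM = 1.
Proof. by rewrite /weight big1 // => i _; rewrite mnm0E. Qed.

Lemma weightU h i : weight h U_(i)%MM = h i.
Proof.
rewrite /weight (bigD1 i) //= mnm1E eqxx big1 ?mulr1 // => j /negPf ji.
by rewrite mnm1E eq_sym ji.
Qed.

Lemma pairingD h a b : pairing h (a + b) = pairing h a * pairing h b.
Proof.
rewrite /pairing -big_split; apply: eq_bigr => i _.
by rewrite ffunE expfzDr ?torusP.
Qed.

Lemma pairingN h a : pairing h (- a) = (pairing h a)^-1.
Proof.
rewrite /pairing -prodfV; apply: eq_bigr => i _.
by rewrite ffunE invr_expz.
Qed.

Lemma pairing_exponent h m : pairing h (exponent m) = weight h m.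
Proof. by apply: eq_bigr => i _; rewrite ffunE. Qed.

Lemma pairingM h g a : pairing (torus_mul h g) a = pairing h a * pairing g a.
Proof.
rewrite /pairing -big_split; apply: eq_bigr => i _.
by rewrite ffunE expfzMl.
Qed.

Lemma pairing1 a : pairing (torus_one k n) a = 1.
Proof. by rewrite /pairing big1 // => i _; rewrite ffunE exp1rz. Qed.

Lemma pairingV h a : pairing (torus_inv h) a = (pairing h a)^-1.
Proof.
rewrite /pairing -prodfV; apply: eq_bigr => i _.
by rewrite ffunE expfV.
Qed.

Lemma torus_invK h : torus_inv (torus_inv h) = h.
Proof. by apply/val_inj/ffunP => i; rewrite !ffunE invrK. Qed.

Lemma coordinates_inj : injective (coordinates k n).
Proof.
move=> i j /(congr1 (mcoeff U_(j)%MM)); rewrite !mcoeffXU eqxx.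
by case: eqP => // _ /eqP; rewrite eq_sym oner_eq0.
Qed.

Variables (actR : torus_action n {mpoly k[n]})
  (actR_std : is_standard_action (coordinates k n) actR).

Lemma actRE h f : actR h f = mdiag (weight h) f.
Proof.
apply: mpoly_linear_ext => m /=; rewrite mdiagX mpolyXE_id rmorph_prod.
rewrite /weight -scaler_prod; apply: eq_bigr => i _.
by rewrite rmorphXn /= -exprZn -actR_std.
Qed.

End TorusPairing.

Section Maps.
Variables (k : fieldType) (n : nat) (q : 'M[k]_n) (qa : mult_antisymmetric q).
Variables (c : {ffun 'I_n -> int} -> {ffun 'I_n -> int} -> k).
Hypotheses (c_alt : is_alternating_bicharacter c)
  (c2 : forall a b, c a b ^+ 2 = sigma q a b)
  (c1 : forall a b, sigma q a b = 1 -> c a b = 1).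
Variables (A : algType k) (x : 'I_n -> A) (X : 'X_{1..n} -> A)
  (Phi : {linear A -> {mpoly k[n]}}).
Hypothesis AX : is_twisted_identification c x X Phi.
Local Notation tmul := (tmul c).
Local Notation graded_core := (graded_core q).
Implicit Types (J : set {mpoly k[n]}) (w : {set 'I_n}).

Let XU i : X U_(i)%MM = x i. Proof. by case: AX. Qed.
Let PhiX m : Phi (X m) = 'X_[m]. Proof. by case: AX. Qed.
Let XM m m' : X m * X m' = c (exponent m) (exponent m') *: X (m + m')%MM.
Proof. by case: AX. Qed.

Lemma Phix i : Phi (x i) = 'X_i. Proof. by rewrite -XU PhiX. Qed.

Lemma PhiK' p : Phi (mext X p) = p.
Proof.
elim/mpoly_linear_ind: p => [m|p r IHp IHr|a p IH]; first by rewrite mextX PhiX.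
  by rewrite !linearD /= IHp IHr.
by rewrite !linearZ /= IH.
Qed.

Lemma PhiK a : mext X (Phi a) = a.
Proof. by have [_ _ _ /bij_inj Phi_inj] := AX; apply: Phi_inj;
  rewrite PhiK'. Qed.

Lemma x_inj : injective x.
Proof. by move=> i j /(congr1 Phi); rewrite !Phix => /coordinates_inj. Qed.

Lemma PhiM a b : Phi (a * b) = tmul (Phi a) (Phi b).
Proof.
rewrite -{1}(PhiK a) -{1}(PhiK b).
elim/mpoly_linear_ind: (Phi a) => [m|p r IHp IHr|u p IH]; last 2 first.
- by rewrite linearD mulrDl linearD /= IHp IHr tmulDl.
- by rewrite linearZ -scalerAl linearZ /= IH tmulZl.
elim/mpoly_linear_ind: (Phi b) => [m'|p r IHp IHr|u p IH]; last 2 first.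
- by rewrite linearD mulrDr linearD /= IHp IHr tmulDr.
- by rewrite linearZ -scalerAr linearZ /= IH tmulZr.
by rewrite !mextX XM linearZ /= PhiX tmulXX.
Qed.

Lemma X0 : X 0%MM = 1.
Proof.
have X0l a : X 0%MM * a = a.
  have [_ _ _ /bij_inj Phi_inj] := AX; apply: Phi_inj.
  by rewrite PhiM PhiX (tmul1l c_alt).
by rewrite -[LHS]mulr1 X0l.
Qed.

Lemma Phi1 : Phi 1 = 'X_[0]. Proof. by rewrite -X0 PhiX. Qed.

Lemma tidealP J : is_tideal c J <-> is_ideal (Phi @^-1` J).
Proof.
split=> [idJ|[J0 JD JM]].
  have [[J0 JD JZ] _ _] := idJ; split=> /= [|a b Ja Jb|a b Jb].
  - by rewrite linear0.
  - by rewrite linearD; exact: JD.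
  - by rewrite !PhiM; split; [exact: tideal_mull|exact: tideal_mulr].
have JP f : J f <-> (Phi @^-1` J) (mext X f) by rewrite /= PhiK'.
have JMl p f : J f -> J (tmul p f).
  by move/JP/(JM (mext X p)) => [+ _]; rewrite /= PhiM !PhiK'.
have JMr p f : J f -> J (tmul f p).
  by move/JP/(JM (mext X p)) => [_]; rewrite /= PhiM !PhiK'.
split=> [|m f|m f]; [|exact: JMl|exact: JMr].
split=> [|f g /JP Jf /JP Jg|a f].
- by apply/JP; rewrite linear0.
- by apply/JP; rewrite linearD; exact: JD.
- by move/(JMl (a *: 'X_[0])); rewrite -tmulZl (tmul1l c_alt).
Qed.

Lemma tprimeP J : is_tprime c J <-> is_prime_ideal (Phi @^-1` J).
Proof.
split=> [[/tidealP idJ J1 JM]|/prime_elementwise[idJ J1 JM]].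
  apply/prime_elementwise; split=> // [|a b Jab]; first by rewrite /= Phi1.
  by apply: JM => m; have := Jab (X m); rewrite /= !PhiM PhiX.
split; [exact/tidealP|by rewrite -Phi1|move=> f g Jfg].
rewrite -(PhiK' f) -(PhiK' g); apply: JM => a; rewrite /= !PhiM !PhiK'.
elim/mpoly_linear_ind: (Phi a) => [//|p r IHp IHr|u p IH].
  rewrite tmulDr tmulDl; have [[_ JD _] _ _] := (tidealP J).2 idJ; exact: JD.
rewrite -tmulZr -tmulZl; have [[_ _ JZ] _ _] := (tidealP J).2 idJ; exact: JZ.
Qed.

(** Sets of elements of A, seen in the polynomial space. *)
Definition pullback (Q : set A) : set {mpoly k[n]} := [set f | Q (mext X f)].

Lemma pullbackK Q : Phi @^-1` pullback Q = Q.
Proof. by apply/seteqP; split=> a; rewrite /pullback /= PhiK. Qed.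

Lemma pullback_Phi (Q : set A) a : pullback Q (Phi a) <-> Q a.
Proof. by rewrite /pullback /= PhiK. Qed.

Lemma pullback_tprime (Q : spec A) : is_tprime c (pullback Q).
Proof. by apply/tprimeP; rewrite pullbackK; exact: spec_prime. Qed.

Lemma pullback_stratum w (Q : spec A) :
  spec_stratum x w Q <-> in_stratum w (pullback Q).
Proof.
have PQ i : pullback Q 'X_i <-> ideal_of Q (x i) by rewrite -Phix;
  exact: pullback_Phi.
rewrite (spec_stratumP _ _ x_inj).
by split=> Qw i; [rewrite PQ Qw|rewrite -PQ Qw].
Qed.

Lemma coordinates_stratum w (P : spec {mpoly k[n]}) :
  spec_stratum (coordinates k n) w P <-> in_stratum w P.
Proof. exact: (spec_stratumP _ _ (@coordinates_inj k n)). Qed.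

Definition stratum_of (B : nzRingType) (y : 'I_n -> B) (P : set B) : {set
  'I_n} :=
  finset (fun i => `[< P (y i) >]).

Lemma in_stratum_of (P : spec {mpoly k[n]}) :
  in_stratum (stratum_of (coordinates k n) P) P.
Proof. by move=> i; rewrite inE; split=> [/asboolP|/asboolP]. Qed.

Lemma in_stratum_inj w w' J : in_stratum w J -> in_stratum w' J -> w = w'.
Proof.
move=> Jw Jw'; apply/setP => i; apply/idP/idP.
  by move=> /Jw /Jw'.
by move=> /Jw' /Jw.
Qed.

Lemma pullback_in_stratum (Q : spec A) :
  in_stratum (stratum_of x Q) (pullback Q).
Proof.
by apply/pullback_stratum/(spec_stratumP _ _ x_inj) => i; rewrite inE;
  split=> /asboolP.
Qed.

Lemma phi_subproof (P : spec {mpoly k[n]}) : is_prime_ideal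
  (Phi @^-1` graded_core (stratum_of (coordinates k n) P) P).
Proof.
apply/tprimeP; apply: graded_core_tprime => //; first exact: spec_prime.
exact: in_stratum_of.
Qed.

Definition phi (P : spec {mpoly k[n]}) : spec A := Spec (phi_subproof P).

Lemma phiE w (P : spec {mpoly k[n]}) : in_stratum w P ->
  ideal_of (phi P) = Phi @^-1` graded_core w P.
Proof. by move=> /(in_stratum_inj (in_stratum_of P)) <-. Qed.

Lemma pullback_phi w (P : spec {mpoly k[n]}) : in_stratum w P -> pullback (phi
  P) = graded_core w P.
Proof.
move=> /phiE ->; apply/seteqP.
by split=> f; rewrite /pullback /= PhiK'.
Qed.

Lemma phi_stratum w (P : spec {mpoly k[n]}) : in_stratum w P <-> spec_stratum
  x w (phi P).
Proof.
have Pw := in_stratum_of P.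
have Cw := graded_core_stratum qa (spec_prime P) Pw.
rewrite pullback_stratum (pullback_phi Pw); split=> [Pw'|Cw'].
  by rewrite -(in_stratum_inj Pw Pw').
by rewrite (in_stratum_inj Cw' Cw).
Qed.

Lemma phi_sub (P : spec {mpoly k[n]}) a : ideal_of (phi P) a -> ideal_of P
  (Phi a).
Proof.
have Pw := in_stratum_of P; rewrite (phiE Pw).
have [idP _ _] := spec_prime P; apply: (graded_core_sub qa).
  exact: ideal_subspace idP.
by move=> m; exact: stratum_out.
Qed.

Lemma phi_surjective (Q : spec A) : exists P, phi P = Q.
Proof.
have Qw := pullback_in_stratum Q.
have [P [Pp Pw PE]] := tprime_lift qa c_alt c2 c1 (pullback_tprime Q) Qw.
by exists (Spec Pp); apply/spec_inj;
  rewrite (@phiE _ (Spec Pp) Pw) /= PE pullbackK.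
Qed.

(** A subspace graded by the classes of S_w that lies in a prime P of the
    stratum of v is also graded there: v contains w, and two exponents off v in
    the same class for w are in the same class for v. *)
Lemma graded_sub_core w v J (P : set {mpoly k[n]}) : is_graded q w J ->
  is_prime_ideal P -> in_stratum v P -> J `<=` P -> J `<=` graded_core v P.
Proof.
move=> [_ Jout Jc] Pp Pv JP f Jf m0.
have [idP _ _] := Pp; have sP := ideal_subspace idP; have [P0 PD PZ] := sP.
have wv : {subset w <= v}.
  by move=> i iw; apply/Pv/JP/Jout; rewrite offU negbK.
have off_vw m : off v m -> off w m.
  by move=> /offP mv; apply/offP => i /wv /mv.
apply: (@components_suffice _ _ q qa w [set g | P (component q v m0 g)]).
- split=> /= [|g h Pg Ph|a g Pg]; first by rewrite linear0.
    by rewrite linearD; exact: PD.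
  by rewrite linearZ; exact: PZ.
- move=> m mw /=; rewrite componentX_out //; exact: contra (off_vw m) mw.
move=> m1; change (P (component q v m0 (component q w m1 f))).
set g := component q w m1 f; have Pg : P g by apply/JP/Jc.
have gh : homogeneous q w m1 g by exact: component_homogeneous.
have vclass m m' : in_class q w m1 m -> in_class q w m1 m' -> off v m' ->
    in_class q v m0 m -> in_class q v m0 m'.
  move=> mm1 /(in_class_trans qa (in_class_sym qa mm1)) mm' m'v mm0.
  apply: (in_class_trans qa mm0); have /andP[mv _] := mm0.
  have /andP[_ /asboolP[mS mS']] := mm'; apply/andP; split=> //; apply/asboolP.
  split=> [|b /Gamma_P bv].
    move/off_Gamma/Gamma_P: mv => mv; move/off_Gamma/Gamma_P: m'v => m'v.
    apply/Gamma_P => i iv; move: (mv i iv) (m'v i iv).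
    by rewrite !ffunE => -> ->; rewrite subrr.
  by apply: mS'; apply/Gamma_P => i /wv /bv.
have [[m [mg mm0]]|H] := pselect (exists m, m \in msupp g /\ in_class q v m0 m).
  rewrite -[X in P X](subrK g); apply: PD => //.
  apply: subspace_supp => // m'; rewrite mcoeff_msupp mcoeffB mcoeff_mdiag.
  have [m'v|m'v] := boolP (off v m'); last by move=> _;
    exact: stratum_out Pv m'v.
  have [/gh m'g|/memN_msupp_eq0 ->] := boolP (m' \in msupp g); last first.
    by rewrite mulr0 subr0 eqxx.
  by rewrite (vclass m m') ?mul1r ?subrr ?eqxx //; exact: gh.
rewrite /component (@eq_mdiag _ _ _ (fun=> 0)) ?mdiag0 // => m mg.
by case: (boolP (in_class q v m0 m)) => // mm0; case: H; exists m.
Qed.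

Section Equivariance.
Variables (actA : torus_action n A) (actA_std : is_standard_action x actA)
  (actR : torus_action n {mpoly k[n]})
  (actR_std : is_standard_action (coordinates k n) actR).

Lemma actAX h m : actA h (X m) = weight h m *: X m.
Proof.
rewrite -(mword_weight m); elim: (mword m) => [|i l IH].
  by rewrite /word_weight big_nil X0 rmorph1 weight0 scale1r.
rewrite word_weight_cons; set m' := word_weight l in IH *.
have c0 := bichar_neq0 c_alt (exponent U_(i)) (exponent m').
have -> : X (U_(i) + m')%MM = (c (exponent U_(i)) (exponent m'))^-1 *: (x i *
  X m').
  by rewrite -XU XM scalerA mulVf // scale1r.
rewrite linearZ /= rmorphM /= actA_std IH -scalerAl -scalerAr !scalerA.
by congr (_ *: _); rewrite weightD weightU -mulrA mulrC.
Qed.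

Lemma Phi_act h a : Phi (actA h a) = actR h (Phi a).
Proof.
rewrite (actRE actR_std) -{1}(PhiK a);
  elim/mpoly_linear_ind: (Phi a) => [m|p r IHp IHr|u p IH].
- by rewrite mextX actAX linearZ /= PhiX mdiagX.
- by rewrite !linearD /= IHp IHr.
- by rewrite !linearZ /= IH.
Qed.

Lemma act_imageP (B : algType k) (act : torus_action n B) h (I : set B) a :
  (act h @` I) a <-> I (act (torus_inv h) a).
Proof. by rewrite act_imageE. Qed.

Lemma component_act w m0 h f :
  component q w m0 (actR h f) = actR h (component q w m0 f).
Proof.
rewrite !(actRE actR_std) /component !mdiag_mdiag.
by apply: eq_mdiag => m _; rewrite mulrC.
Qed.

Lemma S_perpV w h : S_perp q w h -> S_perp q w (torus_inv h).
Proof. by move=> hS a /hS ha; rewrite pairingV ha invr1. Qed.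

Lemma S_perpM w h g : S_perp q w h -> S_perp q w g -> S_perp q w (torus_mul h
  g).
Proof. by move=> hS gS a aS; rewrite pairingM hS // gS // mulr1. Qed.

Lemma act_homogeneous w m0 h f : S_perp q w h -> homogeneous q w m0 f ->
  actR h f = weight h m0 *: f.
Proof.
move=> hS fh; rewrite (actRE actR_std); apply/mpolyP => m.
rewrite mcoeff_mdiag mcoeffZ;
  have [/fh mm0|/memN_msupp_eq0 ->] := boolP (m \in msupp f).
  have /andP[_ /asboolP mS] := mm0; congr (_ * _).
  rewrite -!pairing_exponent -(subrK (exponent m0) (exponent m)) pairingD.
  by rewrite hS ?mul1r.
by rewrite !mulr0.
Qed.

Lemma spec_act_stratum w h (P : spec {mpoly k[n]}) :
  in_stratum w P -> in_stratum w (spec_act actR h P).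
Proof.
move=> Pw i; rewrite -Pw -[ideal_of (spec_act _ _ _)]/(actR h @` P).
rewrite act_imageP (actRE actR_std) mdiagX.
have [idP _ _] := spec_prime P; have sP := ideal_subspace idP.
split; last by case: sP => _ _; exact.
by apply: subspaceZ => //; exact: weight_neq0.
Qed.

Lemma graded_core_act w h (P : set {mpoly k[n]}) f :
  graded_core w (actR h @` P) f <-> graded_core w P (actR (torus_inv h) f).
Proof.
split=> Pf m0; first by rewrite component_act; apply/act_imageP.
by apply/act_imageP; rewrite -component_act.
Qed.

Lemma Phi_act_core w h (P : set {mpoly k[n]}) a :
  (Phi @^-1` graded_core w P) (actA (torus_inv h) a) <->
  (Phi @^-1` graded_core w (actR h @` P)) a.
Proof.
rewrite -[_ (actA _ a)]/(graded_core w P (Phi (actA (torus_inv h) a))) Phi_act.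
by split=> /graded_core_act.
Qed.

Lemma phi_act h (P : spec {mpoly k[n]}) : phi (spec_act actR h P) = spec_act
  actA h (phi P).
Proof.
have Pw := in_stratum_of P; apply: spec_ext => a.
rewrite (phiE (spec_act_stratum h Pw)) -[ideal_of (spec_act actR _ _)]/(actR h
  @` P).
rewrite -[ideal_of (spec_act actA _ _)]/(actA h @` phi P) act_imageP (phiE Pw).
by rewrite -Phi_act_core.
Qed.

Lemma graded_core_perp w h P : is_subspace P -> S_perp q w h ->
  graded_core w (actR h @` P) = graded_core w P.
Proof.
move=> sP hS; have [_ _ PZ] := sP; apply/seteqP.
split=> f Pf m0.
  have /act_imageP := Pf m0;
    rewrite (act_homogeneous (S_perpV hS) (@component_homogeneous _ _ q w m0
      f)).
  by apply: subspaceZ => //; exact: weight_neq0.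
apply/act_imageP;
  rewrite (act_homogeneous (S_perpV hS) (@component_homogeneous _ _ q w m0 f)).
exact/PZ/Pf.
Qed.

Lemma phi_perp w h (P : spec {mpoly k[n]}) : in_stratum w P -> S_perp q w h ->
  phi (spec_act actR h P) = phi P.
Proof.
move=> Pw hS; apply/spec_inj;
  rewrite (phiE (spec_act_stratum h Pw)) (phiE Pw) /=.
have [idP _ _] := spec_prime P.
by rewrite graded_core_perp //; exact: ideal_subspace.
Qed.

(** The characters sigma (epsilon_i, -) with i outside w belong to the
    orthogonal of S_w and already separate the classes, so an ideal stable
    under that group contains the components of its elements. *)
Lemma colonE w (P : spec {mpoly k[n]}) : in_stratum w P ->
  colon actR P (S_perp q w) = graded_core w P.
Proof.
move=> Pw; have [idP _ _] := spec_prime P; have sP := ideal_subspace idP.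
have [P0 PD PZ] := sP.
pose K := colon actR P (S_perp q w).
have KE f : K f <-> forall h, S_perp q w h -> ideal_of P (actR h f).
  split=> Kf h hS; last by apply/act_imageP/Kf/S_perpV.
  by have /act_imageP := Kf _ (S_perpV hS); rewrite torus_invK.
apply/seteqP; split=> f; last first.
  move=> Cf; apply/KE => h hS; apply: (@graded_core_sub _ _ q qa w P) => //.
    by move=> m; exact: stratum_out.
  move=> m0; rewrite component_act.
  rewrite (act_homogeneous hS (@component_homogeneous _ _ q w m0 f)).
  exact/PZ/Cf.
move=> Kf m0; have [m0w|m0w] := boolP (off w m0); last first.
  rewrite /component (@eq_mdiag _ _ _ (fun=> 0)) ?mdiag0 // => m _.
  by case: (boolP (in_class q w m0 m)) => // /(in_class_off qa);
    rewrite (negPf m0w).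
suff /KE /(_ (torus_one k n)) : K (component q w m0 f).
  by rewrite torus_act1; apply=> a _; exact: pairing1.
have sK : is_subspace K.
  split=> [|g h /KE Kg /KE Kh|a g /KE Kg]; apply/KE => u uS.
  - by rewrite linear0.
  - by rewrite linearD; apply: PD; [exact: Kg|exact: Kh].
  - by rewrite linearZ; apply/PZ/Kg.
apply: (@diagonal_component _ _ K (in_class q w m0) f sK) => // m1 m1E.
have [m1w|m1w] := boolP (off w m1); last first.
  left; apply/KE => h _; rewrite (actRE actR_std) mdiagX; apply: PZ.
  exact: stratum_out m1w.
have [i iw si] := class_separated qa m0w m1w m1E; right.
have q0 : [forall j, [ffun j => q i j] j != 0].
  by apply/forallP => j; rewrite ffunE; case: qa.
pose g : torus k n := Torus q0.
have gE a : pairing g a = sigma q (epsilon i) a.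
  rewrite /sigma (bigD1 i) //= [X in _ * X]big1 => [|i' /negPf i'i]; last first.
    by rewrite big1 // => j _; rewrite epsilonE i'i mul0r.
  by rewrite mulr1; apply: eq_bigr => j _; rewrite epsilonE eqxx mul1r ffunE.
have gS : S_perp q w g.
  move=> a [_ aS]; rewrite gE (bicharC (sigma_alternating qa) a) aS ?invr1 //.
  by move=> G _ _ Ge; exact: Ge.
exists (weight g), (weight g m0); split.
- move=> p /KE Kp; apply/KE => h hS; rewrite -(actRE actR_std) -torus_actM.
  by apply: Kp; exact: S_perpM.
- by move=> m mm0; rewrite -!pairing_exponent !gE; exact: sigma_class mm0 iw.
- by rewrite -!pairing_exponent !gE.
Qed.

(** Closed sets are transported stratum by stratum.  The intersection of the
    primes of one stratum above a given ideal is graded, hence an ideal for both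
    multiplications, and lies in P if and only if it lies in the image of P.
    Conversely, if the preimage of W is cut out by K, it is stable under the
    orthogonal of S_w on the stratum of w, so that K lies in the intersection of
    the images of its points of that stratum. *)
Lemma closed_transfer (M : set (spec {mpoly k[n]})) (W : set (spec A)) :
  (forall h P, M P -> M (spec_act actR h P)) ->
  (exists2 I, is_ideal I & forall P, M P -> W (phi P) <-> I `<=` phi P) <->
  (exists2 K, is_ideal K & forall P, M P -> W (phi P) <-> K `<=` P).
Proof.
move=> M_act.
have inter_graded w (S : set (set {mpoly k[n]})) :
    (forall J, S J -> is_graded q w J) -> is_graded q w (\bigcap_(J in S) J).
  move=> Sg; split.
  - split=> [J /Sg[[]//]|f g Sf Sg' J SJ|a f Sf J SJ].
      have [[_ JD _] _ _] := Sg _ SJ; exact: JD (Sf _ SJ) (Sg' _ SJ).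
    by have [[_ _ JZ] _ _] := Sg _ SJ; exact: JZ _ _ (Sf _ SJ).
  - by move=> m mw J SJ; have [_ Jout _] := Sg _ SJ; exact: Jout.
  - by move=> f m0 Sf J SJ; have [_ _ Jc] := Sg _ SJ; exact: Jc _ _ (Sf _ SJ).
have inter_ideal (B : nzRingType) (S : set (set B)) :
    (forall T, S T -> is_ideal T) -> is_ideal (\bigcap_(T in S) T).
  move=> Sid; split=> [J /Sid[]//|a b Sa Sb J SJ|a b Sb].
    by have [_ JD _] := Sid _ SJ; exact: JD (Sa _ SJ) (Sb _ SJ).
  by split=> J SJ; [apply: ideal_mulr|apply: ideal_mull];
    [exact: Sid|exact: Sb|exact: Sid|exact: Sb].
split=> -[I idI IW].
- pose S w := [set J | exists Q : spec A,
    [/\ spec_stratum x w Q, I `<=` Q & J = pullback Q]].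
  have Sg w J : S w J -> is_graded q w J.
    move=> [Q [/pullback_stratum Qw _ ->]].
    exact: (tprime_graded qa c_alt c2 (pullback_tprime Q) Qw).
  have Sid w J : S w J -> is_ideal J.
    move=> SJ; apply: (graded_ideal qa c_alt c1 (Sg _ _ SJ)).
    by case: SJ => [Q [_ _ ->]]; case: (pullback_tprime Q).
  have [K idK KE] := finite_union_closed (fun w => inter_ideal _ _ (Sid w)).
  exists K => // P MP; rewrite IW // KE; split=> [IP|[w JP] a Ia].
    exists (stratum_of (coordinates k n) P) => f /(_ (pullback (phi P))).
    have Pw := in_stratum_of P.
    have H : S (stratum_of (coordinates k n) P) (pullback (phi P)).
      by exists (phi P); split=> //; apply/phi_stratum.
    by move=> /(_ H) /phi_sub; rewrite PhiK'.
  have Pv := in_stratum_of P; rewrite (phiE Pv).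
  apply: (graded_sub_core (inter_graded _ _ (Sg w)) (spec_prime P) Pv JP).
  by move=> _ [Q [_ IQ ->]]; apply/pullback_Phi/IQ.
- pose S w := [set J | exists P : spec {mpoly k[n]},
    [/\ in_stratum w P, M P, W (phi P) & J = graded_core w P]].
  have Sg w J : S w J -> is_graded q w J.
    move=> [P [Pw _ _ ->]]; apply: graded_core_graded => //;
      apply: ideal_subspace.
    by case: (spec_prime P).
  have Sid w J : S w J -> is_ideal (Phi @^-1` J).
    by move=> [P [Pw _ _ ->]]; rewrite -(phiE Pw); case: (spec_prime (phi P)).
  have Sid' w T : ((fun J => Phi @^-1` J) @` S w) T -> is_ideal T.
    by move=> [J' SJ' <-]; exact: Sid SJ'.
  have [K idK KE] := finite_union_closed (fun w => inter_ideal _ _ (Sid' w)).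
  exists K => // P MP; rewrite KE; split=> [WP|[w JP]].
    exists (stratum_of (coordinates k n) P) => a; apply.
    have Pw := in_stratum_of P; rewrite (phiE Pw).
    by exists (graded_core (stratum_of (coordinates k n) P) P) => //; exists P.
  apply/IW => // f If; rewrite -(PhiK' f);
    apply/phi_sub/JP => _ [_ [P' [Pw MP' WP' ->]] <-].
  rewrite /= PhiK' -colonE // => h hS.
  suff : I `<=` spec_act actR h P' by exact.
  by apply/IW; [exact: M_act|rewrite (phi_perp Pw hS)].
Qed.

End Equivariance.
End Maps.

(** * Maximal ideals and primitive ideals *)

Definition is_left_ideal (B : nzRingType) (L : set B) :=
  [/\ L 0, forall a b, L a -> L b -> L (a + b) & forall a b, L b -> L (a * b)].

Section MaximalLeftIdealQuotient.
Variables (B : nzRingType) (L : set B).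
Hypothesis idL : is_left_ideal L.

Definition left_ideal_pred : {pred B} := fun b => `[< L b >].

Lemma left_ideal_zmod : zmod_closed left_ideal_pred.
Proof.
have [L0 LD LM] := idL; split; first by apply/asboolP.
move=> a b /asboolP La /asboolP Lb; apply/asboolP; apply: LD => //.
by rewrite -mulN1r; exact: LM.
Qed.

HB.instance Definition _ := GRing.isZmodClosed.Build B left_ideal_pred
  left_ideal_zmod.

Definition left_quotient : Type := Quotient.quot left_ideal_pred.
HB.instance Definition _ := EqQuotient.on left_quotient.
HB.instance Definition _ := GRing.Zmodule.on left_quotient.

Local Notation pi := (\pi_left_quotient%qT).

Lemma left_quotient_eq a b : pi a = pi b <-> L (a - b).
Proof.
split=> [/eqP|ab]; first by rewrite -Quotient.idealrBE => /asboolP.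
by apply/eqP; rewrite -Quotient.idealrBE; apply/asboolP.
Qed.

Definition left_quotient_scale (a : B) (u : left_quotient) : left_quotient :=
  pi (a * repr u).

Lemma left_quotient_scaleE a b : left_quotient_scale a (pi b) = pi (a * b).
Proof.
apply/left_quotient_eq; rewrite -mulrBr; have [_ _ LM] := idL; apply: LM.
by apply/left_quotient_eq; exact: reprK.
Qed.

Lemma left_quotientP (u : left_quotient) : exists b, u = pi b.
Proof. by exists (repr u); rewrite reprK. Qed.

Lemma left_quotientD a b : pi (a + b) = pi a + pi b.
Proof. exact: Quotient.pi_add. Qed.

Lemma left_quotient0 a : pi a = 0 <-> L a.
Proof.
have <- : pi 0 = 0 by apply: (addrI (pi 0)); rewrite -left_quotientD !addr0.
by rewrite left_quotient_eq subr0.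
Qed.

Fact left_quotient_scaleA a b u :
  left_quotient_scale a (left_quotient_scale b u) = left_quotient_scale (a *
    b) u.
Proof. by have [v ->] := left_quotientP u;
  rewrite !left_quotient_scaleE mulrA. Qed.

Fact left_quotient_scale1 : left_id 1 left_quotient_scale.
Proof. by move=> u; have [v ->] := left_quotientP u;
  rewrite left_quotient_scaleE mul1r. Qed.

Fact left_quotient_scaleDr : right_distributive left_quotient_scale +%R.
Proof.
move=> a u v; have [b ->] := left_quotientP u; have [d ->] := left_quotientP v.
by rewrite -left_quotientD !left_quotient_scaleE mulrDr left_quotientD.
Qed.

Fact left_quotient_scaleDl u :
  {morph left_quotient_scale^~ u : a b / a + b}.
Proof.
move=> a b; have [d ->] := left_quotientP u.
by rewrite !left_quotient_scaleE mulrDl left_quotientD.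
Qed.

HB.instance Definition _ := GRing.Zmodule_isLmodule.Build B left_quotient
  left_quotient_scaleA left_quotient_scale1 left_quotient_scaleDr
  left_quotient_scaleDl.

Lemma left_quotient_simple :
  ~ L 1 -> (forall L', is_left_ideal L' -> L `<=` L' -> L' = L \/ L' 1) ->
  is_simple_module (left_quotient : lmodType B).
Proof.
move=> L1 Lmax; have [L0 _ _] := idL; split.
  by exists (pi 1); apply/eqP => /left_quotient0.
move=> N [N0 ND NZ].
have idN : is_left_ideal [set b | N (pi b)].
  split=> /= [|a b Na Nb|a b Nb].
  - by rewrite (_ : pi 0 = 0) //; apply/left_quotient0.
  - by rewrite left_quotientD; exact: ND.
  - by rewrite -left_quotient_scaleE; exact: NZ.
have [b Lb|NL|N1] := Lmax _ idN.
- by rewrite /= (_ : pi b = 0) //; apply/left_quotient0.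
- left; apply/seteqP; split=> [u Nu|_ ->//]; have [b ub] := left_quotientP u.
  have Lb : L b by rewrite -NL /= -ub.
  by rewrite ub; apply/left_quotient0.
- right; apply/seteqP; split=> // u _; have [b ->] := left_quotientP u.
  by rewrite -[b]mulr1 -left_quotient_scaleE; exact: NZ.
Qed.

End MaximalLeftIdealQuotient.

Lemma exists_simple_module (B : nzRingType) (L : set B) :
  is_left_ideal L -> ~ L 1 ->
  exists M : lmodType B, is_simple_module M /\
    exists2 v : M, v != 0 & forall b, L b -> b *: v = 0.
Proof.
move=> idL L1.
have [|F FP [X0 FX0] Ftot|N [LN [idN N1] Nmax]] := @Zorn_above _
    (fun N => is_left_ideal N /\ ~ N 1) L.
- by [].
- split; last by move=> [X FX X1]; case: (FP _ FX).
  split.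
  + by exists X0 => //; case: (FP _ FX0) => [[]].
  + move=> a b [X FX Xa] [Y FY Yb].
    have [XY|YX] := Ftot X Y FX FY.
      by exists Y => //; case: (FP _ FY) => [[_ YD _] _]; apply: YD => //;
        exact: XY.
    by exists X => //; case: (FP _ FX) => [[_ XD _] _]; apply: XD => //;
      exact: YX.
  + by move=> a b [X FX Xb]; exists X => //; case: (FP _ FX) => [[_ _ XM] _];
    exact: XM.
exists (left_quotient idN : lmodType B); split.
  apply: left_quotient_simple => // N' idN' NN'.
  have [N'1|nN'1] := pselect (N' 1); first by right.
  by left; exact: Nmax.
exists (\pi_(left_quotient idN)%qT 1).
  by apply/eqP => /(left_quotient0 idN).
move=> b /LN Nb; apply: etrans (left_quotient_scaleE idN b 1) _.
by apply/(left_quotient0 idN); rewrite mulr1.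
Qed.

Section Points.
Variables (k : closedFieldType) (n : nat).
Implicit Types (a : 'I_n -> k) (m : 'X_{1..n}).

Definition point_ideal a : set {mpoly k[n]} := [set f | f.@[a] = 0].

Lemma point_ideal_ideal a : is_ideal (point_ideal a).
Proof.
rewrite /point_ideal; split=> /= [|f g fa ga|f g ga].
- by rewrite meval0.
- by rewrite mevalD fa ga addr0.
- by rewrite !mevalM ga mulr0 mul0r.
Qed.

Lemma point_ideal_maximal a : is_maximal_ideal (point_ideal a).
Proof.
have idp := point_ideal_ideal a; split=> //.
  by apply/(ideal_proper idp); rewrite /point_ideal /= meval1;
    apply/eqP/oner_neq0.
move=> I idI aI; have [Ia|/existsNP[f /not_implyP[If /eqP fa]]] :=
  pselect (I `<=` point_ideal a); first by left; apply/seteqP.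
right; have [_ ID _] := idI; apply/seteqP; split=> // g _.
have If1 : I ((f.@[a])%:MP).
  rewrite -(subKr f (f.@[a])%:MP); apply: ideal_subr => //; apply: aI.
  by rewrite /point_ideal /= mevalB mevalC subrr.
rewrite -[g]mul1r -mpolyC1 -(mulVf fa) mpolyCM.
by apply: ideal_mull => //; exact: ideal_mulr.
Qed.

Lemma maximal_point (P : set {mpoly k[n]}) :
  is_maximal_ideal P -> exists a, P = point_ideal a.
Proof.
move=> Pmax; have Pp := maximal_ideal_prime Pmax; have [idP PT Pm] := Pmax.
have [a [Pa _]] := mpoly_nullstellensatz Pp (proj1 (ideal_proper idP) PT).
exists a; have [->//|aT] := Pm _ (point_ideal_ideal a) Pa.
have : [set: {mpoly k[n]}] 1 by [].
by rewrite -aT /point_ideal /= meval1 => /eqP; rewrite oner_eq0.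
Qed.

Lemma point_stratum w a :
  in_stratum w (point_ideal a) <-> forall i, a i = 0 <-> i \in w.
Proof. by split=> aw i; rewrite -aw /point_ideal /= mevalXU. Qed.

Lemma meval_mon_neq0 w a m :
  in_stratum w (point_ideal a) -> off w m -> ('X_[m]).@[a] != 0.
Proof.
move=> /point_stratum aw /offP mw; rewrite mevalX; apply/prodf_neq0 => i _.
have [/mw ->|iw] := boolP (i \in w); first by rewrite expr0 oner_neq0.
by rewrite expf_neq0 //; apply: contraNneq iw => /aw.
Qed.

Section Primitive.
Variables (q : 'M[k]_n) (qa : mult_antisymmetric q).
Variables (c : {ffun 'I_n -> int} -> {ffun 'I_n -> int} -> k).
Hypotheses (c_alt : is_alternating_bicharacter c)
  (c2 : forall u v, c u v ^+ 2 = sigma q u v)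
  (c1 : forall u v, sigma q u v = 1 -> c u v = 1).

(** A homogeneous element not vanishing at a differs by an element of the graded
    core from a multiple of any of its monomials. *)
Lemma graded_core_point_maximal w a J : in_stratum w (point_ideal a) ->
  is_graded q w J -> graded_core q w (point_ideal a) `<=` J ->
  (forall m, off w m -> ~ J 'X_[m]) -> J `<=` graded_core q w (point_ideal a).
Proof.
move=> aw [sJ Jout Jc] CJ JX f Jf m0; apply: contrapT;
  set g := component _ _ _ _.
rewrite {1}/point_ideal /= => /eqP ga.
have gh : homogeneous q w m0 g by exact: component_homogeneous.
have g0 : g != 0 by apply: contraNneq ga => ->; rewrite meval0.
have mg := mlead_supp g0; set m := mlead g in mg.
have mm0 : in_class q w m0 m by exact: gh.
have mw : off w m by case/andP: mm0.
have ma := meval_mon_neq0 aw mw.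
pose b := g.@[a] / ('X_[m]).@[a].
have b0 : b != 0 by rewrite mulf_neq0 ?invr_neq0.
apply: (JX m) => //; apply: (@subspaceZ _ _ _ b) => //.
rewrite -(subKr g (b *: _)); apply: subspaceB => //; first exact: Jc.
apply: CJ => m1; have hh : homogeneous q w m0 (g - b *: 'X_[m]).
  move=> m' /msuppB_le; rewrite mem_cat => /orP[/gh//|/msuppZ_le].
  by rewrite msuppX inE => /eqP ->.
have [->|->] := component_or qa m1 hh; rewrite /point_ideal /= ?meval0 //.
by rewrite mevalB mevalZ divfK // subrr.
Qed.

Variables (A : algType k) (x : 'I_n -> A) (X : 'X_{1..n} -> A)
  (Phi : {linear A -> {mpoly k[n]}}).
Hypothesis AX : is_twisted_identification c x X Phi.
Local Notation tmul := (tmul c).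

(** Let y be the product of the variables invertible on the stratum, m its
    exponent and l its value at the point.  The left ideal generated by y - l and
    by the image of the point is proper: it is annihilated by the functional that
    evaluates at the point the terms with exponents in Z m + S_w, on which the
    twist is trivial.  On a simple quotient y acts invertibly, so that its annihilator
    belongs to the same stratum, where the image of a point is maximal. *)
Lemma point_primitive w a : in_stratum w (point_ideal a) ->
  is_left_primitive_ideal (Phi @^-1` graded_core q w (point_ideal a)).
Proof.
move=> aw; set C := graded_core _ _ _.
have ida := point_ideal_ideal a; have sa := ideal_subspace ida.
have Cg : is_graded q w C := graded_core_graded qa w sa.
have idC : is_ideal (Phi @^-1` C).
  apply/(tidealP c_alt AX); apply: (graded_tideal qa c_alt c1 Cg).
  exact: (graded_core_ideal qa w ida).
pose m : 'X_{1..n} := [multinom nat_of_bool (i \notin w) | i < n].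
have mE i : m i = (i \notin w) by rewrite mnmE.
have mw : off w m by apply/offP => i iw; rewrite mE iw.
set l := ('X_[m]).@[a]; have l0 : l != 0 := meval_mon_neq0 aw mw.
pose D m' := off w m' && `[< exists j : int,
  S_ q w (exponent m' - exponent m *~ j) >].
pose ev : {linear {mpoly k[n]} -> k^o} := @mext k n k^o (fun m' => if D m'
  then ('X_[m']).@[a] else 0).
have evX m' : ev 'X_[m'] = if D m' then ('X_[m']).@[a] else 0 by exact: mextX.
have D_class m1 m2 : in_class q w m1 m2 -> D m2 = D m1.
  suff H m3 m4 : in_class q w m3 m4 -> D m4 -> D m3.
    by move=> h; apply/idP/idP; apply: H => //; exact: (in_class_sym qa h).
  move=> h /andP[_ /asboolP[j jS]]; rewrite /D (in_class_off qa h);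
    apply/asboolP.
  exists j; rewrite -(subrK (exponent m4) (exponent m3)) -addrA;
    apply: (S_D qa) => //.
  by have /andP[_ /asboolP] := in_class_sym qa h.
have evC f : C f -> ev f = 0.
  move=> Cf; apply: (@components_suffice _ _ q qa w [set f | ev f = 0]).
  - split=> [|g h g0 h0|b g g0]; rewrite /mkset ?linear0 //.
      by rewrite linearD g0 h0 addr0.
    by rewrite linearZ /= g0 scaler0.
  - by move=> m' m'w /=; rewrite evX /D (negPf m'w).
  move=> m0 /=; set g := component _ _ _ _.
  have ga : g.@[a] = 0 := Cf m0.
  have gh : homogeneous q w m0 g by exact: component_homogeneous.
  pose b : k := (D m0)%:R; suff : ev g = b * g.@[a] by rewrite ga mulr0.
  apply: (@subspace_supp _ _ [set h | ev h = b * h.@[a]]) => [|m' /gh m'g].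
    split=> [|h h' e e'|u h e]; rewrite /mkset ?linear0 ?meval0 ?mulr0 //.
      by rewrite linearD e e' mevalD mulrDr.
    by rewrite linearZ /= e mevalZ mulrCA.
  rewrite /mkset evX (D_class _ _ m'g) /b.
  by case: (D m0); rewrite ?mul1r ?mul0r.
have evm f : ev (tmul f ('X_[m] - l *: 'X_[0])) = 0.
  elim/mpoly_linear_ind: f => [m'|f g IHf IHg|b f IH]; last 2 first.
  - by rewrite tmulDl linearD /= IHf IHg addr0.
  - by rewrite -tmulZl linearZ /= IH scaler0.
  rewrite (linearB (tmul 'X_[m'])) /= -tmulZr (tmul1r c_alt) tmulXX linearB /=.
  rewrite !linearZ /= !evX.
  have Dm' : D (m' + m)%MM = D m'.
    rewrite /D offD mw andbT; case: (off w m') => //=; apply: asbool_equiv_eq.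
    split=> -[j jS]; [exists (j - 1)|exists (j + 1)].
      by rewrite mulrzBr mulr1z opprB addrA -exponentD.
    rewrite mulrzDr mulr1z exponentD opprD addrACA.
    by rewrite subrr addr0.
  rewrite Dm'; case: ifP => [/andP[m'w /asboolP[j jS]]|_]; last first.
    by rewrite oppr0 !scaler0 addr0.
  suff -> : c (exponent m') (exponent m) = 1.
    by rewrite scale1r scalerN mpolyXD mevalM mulrC; exact: subrr.
  apply: c1; have s_alt := sigma_alternating qa.
  rewrite -(subrK (exponent m *~ j) (exponent m')) (bicharDl s_alt).
  rewrite jS.2 ?mul1r; last by apply/off_Gamma.
  elim/int_rect: j {jS} => [|j IH|j IH].
  - by rewrite mulr0z (bichar0l s_alt).
  - by rewrite intS mulrzDr mulr1z (bicharDl s_alt) (bicharxx s_alt) mul1r.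
  - rewrite intS opprD mulrzDr mulrNz mulr1z addrC (bicharBl s_alt) IH.
    by rewrite (bicharxx s_alt) divr1.
pose L := [set b | exists u g, C (Phi g) /\ b = u * (X m - l%:A) + g].
have idL : is_left_ideal L.
  have [C0 CD CM] := idC; split.
  - by exists 0, 0; rewrite mul0r addr0.
  - move=> _ _ [u [g [Cg' ->]]] [u' [g' [Cg'' ->]]].
    by exists (u + u'), (g + g'); rewrite mulrDl addrACA; split=> //; exact: CD.
  - move=> b _ [u [g [Cg' ->]]]; exists (b * u), (b * g).
    by rewrite mulrDr mulrA; split=> //; case: (CM b g Cg').
have PhiX m' : Phi (X m') = 'X_[m'] by case: AX.
have L1 : ~ L 1.
  move=> [u [g [Cg' E]]]; have := congr1 (fun b => ev (Phi b)) E.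
  rewrite (Phi1 c_alt AX) evX linearD /= (PhiM AX) linearD /= (evC _ Cg') addr0.
  rewrite linearB /= PhiX linearZ /= (Phi1 c_alt AX) evm mpolyX0 meval1.
  suff -> : D 0%MM by move/eqP; rewrite oner_eq0.
  rewrite /D off0; apply/asboolP; exists 0.
  by rewrite mulr0z subr0 exponent0; exact: (S_0 qa).
have [M [Msimple [v v0 Lv]]] := exists_simple_module idL L1.
pose P := [set b | forall u : M, b *: u = 0].
have Pprim : is_left_primitive_ideal P by exists M.
have Pp : is_prime_ideal P := left_primitive_ideal_prime Pprim.
suff <- : P = Phi @^-1` C by [].
have CP : Phi @^-1` C `<=` P.
  move=> g Cg' u; have [_ Mmax] := Msimple.
  pose N := [set u : M | exists b, u = b *: v].
  have [|N0|NT] := Mmax N.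
  - split; first by exists 0; rewrite scale0r.
      by move=> _ _ [b ->] [b' ->]; exists (b + b'); rewrite scalerDl.
    by move=> b _ [b' ->]; exists (b * b'); rewrite scalerA.
  - have : N v by exists 1; rewrite scale1r.
    by rewrite N0 => /eqP; rewrite (negPf v0).
  - have [b ->] : N u by rewrite NT.
    rewrite scalerA; apply: Lv; exists 0, (g * b); rewrite mul0r add0r;
      split=> //.
    by case: idC => _ _ /(_ b g Cg')[].
pose J := pullback X P.
have JE : Phi @^-1` J = P by exact: (pullbackK AX).
have Jp : is_tprime c J by apply/(tprimeP c_alt AX); rewrite JE.
have CJ : C `<=` J.
  by move=> f Cf; apply: CP; rewrite /= (PhiK' AX).
have nXm : ~ J 'X_[m].
  rewrite /J /pullback /= mextX => /(_ v) Xv.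
  have : (X m - l%:A) *: v = 0.
    apply: Lv; exists 1, 0; rewrite mul1r addr0 linear0; split=> //.
    by case: Cg => [[]].
  rewrite scalerBl Xv sub0r => /eqP; rewrite oppr_eq0 => /eqP lv.
  case/eqP: v0; rewrite -[v]scale1r -[1](scale1r (1 : A)) -(mulVf l0) -scalerA.
  by rewrite -[l%:A]mul1r scalerAl -scalerA lv scaler0.
have Jw : in_stratum w J.
  move=> i; split=> [Ji|iw]; last first.
    by apply: CJ; have [_ Cout _] := Cg; apply: Cout; rewrite offU negbK.
  apply: contrapT => /negP iw; apply: nXm.
  have mi : m i != 0%N by rewrite mE iw.
  have [[[_ _ JZ] _ JM] _ _] := Jp.
  apply: (@subspaceZ _ _ J (c (exponent U_(i)) (exponent (m - U_(i))%MM))).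
  - exact: (bichar_neq0 c_alt).
  - by case: Jp => [[]].
  - by rewrite {2}(mon_split mi) -tmulXX; exact: JM.
rewrite -JE; suff -> : J = C by [].
apply/seteqP; split=> //; apply: graded_core_point_maximal => //.
  exact: (tprime_graded qa c_alt c2 Jp Jw).
by move=> m'; exact: (tstratum_off c_alt Jp Jw).
Qed.

End Primitive.
End Points.

(** * Central fractions act on simple modules by scalars *)

Lemma nondecreasing_subsequence (f : nat -> nat) : exists g : nat -> nat,
  (forall i j, (i < j)%N -> (g i < g j)%N) /\
  (forall i j, (i <= j)%N -> (f (g i) <= f (g j))%N).
Proof.
have tail N : exists i, (N <= i)%N /\ forall j, (N <= j)%N -> (f i <= f j)%N.
  have [|i [Ni imin]] := @exists_minimal nat (fun i => N <= i)%N f;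
    first by exists N.
  by exists i; split=> // j Nj; rewrite leqNgt; apply/negP => /imin.
have [h hE] := choice tail; pose g i := iter i (fun j => h j.+1) (h 0%N).
have gS i : g i.+1 = h (g i).+1 by [].
have g_lt i : (g i < g i.+1)%N by rewrite gS; case: (hE (g i).+1).
have g_min i j : (g i <= j)%N -> (f (g i) <= f j)%N.
  case: i => [|i] ij; first by case: (hE 0%N) => _; exact.
  rewrite gS in ij *; have [h1 h2] := hE (g i).+1.
  by apply: h2; apply: leq_trans ij.
have g_mono : {homo g : i j / (i < j)%N}.
  by apply: homo_ltn; [exact: ltn_trans|exact: g_lt].
exists g; split=> // i j; rewrite leq_eqVlt => /predU1P[->//|/g_mono ij].
by apply/g_min/ltnW.
Qed.

Section Dickson.
Variable n : nat.
Implicit Types (m : 'X_{1..n}).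

(** Passing to subsequences makes the coordinates nondecreasing one after the
    other. *)
Lemma monomial_sequence (u : nat -> 'X_{1..n}) :
  exists i j, (i < j)%N /\ (u i <= u j)%MM.
Proof.
suff [g [g_mono gu]] : exists g : nat -> nat,
    (forall i j, (i < j)%N -> (g i < g j)%N) /\
    forall l, l \in enum 'I_n -> forall i j, (i <= j)%N -> (u (g i) l <= u (g
      j) l)%N.
  exists (g 0%N), (g 1%N); split; first exact: g_mono.
  by apply/mnm_lepP => l; apply: gu; rewrite ?mem_enum.
elim: (enum 'I_n) => [|l s [g [g_mono gu]]]; first by exists id.
have [h [h_mono hu]] := nondecreasing_subsequence (fun i => u (g i) l).
exists (g \o h); split=> [i j ij|l']; first by apply/g_mono/h_mono.
rewrite inE => /predU1P[-> //|ls] i j; rewrite leq_eqVlt => /predU1P[->//|ij].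
by apply: gu => //; apply/ltnW/h_mono.
Qed.

(** Otherwise one could choose successively elements of S none of which is above
    an earlier one, contradicting [monomial_sequence]. *)
Lemma dickson (S : set 'X_{1..n}) : exists s : seq 'X_{1..n},
  (forall m, m \in s -> S m) /\
  forall m, S m -> exists2 m', m' \in s & (m' <= m)%MM.
Proof.
apply: contrapT => H.
have bad (s : seq 'X_{1..n}) : exists m, (forall m, m \in s -> S m) ->
    S m /\ forall m', m' \in s -> ~~ (m' <= m)%MM.
  have [sS|nsS] := pselect (forall m, m \in s -> S m); last by exists 0%MM.
  apply: contrapT => nm; apply: H; exists s; split=> // m Sm.
  apply: contrapT => nm'; apply: nm; exists m => _; split=> // m' m's.
  by apply/negP => m'm; apply: nm'; exists m'.
have [next nextE] := choice bad.
pose L i := iter i (fun s => rcons s (next s)) [::].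
have LS i m : m \in L i -> S m.
  elim: i m => // i IH m; rewrite /L iterS mem_rcons inE -/(L i).
  by case/predU1P=> [->|/IH//]; case: (nextE (L i) IH).
have LL i j : (i < j)%N -> next (L i) \in L j.
  elim: j => // j IH; rewrite ltnS leq_eqVlt => /predU1P[->|/IH iL];
    by rewrite /L iterS mem_rcons inE -/(L j) ?eqxx // iL orbT.
have [i [j [ij uij]]] := monomial_sequence (fun i => next (L i)).
by have [_ /(_ _ (LL _ _ ij))] := nextE (L j) (LS j); rewrite uij.
Qed.

End Dickson.

Section ScalarRestriction.
Variables (k : fieldType) (A : algType k) (M : lmodType A).

Definition scalar_restriction : Type := M.
HB.instance Definition _ := GRing.Zmodule.on scalar_restriction.

Definition restricted_scale (a : k) (v : scalar_restriction) :
  scalar_restriction :=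
  (a%:A : A) *: (v : M).

Fact restricted_scaleA a b v :
  restricted_scale a (restricted_scale b v) = restricted_scale (a * b) v.
Proof. by rewrite /restricted_scale scalerA -scalerAl mul1r scalerA. Qed.

Fact restricted_scale1 : left_id 1 restricted_scale.
Proof. by move=> v; rewrite /restricted_scale !scale1r. Qed.

Fact restricted_scaleDr : right_distributive restricted_scale +%R.
Proof. by move=> a u v; rewrite /restricted_scale scalerDr. Qed.

Fact restricted_scaleDl v : {morph restricted_scale^~ v : a b / a + b}.
Proof. by move=> a b; rewrite /restricted_scale !scalerDl. Qed.

HB.instance Definition _ := GRing.Zmodule_isLmodule.Build k scalar_restriction
  restricted_scaleA restricted_scale1 restricted_scaleDr restricted_scaleDl.

End ScalarRestriction.

Section PolynomialModule.
Variables (k : fieldType) (M : lmodType k) (z : {linear M -> M}).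
Implicit Types p r : {poly k}.

(** M with the indeterminate acting through z; the operator is part of the type
    because it determines the module structure. *)
Definition poly_module (_ : {linear M -> M}) : Type := M.
HB.instance Definition _ := GRing.Zmodule.on (poly_module z).

Definition poly_scale (p : {poly k}) (v : poly_module z) : poly_module z :=
  \sum_(i < size p) p`_i *: (iter i z v : M).

Lemma poly_scale_wide N p v : (size p <= N)%N ->
  poly_scale p v = \sum_(i < N) p`_i *: (iter i z v : M).
Proof.
move=> pN; rewrite /poly_scale (big_ord_widen _ (fun i => p`_i *: (iter i z v
  : M)) pN).
rewrite big_mkcond; apply: eq_bigr => i _; case: ltnP => // pi.
by rewrite nth_default // scale0r.
Qed.

Fact poly_scaleDl v : {morph poly_scale^~ v : p r / p + r}.
Proof.
move=> p r; rewrite !(@poly_scale_wide (maxn (size p) (size r))) ?leq_maxl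
  ?leq_maxr //.
  by rewrite -big_split; apply: eq_bigr => i _; rewrite coefD scalerDl.
exact: size_polyD.
Qed.

Fact poly_scaleDr : right_distributive poly_scale +%R.
Proof.
move=> p u v; rewrite /poly_scale -big_split; apply: eq_bigr => i _ /=.
rewrite -scalerDr; congr (_ *: _).
by elim: (i : nat) => //= j ->; rewrite linearD.
Qed.

Lemma poly_scaleC a v : poly_scale a%:P v = a *: (v : M).
Proof.
rewrite (@poly_scale_wide 1) ?size_polyC ?leq_b1 // big_ord_recl big_ord0 addr0.
by rewrite coefC.
Qed.

Lemma poly_scaleX p v : poly_scale ('X * p) v = z (poly_scale p v : M).
Proof.
rewrite (@poly_scale_wide (size p).+1); last first.
  by apply: leq_trans (size_polyMleq _ _) _; rewrite size_polyX.
rewrite big_ord_recl coefXM scale0r add0r /poly_scale linear_sum.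
by apply: eq_bigr => i _; rewrite coefXM /= linearZ.
Qed.

Lemma poly_scaleZ a p v : poly_scale (a%:P * p) v = a *: (poly_scale p v : M).
Proof.
rewrite (@poly_scale_wide (size p)); last first.
  by rewrite mul_polyC; exact: size_scale_leq.
rewrite /poly_scale scaler_sumr; apply: eq_bigr => i _.
by rewrite coefCM scalerA.
Qed.

Fact poly_scaleA p r v : poly_scale p (poly_scale r v) = poly_scale (p * r) v.
Proof.
elim/poly_ind: p v => [|p a IH] v.
  by rewrite mul0r -polyC0 !poly_scaleC !scale0r.
rewrite mulrDl !poly_scaleDl poly_scaleC poly_scaleZ; congr (_ + _).
rewrite mulrC poly_scaleX IH -poly_scaleX; congr (poly_scale _ _).
by rewrite mulrCA mulrC mulrA.
Qed.

Fact poly_scale1 : left_id 1 poly_scale.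
Proof. by move=> v; rewrite poly_scaleC scale1r. Qed.

HB.instance Definition _ := GRing.Zmodule_isLmodule.Build {poly k}
  (poly_module z)
  poly_scaleA poly_scale1 poly_scaleDr poly_scaleDl.

Lemma poly_module_C a (v : poly_module z) : a%:P *: v = a *: (v : M).
Proof. exact: poly_scaleC. Qed.

Lemma poly_module_X (v : poly_module z) : ('X : {poly k}) *: v = z v.
Proof.
by rewrite -['X]mulr1 -scalerA scale1r -[LHS]/(poly_scale _ _) -['X]mulr1
  poly_scaleX
  poly_scale1.
Qed.

End PolynomialModule.

(** Splitting off a root of p reduces to the operators z - t. *)
Lemma poly_module_torsion_free (k : closedFieldType) (M : lmodType k)
    (z : {linear M -> M}) (p : {poly k}) (v : poly_module z) :
  (forall t (u : M), z u = t *: u -> u = 0) -> p != 0 -> p *: v = 0 -> v = 0.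
Proof.
move=> zt; have [N] := ubnP (size p); elim: N p v => // N IH p v pN p0 pv.
have [p1|p1] := eqVneq (size p) 1%N.
  have [a a0 pE] := size_poly1P _ (introT eqP p1).
  move: pv; rewrite pE poly_module_C => /(congr1 (fun u : M => a^-1 *: u)).
  by rewrite scalerA mulVf // scale1r scaler0.
have [t /factor_theorem[r pE]] := closed_rootP p p1.
have r0 : r != 0 by apply: contraNneq p0 => r0; rewrite pE r0 mul0r.
have : ('X - t%:P) *: v = 0.
  apply: (IH r) => //; last by rewrite scalerA -pE.
  by rewrite -ltnS; apply: leq_trans pN; rewrite pE size_Mmonic ?monicXsubC //
    size_XsubC addn2.
by rewrite scalerBl poly_module_X poly_module_C => /subr0_eq /zt.
Qed.

Section LeadingTerms.
Variables (R : idomainType) (n : nat).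
Implicit Types (F G : {mpoly R[n]}) (L : set {mpoly R[n]}).

Definition leading_monomial L (m : 'X_{1..n}) :=
  exists F, [/\ L F, F != 0 & mlead F = m].

Lemma mlead_max F m : m \in msupp F ->
  (forall m', m' \in msupp F -> (m' <= m)%O) -> mlead F = m.
Proof.
move=> mF Fm; apply/eqP; rewrite eq_le (msupp_le_mlead mF) andbT; apply: Fm.
by apply: mlead_supp; apply: contraTneq mF => ->; rewrite msupp0.
Qed.

(** Finitely many leading monomials generate all of them, so that division by L
    needs to invert only one element d of the base ring. *)
Lemma leading_reduction L :
  (L 0) -> (forall F G, L F -> L G -> L (F + G)) -> (forall a F, L F -> L (a
    *: F)) ->
  (forall g F, L F -> F != 0 -> exists S r,
     [/\ L S, mlead S = (g + mlead F)%MM & F@_(mlead F) = r * S@_(mlead S)]) ->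
  exists2 d : R, d != 0 & forall G, exists N F G',
    [/\ L F, d ^+ N *: G = F + G' & forall m, m \in msupp G' -> ~
      leading_monomial L m].
Proof.
move=> L0 LD LZ Lshift.
have [s [sL Ls]] := dickson (leading_monomial L).
have gens m : exists F, m \in s -> [/\ L F, F != 0 & mlead F = m].
  have [/sL[F FP]|_] := boolP (m \in s); first by exists F.
  by exists 0.
have [Fs FsP] := choice gens.
exists (\prod_(m <- s) (Fs m)@_(mlead (Fs m))).
  rewrite prodf_seq_neq0; apply/allP => m /FsP[_ F0 _] /=.
  by rewrite mleadc_eq0.
set d := \prod_(m <- s) _.
suff main (m : 'X_{1..n}) G : (forall m', m' \in msupp G -> (m' <= m)%O) ->
  exists N F G', [/\ L F, d ^+ N *: G = F + G'
    & forall m, m \in msupp G' -> ~ leading_monomial L m].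
  move=> G; apply: (main (mlead G)) => m'; exact: msupp_le_mlead.
elim/(well_founded_ind (@ltom_wf n)): m G => m IH G Gm.
have lower H : (forall m', m' \in msupp H -> (m' <= m)%O) -> H@_m = 0 ->
    exists N F G', [/\ L F, d ^+ N *: H = F + G'
      & forall m, m \in msupp G' -> ~ leading_monomial L m].
  move=> Hm Hm0; have [->|H0] := eqVneq H 0.
    by exists 0%N, 0, 0; rewrite scaler0 addr0; split=> // m'; rewrite msupp0.
  apply: (IH (mlead H)) => [|m']; last exact: msupp_le_mlead.
  rewrite lt_neqAle Hm ?mlead_supp // andbT.
  by apply: contra_neq H0 => Hm1; apply/eqP; rewrite -mleadc_eq0 Hm1 Hm0.
have [mL|nmL] := pselect (leading_monomial L m).
  have [m' m's m'm] := Ls m mL.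
  have [LF F0 Fm'] := FsP m' m's; set F0' := Fs m' in LF F0 Fm'.
  have [S [r [LS Slead SF]]] := Lshift (m - m')%MM F0' LF F0.
  rewrite Fm' submK // in Slead.
  pose e := (\prod_(m1 <- rem m' s) (Fs m1)@_(mlead (Fs m1))) * r.
  have dE : d = e * S@_m.
    rewrite /d (perm_big _ (perm_to_rem m's)) big_cons /= -/F0' SF Slead /e.
    by rewrite mulrC mulrA.
  pose H := d *: G - (e * G@_m) *: S.
  have [||N [F [G' [LF' HE G'm]]]] := lower H.
  - move=> m1 /msuppB_le; rewrite mem_cat => /orP[] /msuppZ_le; first exact: Gm.
    by move=> m1S; rewrite -Slead; exact: msupp_le_mlead.
  - by rewrite mcoeffB !mcoeffZ dE mulrAC subrr.
  exists N.+1, (F + (d ^+ N * (e * G@_m)) *: S), G'; split=> //.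
    by apply: LD => //; exact: LZ.
  rewrite addrAC -HE /H scalerBr !scalerA -exprSr subrK //.
pose H := G - G@_m *: 'X_[m].
have [||N [F [G' [LF' HE G'm]]]] := lower H.
- move=> m1 /msuppB_le; rewrite mem_cat => /orP[/Gm//|/msuppZ_le].
  by rewrite msuppX inE => /eqP ->.
- by rewrite mcoeffB mcoeffZ mcoeffX eqxx mulr1 subrr.
exists N, F, (G' + (d ^+ N * G@_m) *: 'X_[m]); split=> //.
  by rewrite addrA -HE /H scalerBr scalerA subrK.
move=> m1 /msuppD_le; rewrite mem_cat => /orP[/G'm//|/msuppZ_le].
by rewrite msuppX inE => /eqP ->.
Qed.

End LeadingTerms.

Section SimpleModules.
Variables (k : closedFieldType) (n : nat) (q : 'M[k]_n) (qa :
  mult_antisymmetric q).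
Variables (c : {ffun 'I_n -> int} -> {ffun 'I_n -> int} -> k).
Hypotheses (c_alt : is_alternating_bicharacter c)
  (c2 : forall a b, c a b ^+ 2 = sigma q a b)
  (c1 : forall a b, sigma q a b = 1 -> c a b = 1).
Variables (A : algType k) (x : 'I_n -> A) (X : 'X_{1..n} -> A)
  (Phi : {linear A -> {mpoly k[n]}}).
Hypothesis AX : is_twisted_identification c x X Phi.
Local Notation ce m m' := (c (exponent m) (exponent m')).

Let XM m m' : X m * X m' = ce m m' *: X (m + m')%MM. Proof. by case: AX. Qed.

Lemma XC m m' : X m * X m' = sigma q (exponent m) (exponent m') *: (X m' * X m).
Proof.
rewrite !XM scalerA addmC -c2 (bicharC c_alt (exponent m)) expr2 mulfK //.
exact: (bichar_neq0 c_alt).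
Qed.

Lemma X_ind (K : A -> Prop) : K 0 -> (forall m, K (X m)) ->
  (forall a b, K a -> K b -> K (a + b)) -> (forall t a, K a -> K (t *: a)) ->
  forall a, K a.
Proof.
move=> K0 KX KD KZ a; rewrite -(PhiK AX a).
elim/mpoly_linear_ind: (Phi a) => [m|p r IHp IHr|t p IH].
- by rewrite mextX.
- by rewrite linearD; exact: KD.
- by rewrite linearZ; exact: KZ.
Qed.

Variable M : lmodType A.
Hypothesis M_simple : is_simple_module M.
Local Notation Mk := (scalar_restriction M).
Let Q : set A := [set a | forall v : M, a *: v = 0].
Variable w : {set 'I_n}.
Hypothesis Qw : forall i, Q (x i) <-> i \in w.

Let restrE (t : k) (v : Mk) : t *: v = (t%:A : A) *: (v : M).
Proof. by []. Qed.

Let scaleAk (t : k) (a : A) (v : M) : (t *: a) *: v = (t *: (a *: v : Mk)) :> M.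
Proof. by rewrite restrE scalerA -scalerAl mul1r. Qed.

Definition left_mult (u : A) (v : Mk) : Mk := u *: (v : M).

Lemma left_mult_is_linear u : linear (left_mult u).
Proof.
move=> t v v'; rewrite /left_mult scalerDr restrE scalerA.
by rewrite -scalerAr mulr1 scaleAk.
Qed.

HB.instance Definition _ u :=
  GRing.isLinear.Build k Mk Mk *:%R (left_mult u) (left_mult_is_linear u).

Lemma left_multE u v : left_mult u v = u *: (v : M). Proof. by []. Qed.

(** Schur's lemma for operators commuting with the monomials up to scalars. *)
Lemma normal_bijective (T : {linear Mk -> Mk}) :
  (forall m, exists2 s : k, s != 0 & forall v : Mk,
     left_mult (X m) (T v) = s *: T (left_mult (X m) v)) ->
  (exists v, T v != 0) -> (forall v, T v = 0 -> v = 0) /\ forall u, exists v,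
    T v = u.
Proof.
move=> TX [v0 Tv0]; have [_ Mmax] := M_simple.
have ker_sub : is_submodule [set v : M | T v = 0].
  split=> [|u v /= Tu Tv|a u /= Tu]; first exact: linear0.
    by rewrite (linearD T) Tu Tv addr0.
  elim/X_ind: a => [|m|a b IHa IHb|t a IHa].
  - by rewrite scale0r; exact: linear0.
  - have [s s0 sE] := TX m; have := sE u; rewrite Tu linear0 => /esym/eqP.
    by rewrite scaler_eq0 (negPf s0) => /eqP.
  - by rewrite scalerDl (linearD T) IHa IHb addr0.
  - by rewrite scaleAk (linearZ_LR T) IHa scaler0.
have im_sub : is_submodule [set u : M | exists v, T v = u].
  split=> [|_ _ [u <-] [v <-]|a _ [u <-]]; first by exists 0; exact: linear0.
    by exists (u + v); exact: (linearD T).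
  elim/X_ind: a => [|m|a b [u1 IHa] [u2 IHb]|t a [u1 IHa]] /=.
  - by exists 0; rewrite scale0r; exact: linear0.
  - have [s s0 sE] := TX m; exists (s *: left_mult (X m) u).
    by rewrite (linearZ_LR T) -sE.
  - by exists (u1 + u2); rewrite scalerDl (linearD T) IHa IHb.
  - by exists (t *: u1); rewrite scaleAk (linearZ_LR T) IHa.
split=> [v Tv|u].
  have [N0|NT] := Mmax _ ker_sub.
    by have : [set v : M | T v = 0] v by []; rewrite N0.
  have : [set v : M | T v = 0] v0 by rewrite NT.
  by move=> /= /eqP; rewrite (negPf Tv0).
have [N0|NT] := Mmax _ im_sub.
  have : [set u : M | exists v, T v = u] (T v0) by exists v0.
  by rewrite N0 => /eqP; rewrite (negPf Tv0).
by have : [set u : M | exists v, T v = u] u by rewrite NT.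
Qed.

Let Qprim : is_left_primitive_ideal Q. Proof. by exists M. Qed.
Let J := pullback X Q.
Let JE : Phi @^-1` J = Q. Proof. exact: (pullbackK AX). Qed.
Let Jp : is_tprime c J.
Proof. by apply/(tprimeP c_alt AX); rewrite JE;
  exact: left_primitive_ideal_prime. Qed.
Let QX m : Q (X m) <-> J 'X_[m]. Proof. by rewrite /J /pullback /= mextX. Qed.
Let Jw : in_stratum w J.
Proof.
by move=> i; rewrite -Qw -QX; have [-> _ _ _] := AX.
Qed.

Lemma annihilator_out m (v : M) : ~~ off w m -> X m *: v = 0.
Proof.
move=> mw; suff : Q (X m) by exact.
by apply/QX; apply: (tstratum_out c_alt _ Jw mw); case: Jp.
Qed.

Section CentralFraction.
Variables (al be : 'X_{1..n}).
Hypotheses (bew : off w be) (alS : S_ q w (exponent al - exponent be)).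

Let u t : A := X al - t *: X be.

(** X al - t X be is normal modulo the annihilator because al and be have the same
    pairing with all exponents off w. *)
Lemma central_fraction_normal t m : exists2 s : k, s != 0 & forall v : Mk,
  left_mult (X m) (left_mult (u t) v) = s *: left_mult (u t) (left_mult (X m)
    v).
Proof.
have s_alt := sigma_alternating qa.
have [mw|mw] := boolP (off w m); last first.
  exists 1; rewrite ?oner_neq0 // => v.
  by rewrite !left_multE !annihilator_out // scaler0 scale1r.
exists (sigma q (exponent m) (exponent al)) => [|v];
  first exact: (bichar_neq0 s_alt).
rewrite !left_multE !scalerA -scaleAk.
suff -> : X m * u t = sigma q (exponent m) (exponent al) *: (u t * X m) by [].
have sE : sigma q (exponent m) (exponent be) = sigma q (exponent m) (exponent
  al).
  have := alS.2 (exponent m) (proj1 (off_Gamma w m) mw).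
  rewrite (bicharC s_alt (exponent m)) (bicharBr s_alt) => /(congr1 GRing.inv).
  by rewrite invrK invr1 => /divr1_eq.
rewrite /u mulrBr mulrBl scalerBr -scalerAr -scalerAl.
by rewrite (XC m al) (XC m be) sE !scalerA [t * _]mulrC.
Qed.

(** The fraction X al / X be acts on M by an endomorphism z.  If it is not a
    scalar, M is a module over the field of rational functions in z.  Division
    with leading terms shows on the other hand that, after inverting one nonzero
    polynomial d in z, M has a basis over k[z] formed by standard monomials: so
    z - t cannot be onto when d does not vanish at t. *)
Lemma central_fraction_scalar :
  exists t, forall v : M, (X al - t *: X be) *: v = 0.
Proof.
apply: contrapT => H.
have u_bij t : (forall v, left_mult (u t) v = 0 -> v = 0) /\
    forall v', exists v, left_mult (u t) v = v'.
  apply: normal_bijective; first exact: central_fraction_normal.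
  apply: contrapT => H'; apply: H; exists t => v.
  by apply/eqP; apply: contrapT => /negP uv; apply: H'; exists v.
have [be_inj be_surj] : (forall v, left_mult (X be) v = 0 -> v = 0) /\
    forall v', exists v, left_mult (X be) v = v'.
  apply: normal_bijective => [m|].
    exists (sigma q (exponent m) (exponent be)) => [|v].
      exact: (bichar_neq0 (sigma_alternating qa)).
    by rewrite /= !left_multE !scalerA (XC m be) -scaleAk.
  apply: contrapT => H'; apply: (tstratum_off c_alt Jp Jw bew); apply/QX => v.
  by apply/eqP; apply: contrapT => /negP uv; apply: H'; exists v.
have be_inj2 (v v' : M) : X be *: v = X be *: v' -> v = v'.
  by move=> e; apply/subr0_eq/be_inj; rewrite left_multE scalerBr e subrr.
have [z0 z0E] := choice (fun v : Mk => be_surj (left_mult (X al) v)).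
have zE (v : M) : X be *: (z0 v : M) = X al *: v := z0E v.
have z_lin : linear z0.
  move=> t v v'; apply: be_inj2; apply: etrans (zE _) _.
  apply: etrans (left_mult_is_linear (X al) t v v') _; apply/esym.
  apply: etrans (left_mult_is_linear (X be) t (z0 v) (z0 v')) _.
  by rewrite !left_multE !zE.
pose z : {linear Mk -> Mk} := HB.pack z0 (GRing.isLinear.Build k Mk Mk *:%R z0
  z_lin).
have zX m (v : M) : z (X m *: v) = X m *: (z v : M).
  have [mw|mw] := boolP (off w m); last by rewrite !annihilator_out ?linear0.
  apply: be_inj2; rewrite [LHS]zE !scalerA XC [X be * _]XC.
  have s_alt := sigma_alternating qa.
  have -> : sigma q (exponent al) (exponent m) = sigma q (exponent be)
    (exponent m).
    have := alS.2 (exponent m) (proj1 (off_Gamma w m) mw).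
    by rewrite (bicharBl s_alt) => /divr1_eq.
  by rewrite !scaleAk -!scalerA zE.
have zt t (v : Mk) : z v = t *: v -> v = 0.
  move=> zv; have {}zv : z0 v = t *: v := zv; apply: (u_bij t).1.
  rewrite left_multE scalerBl scaleAk -zE zv.
  by rewrite -[X be *: (t *: v)]/(left_mult (X be) (t *: v)) linearZ subrr.
have zt_surj t (v' : Mk) : exists v : Mk, z v - t *: v = v'.
  have [v uv] := (u_bij t).2 (left_mult (X be) v'); exists v.
  apply: be_inj2; apply: etrans uv.
  rewrite -[LHS]/(left_mult (X be) (z0 v - t *: v)) linearB linearZ /=
    !left_multE.
  by rewrite zE scalerBl scaleAk.
have [[v0 v0N0] Mmax] := M_simple.
have cyclic (v : M) : exists a : A, v = a *: v0.
  have [||NT] := Mmax [set v | exists a : A, v = a *: v0].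
  - split; first by exists 0; rewrite scale0r.
      by move=> _ _ [a ->] [b ->]; exists (a + b); rewrite scalerDl.
    by move=> b _ [a ->]; exists (b * a); rewrite scalerA.
  - move=> N0; have : [set v | exists a : A, v = a *: v0] v0 by exists 1;
    rewrite scale1r.
    by rewrite N0 => /eqP; rewrite (negPf v0N0).
  - by have : [set v | exists a : A, v = a *: v0] v by rewrite NT.
pose W := poly_module z.
have XW m (p : {poly k}) (v : W) : X m *: (p *: v : M) = p *: (X m *: (v : M)
  : W).
  rewrite -[p *: v]/(poly_scale p v) -[RHS]/(poly_scale p _) /poly_scale.
  rewrite -left_multE linear_sum; apply: eq_bigr => i _.
  rewrite linearZ /= left_multE; congr (_ *: _).
  by elim: (i : nat) => //= j <-; exact/esym/zX.
pose ev : {linear {mpoly {poly k}[n]} -> W} := mext (fun m => (X m *: v0 : W)).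
pose L := [set F | ev F = 0].
pose shift g : {linear {mpoly {poly k}[n]} -> {mpoly {poly k}[n]}} :=
  mext (fun m => (ce g m)%:P *: 'X_[{poly k}, g + m]).
have ev_shift g F : ev (shift g F) = X g *: (ev F : M).
  elim/mpoly_linear_ind: F => [m|F G IHF IHG|p F IHF].
  - rewrite /shift /ev /= mextX linearZ /= !mextX poly_module_C.
    by apply: etrans (esym (scaleAk _ _ _)) _; rewrite -XM scalerA.
  - by rewrite !linearD /= IHF IHG;
    exact: esym (@scalerDr A M (X g) (ev F) (ev G)).
  - by rewrite !linearZ /= IHF; exact/esym/XW.
have v0W : v0 != 0 :> W by [].
have X1 : X 0%MM = 1 by exact: (X0 c_alt AX).
have ev1 : ev 'X_[0] = v0 by rewrite /ev /= mextX X1 scale1r.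
have tors (p : {poly k}) (v : W) : p != 0 -> p *: v = 0 -> v = 0.
  by apply: poly_module_torsion_free => t v1; exact: zt.
have [||||d d0 red] := @leading_reduction {poly k} n L.
- exact: linear0.
- move=> F G LF LG; apply: etrans (linearD ev F G) _.
  by rewrite (LF : ev F = 0) (LG : ev G = 0) addr0.
- move=> a F LF; apply: etrans (linearZ_LR ev a F) _.
  by rewrite (LF : ev F = 0) scaler0.
- move=> g F LF F0; exists (shift g F).
  have addgI : injective (fun m => g + m)%MM by exact: addmI.
  have coefE m : (shift g F)@_(g + m) = F@_m * (ce g m)%:P.
    exact: (mcoeff_mext_inj _ _ _ addgI).
  have lead : mlead (shift g F) = (g + mlead F)%MM.
    apply: mlead_max => [|m'].
      rewrite mcoeff_msupp coefE mulf_neq0 ?mleadc_eq0 // polyC_eq0.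
      exact: (bichar_neq0 c_alt).
    have [[m ->]|nm] := pselect (exists m, m' = g + m)%MM.
      rewrite mcoeff_msupp coefE mulf_eq0 negb_or => /andP[+ _].
      by rewrite -mcoeff_msupp lemc_add2r => /msupp_le_mlead.
    rewrite mcoeff_msupp mcoeff_mext_out ?eqxx // => m.
    by apply/eqP => mm; apply: nm; exists m.
  exists ((ce g (mlead F))^-1)%:P; split=> //.
    apply: etrans (ev_shift g F) _; rewrite (LF : ev F = 0).
    exact: (@scaler0 A M (X g)).
  rewrite lead coefE mulrCA -polyCM mulVf ?mulr1 //.
  exact: (bichar_neq0 c_alt).
have [t dt] := closed_nonrootP _ d0.
have [v zv] := zt_surj t v0; have [a va] := cyclic v.
have [G' evG'] : exists G' : {mpoly {poly k}[n]}, ev G' = v.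
  suff [G' G'E] : exists G' : {mpoly {poly k}[n]}, ev G' = a *: v0.
    by exists G'; rewrite G'E va.
  elim/X_ind: a {va} => [|m|a b [G1 IHa] [G2 IHb]|r a [G1 IHa]].
  - by exists 0; rewrite linear0 scale0r.
  - by exists 'X_[m]; rewrite /ev /= mextX.
  - by exists (G1 + G2); rewrite linearD /= IHa IHb scalerDl.
  - by exists (r%:P *: G1); rewrite linearZ /= IHa poly_module_C scaleAk.
have nL0 : ~ leading_monomial L 0%MM.
  move=> [F [LF F0 Flead]]; case/eqP: v0W.
  apply: (tors F@_0%MM); first by rewrite -Flead mleadc_eq0.
  rewrite -ev1 -linearZ -LF; congr (ev _); apply/mpolyP => m.
  rewrite mcoeffZ mcoeffX; case: eqP => [<-|/eqP m0]; first by rewrite mulr1.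
  rewrite mulr0; apply/esym/mcoeff_gt_mlead; rewrite Flead lt_neqAle m0.
  exact: le0m.
have [N [F [G1 [LF dG G1L]]]] := red G'.
pose E := ('X - t%:P) *: G1 - d ^+ N *: 'X_[0].
have LE : L E.
  have -> : E = d ^+ N *: (('X - t%:P) *: G' - 'X_[0]) - ('X - t%:P) *: F.
    rewrite scalerBr scalerA mulrC -scalerA dG scalerDr addrAC.
    by rewrite [_ *: F + _]addrC addrK.
  rewrite /L /= linearB linearZ /= linearB linearZ /= ev1 evG' linearZ /= LF.
  rewrite scaler0 subr0 scalerBl poly_module_X poly_module_C zv.
  by rewrite subrr scaler0.
have EL m : m \in msupp E -> ~ leading_monomial L m.
  move=> /msuppB_le; rewrite mem_cat => /orP[] /msuppZ_le; first exact: G1L.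
  by rewrite msuppX inE => /eqP ->.
have E0 : E = 0.
  apply/eqP; apply: contrapT => /negP E0.
  by apply: (EL (mlead E)); [exact: mlead_supp|exists E].
have := congr1 (fun F => (F@_0%MM).[t]) E0.
rewrite /E mcoeffB !mcoeffZ mcoeffX eqxx mulr1 mcoeff0 hornerD hornerN hornerM.
rewrite !hornerE subrr mul0r sub0r => /eqP;
  rewrite oppr_eq0 expf_eq0 => /andP[_].
by apply/negP.
Qed.

End CentralFraction.

(** On a primitive ideal the fractions with exponents in S_w take values in k;
    at a point where they take the same values, the image is the given ideal. *)
Lemma primitive_point : exists2 a, in_stratum w (point_ideal a) &
  Q = Phi @^-1` graded_core q w (point_ideal a).
Proof.
have Jg := tprime_graded qa c_alt c2 Jp Jw; have [sJ Jout Jc] := Jg.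
have [P [Pp Pw PE]] := tprime_lift qa c_alt c2 c1 Jp Jw.
have [idP _ _] := Pp; have sP := ideal_subspace idP.
pose m : 'X_{1..n} := [multinom nat_of_bool (i \notin w) | i < n].
have mw : off w m by apply/offP => i iw; rewrite mnmE iw.
have [a [Pa ma]] := mpoly_nullstellensatz Pp (stratum_off Pp Pw mw).
have aw : in_stratum w (point_ideal a).
  apply/point_stratum => i; split=> [ai|/Pw/Pa]; last by rewrite mevalXU.
  apply: contrapT => /negP iw; case/eqP: ma; rewrite mevalX (bigD1 i) //=.
  by rewrite mnmE iw ai expr1 mul0r.
have Ja : J `<=` point_ideal a.
  move=> f; rewrite -PE => /(graded_core_sub qa sP) H.
  by apply/Pa/H => m'; exact: stratum_out.
exists a => //; rewrite -JE;
  suff -> : J = graded_core q w (point_ideal a) by [].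
apply/seteqP; split; first exact: graded_core_max.
move=> f fC; apply: (components_suffice qa sJ Jout) => m0; have := fC m0.
set g := component _ _ _ _ => ga.
have gh : homogeneous q w m0 g by exact: component_homogeneous.
have [->|g0] := eqVneq g 0; first by case: sJ.
have m1g := mlead_supp g0; set m1 := mlead g in m1g.
have m1m0 : in_class q w m0 m1 by exact: gh.
have m1w : off w m1 by case/andP: m1m0.
have [J0 JD JZ] := sJ.
have [t gt] : exists t, J (g - t *: 'X_[m1]).
  apply: (@subspace_supp _ _ [set g | exists t, J (g - t *: 'X_[m1])] g).
    split=> [|h h' [t Jt] [t' Jt']|r h [t Jt]].
    - by exists 0; rewrite scale0r subr0.
    - by exists (t + t'); rewrite scalerDl opprD addrACA; exact: JD.
    - by exists (r * t); rewrite -scalerA -scalerBr; exact: JZ.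
  move=> m2 /gh m2m0.
  have /andP[m2w /asboolP m2S] := in_class_trans qa (in_class_sym qa m1m0) m2m0.
  have [t tE] := central_fraction_scalar m1w m2S; exists t.
  by rewrite /J /pullback /= linearB linearZ /= !mextX => v; exact: tE.
have : (g - t *: 'X_[m1]).@[a] = 0 by exact: Ja.
rewrite mevalB mevalZ (ga : g.@[a] = 0) sub0r => /eqP.
rewrite oppr_eq0 mulf_eq0 (negPf (meval_mon_neq0 aw m1w)) orbF => /eqP t0.
by move: gt; rewrite t0 scale0r subr0.
Qed.

End SimpleModules.

(** * The quotient maps *)

Lemma closed_subtypeP (T : topologicalType) (S : set T) (W : set S) :
  closed W <-> exists2 C : set T, closed C & W = val @^-1` C.
Proof.
rewrite -openC; split=> [[U oU UW]|[C cC WC]].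
  exists (~` U); first by rewrite closedC.
  by rewrite preimage_setC -[W]setCK -UW.
by exists (~` C); [rewrite openC|rewrite WC preimage_setC].
Qed.

Lemma meval_weight (k : fieldType) (n : nat) (h : torus k n) (a : 'I_n -> k) f :
  (mdiag (weight h) f).@[a] = f.@[fun i => h i * a i].
Proof.
elim/mpoly_linear_ind: f => [m|p r IHp IHr|t p IH].
- rewrite mdiagX mevalZ !mevalX /weight -big_split.
  by apply: eq_bigr => i _; rewrite exprMn.
- by rewrite linearD !mevalD IHp IHr.
- by rewrite linearZ /= !mevalZ IH.
Qed.

Section Fibres.
Variables (k : closedFieldType) (n : nat) (q : 'M[k]_n) (qa :
  mult_antisymmetric q).
Variables (actR : torus_action n {mpoly k[n]})
  (actR_std : is_standard_action (coordinates k n) actR).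

Lemma act_point h (a : 'I_n -> k) :
  actR h @` point_ideal a = point_ideal (fun i => (h i)^-1 * a i).
Proof.
rewrite act_imageE; apply/seteqP.
split=> f; rewrite /point_ideal /= (actRE actR_std) meval_weight => <-;
  by apply: meval_eq => i; rewrite ffunE.
Qed.

(** Every element of S_w is the difference of the exponents of two monomials;
    the ratio of their values at a can be read off the graded core, so two points
    with the same core differ by an element of the orthogonal of S_w. *)
Lemma same_core_orbit w (a b : 'I_n -> k) :
  in_stratum w (point_ideal a) -> in_stratum w (point_ideal b) ->
  graded_core q w (point_ideal a) = graded_core q w (point_ideal b) ->
  exists2 h, S_perp q w h & actR h @` point_ideal a = point_ideal b.
Proof.
move=> aw bw ab; have [/point_stratum aP /point_stratum bP] := (aw, bw).
pose hf : {ffun 'I_n -> k} := [ffun i => if i \in w then 1 else a i / b i].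
have hf0 : [forall i, hf i != 0].
  apply/forallP => i; rewrite ffunE; case: ifPn => [_|iw];
    first exact: oner_neq0.
  rewrite mulf_neq0 ?invr_neq0 //; first by apply: contraNneq iw => /aP.
  by apply: contraNneq iw => /bP.
pose h := Torus hf0.
have hE m : off w m -> weight h m = ('X_[m]).@[a] / ('X_[m]).@[b].
  move=> /offP mw; rewrite !mevalX -prodf_div; apply: eq_bigr => i _.
  rewrite ffunE; case: ifP => [/mw ->|_]; first by rewrite !expr0 divr1.
  by rewrite expr_div_n.
exists h; last first.
  rewrite act_point; apply/seteqP.
  have e : (fun i => (h i)^-1 * a i) =1 b.
    move=> i; rewrite ffunE; case: ifPn => [iw|iw].
      by rewrite (aP i).2 // (bP i).2 // mulr0.
    rewrite invfM invrK mulrAC mulVf ?mul1r //.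
    by apply: contraNneq iw => /aP.
  by split=> f; rewrite /point_ideal /= (meval_eq _ e).
move=> s sS; have [/Gamma_P sw _] := sS.
pose al : 'X_{1..n} := [multinom (if (0 <= s i)%R then `|s i|%N else 0%N) | i
  < n].
pose be : 'X_{1..n} := [multinom (if (0 <= s i)%R then 0%N else `|s i|%N) | i
  < n].
have sE : exponent al - exponent be = s.
  apply/ffunP => i; rewrite !ffunE !mnmE; case: ifPn => [s0|].
    by rewrite subr0 abszE ger0_norm.
  by rewrite -ltNge => s0; rewrite sub0r abszE ltr0_norm // opprK.
have alw : off w al by apply/offP => i /sw si; rewrite mnmE si.
have bew : off w be by apply/offP => i /sw si; rewrite mnmE si.
rewrite -sE pairingD pairingN !pairing_exponent !hE //.
have a0 := meval_mon_neq0 aw; have b0 := meval_mon_neq0 bw.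
pose t := ('X_[al]).@[a] / ('X_[be]).@[a].
have gh : homogeneous q w be ('X_[al] - t *: 'X_[be]).
  move=> m /msuppB_le; rewrite mem_cat => /orP[|/msuppZ_le];
    rewrite msuppX inE => /eqP ->; last exact: in_class_refl.
  by apply/andP; split=> //; apply/asboolP; rewrite sE.
have : graded_core q w (point_ideal a) ('X_[al] - t *: 'X_[be]).
  move=> m; have [->|->] := component_or qa m gh;
    rewrite /point_ideal /= ?meval0 //.
  by rewrite mevalB mevalZ /t divfK ?subrr ?a0.
rewrite ab => /(_ be); rewrite (component_id gh) /point_ideal /= mevalB mevalZ.
move=> /subr0_eq ->; have a0' := a0 _ bew.
have t0 : t != 0 by rewrite mulf_neq0 ?invr_neq0 ?a0.
have -> : ('X_[al]).@[a] = t * ('X_[be]).@[a] by rewrite divfK.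
by rewrite -[t * _ / (t * _)]mulf_div divff // mul1r divff // mulf_neq0
  ?invr_neq0 ?b0.
Qed.

End Fibres.

Section QuotientMaps.
Variables (k : closedFieldType) (n : nat) (q : 'M[k]_n) (qa :
  mult_antisymmetric q).
Variables (c : {ffun 'I_n -> int} -> {ffun 'I_n -> int} -> k).
Hypotheses (c_alt : is_alternating_bicharacter c)
  (c2 : forall a b, c a b ^+ 2 = sigma q a b)
  (c1 : forall a b, sigma q a b = 1 -> c a b = 1).
Variables (A : algType k) (x : 'I_n -> A) (X : 'X_{1..n} -> A)
  (Phi : {linear A -> {mpoly k[n]}}).
Hypothesis AX : is_twisted_identification c x X Phi.
Variables (actA : torus_action n A) (actA_std : is_standard_action x actA)
  (actR : torus_action n {mpoly k[n]})
  (actR_std : is_standard_action (coordinates k n) actR).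

Local Notation phi := (phi qa c_alt c2 c1 AX).

Lemma phi_max_primitive (P : max_spec {mpoly k[n]}) :
  phi (val P) \in prim_spec A.
Proof.
apply/mem_set; change (is_left_primitive_ideal (phi (val P))).
have [a Pa] := maximal_point (set_mem (valP P)).
have Pw := in_stratum_of (val P); rewrite (phiE qa c_alt c2 c1 AX Pw) Pa.
by apply: (point_primitive qa c_alt c2 c1 AX); rewrite -Pa.
Qed.

Definition psi (P : max_spec {mpoly k[n]}) : prim_spec A :=
  SigSub (phi_max_primitive P).

(** A primitive ideal is the annihilator of a simple module, to which the
    description by a point applies. *)
Lemma psi_surjective (Q : prim_spec A) : exists P, psi P = Q.
Proof.
have [M Msimple QM] := set_mem (valP Q).
pose w := stratum_of x (val Q).
have Qw i : [set a | forall v : M, a *: v = 0] (x i) <-> i \in w.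
  by rewrite -QM inE; split=> /asboolP.
have [a aw Qa] := primitive_point qa c_alt c2 c1 AX Msimple Qw.
pose P := Spec (maximal_ideal_prime (point_ideal_maximal a)).
have Pmax : P \in max_spec {mpoly k[n]} by apply/mem_set/point_ideal_maximal.
have Pw : in_stratum w P := aw.
exists (SigSub Pmax); apply/val_inj/spec_inj.
by apply: etrans (phiE qa c_alt c2 c1 AX Pw) _; rewrite [in RHS]QM Qa.
Qed.

Lemma phi_quotient_map : topological_quotient_map phi.
Proof.
split=> [|W].
  apply/seteqP; split=> // Q _.
  by have [P <-] := phi_surjective qa c_alt c2 c1 AX Q; exists P.
have T : (_ <-> _) := closed_transfer qa c_alt c2 c1 AX actR_std W
  (fun h P (_ : setT P) => I).
rewrite !zariski_closedP; split=> [[J idJ WJ]|[K idK WK]].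
  have [|K idK KE] := T.1; first by exists J => // P _; rewrite WJ.
  by exists K => //; apply/seteqP; split=> P; rewrite /= KE.
have [|J idJ JE] := T.2.
  by exists K => // P _; rewrite -[W _]/((phi @^-1` W) P) WK.
exists J => //; apply/seteqP; split=> Q;
  by have [P <-] := phi_surjective qa c_alt c2 c1 AX Q; rewrite JE.
Qed.

Lemma psi_quotient_map : topological_quotient_map psi.
Proof.
split=> [|W].
  by apply/seteqP; split=> // Q _; have [P <-] := psi_surjective Q; exists P.
pose W' := val @` W : set (spec A).
have W'E (P : max_spec {mpoly k[n]}) : W' (phi (val P)) <-> W (psi P).
  split=> [[Q WQ QP]|WP]; last by exists (psi P).
  by rewrite (_ : psi P = Q) //; apply: val_inj.
have M_act h (P : spec {mpoly k[n]}) : max_spec _ P -> max_spec _ (spec_act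
  actR h P).
  exact: act_image_maximal.
have lift (P : spec {mpoly k[n]}) :
    max_spec _ P -> exists P' : max_spec {mpoly k[n]}, val P' = P.
  by move=> Pm; exists (SigSub (mem_set Pm)).
have T : (_ <-> _) := closed_transfer qa c_alt c2 c1 AX actR_std W' M_act.
rewrite !closed_subtypeP; split=> -[C /zariski_closedP [J idJ ->] CE].
  have [|K idK KE] := T.1.
    exists J => // P Pm; have [P' <-] := lift P Pm.
    by rewrite W'E CE.
  exists (vanishing K); first by apply/zariski_closedP; exists K.
  apply/seteqP; split=> P; rewrite /preimage /= -W'E KE //;
    exact: set_mem (valP P).
have [|K idK KE] := T.2.
  exists J => // P Pm; have [P' <-] := lift P Pm.
  by rewrite W'E -[W _]/((psi @^-1` W) P') CE.
exists (vanishing K); first by apply/zariski_closedP; exists K.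
apply/seteqP; split=> Q; have [P <-] := psi_surjective Q;
  rewrite /preimage /= -W'E KE //; exact: set_mem (valP P).
Qed.

Lemma psi_fibre w (P : max_spec {mpoly k[n]}) : in_stratum w (val P) ->
  psi @^-1` [set psi P] = max_orbit actR (S_perp q w) P.
Proof.
move=> Pw; apply/seteqP; split=> [P' /= PP'|_ [g gS <-]]; last first.
  by apply: val_inj; exact: (phi_perp qa c_alt c2 c1 AX actR_std Pw gS).
have {}PP' : phi (val P') = phi (val P) 
  by exact: (congr1 (fun Q : prim_spec A => val Q) PP').
have Pw' : in_stratum w (val P').
  by apply/(phi_stratum qa c_alt c2 c1 AX); rewrite PP'; apply/phi_stratum.
have PE := pullback_phi qa c_alt c2 c1 AX Pw.
have := pullback_phi qa c_alt c2 c1 AX Pw'; rewrite PP' PE.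
have [a Pa] := maximal_point (set_mem (valP P)).
have [b Pb] := maximal_point (set_mem (valP P')).
rewrite Pa Pb; rewrite Pa in Pw; rewrite Pb in Pw'.
move=> /(same_core_orbit qa actR_std Pw Pw')[h hS hab].
by exists h => //; apply/val_inj/spec_inj; rewrite /= Pa Pb.
Qed.

End QuotientMaps.

Theorem mainTheorem1 (k : closedFieldType) (n : nat) (q : 'M[k]_n)
    (q_antisym : mult_antisymmetric q)
    (q_N1 : ~ entry_group q (-1) \/ 2%N \in [pchar k])
    (A : algType k) (x : 'I_n -> A) (A_qas : is_quantum_affine_space q x)
    (actA : torus_action n A) (actA_std : is_standard_action x actA)
    (actR : torus_action n {mpoly k[n]})
    (actR_std : is_standard_action (coordinates k n) actR) :
  (exists c, is_square_root_cocycle q c) /\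
  forall c, is_square_root_cocycle q c ->
  exists (X : 'X_{1..n} -> A) (Phi : {linear A -> {mpoly k[n]}}),
    is_twisted_identification c x X Phi /\
  exists (phi : spec {mpoly k[n]} -> spec A)
         (psi : max_spec {mpoly k[n]} -> prim_spec A),
    [/\ topological_quotient_map phi /\ topological_quotient_map psi,
        forall h P, phi (spec_act actR h P) = spec_act actA h (phi P),
        forall h P,
          val (psi (max_spec_act actR h P)) = spec_act actA h (val (psi P)),
        (forall w P, spec_stratum (coordinates k n) w P ->
          ideal_of (phi P) = Phi @^-1` colon actR (ideal_of P) (S_perp q w)) /\
        (forall w P, spec_stratum (coordinates k n) w (val P) ->
          ideal_of (val (psi P)) =
            Phi @^-1` colon actR (ideal_of (val P)) (S_perp q w))
      & forall w : {set 'I_n},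
          [set psi @^-1` [set Q] | Q in [set Q | spec_stratum x w (val Q)]] =
          [set max_orbit actR (S_perp q w) P
             | P in [set P | spec_stratum (coordinates k n) w (val P)]]].
Proof.
have [xq univ] := A_qas.
split; first exact: exists_square_root_cocycle.
move=> c [c_alt c2 c1].
have [X [Phi AX]] := exists_twisted_identification c_alt c2 A_qas.
exists X, Phi; split=> //.
exists (phi q_antisym c_alt c2 c1 AX), (psi q_antisym c_alt c2 c1 AX); split.
- split; first exact: phi_quotient_map actR_std.
  exact: psi_quotient_map actR_std.
- exact: (phi_act q_antisym c_alt c2 c1 AX actA_std actR_std).
- by move=> h P; exact: (phi_act q_antisym c_alt c2 c1 AX actA_std actR_std h
  (val P)).
- split=> w P /coordinates_stratum Pw; rewrite colonE //.
    exact: phiE.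
  exact: (phiE q_antisym c_alt c2 c1 AX Pw).
- move=> w; apply/seteqP;
  split=> [_ [Q Qw <-]|_ [P /coordinates_stratum Pw <-]].
    have [P PQ] := psi_surjective q_antisym c_alt c2 c1 AX Q.
    have Pw : in_stratum w (val P).
      by apply/(phi_stratum q_antisym c_alt c2 c1 AX); rewrite -PQ in Qw.
    exists P; first by apply/coordinates_stratum.
    by rewrite -(psi_fibre q_antisym c_alt c2 c1 AX actR_std Pw) PQ.
  exists (psi q_antisym c_alt c2 c1 AX P).
    by apply/(phi_stratum q_antisym c_alt c2 c1 AX).
  exact: psi_fibre.
Qed.
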